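(* Let $F$ be a graph with $e_F>0$ which is not a forest. For every $\varepsilon>0$ there exists a constant $c=c(F,\varepsilon)>0$ such that the following holds for $n\in\mathbb{N}$ divisible by $v_F$: if $p\ge c\,n^{-1/m_1(F)}$ and $G$ is an $n$-vertex graph with at least $\varepsilon n^2$ edges, then with high probability $G\cup G(n,p)$ contains an $F$-factor.
   Context: For a graph $F$, $v_F$ and $e_F$ denote its numbers of vertices and edges. For $F$ with at least two vertices, $m_1(F):=\max\{e_{F'}/(v_{F'}-1): F'\subseteq F,\ v_{F'}\ge 2\}$. $G(n,p)$ is the binomial random graph on the same vertex set as $G$, in which each pair of vertices is an edge independently with probability $p$; $G\cup G(n,p)$ is the graph on this vertex set whose edge set is the union of the two edge sets. An $F$-factor of a graph is a collection of vertex-disjoint copies of $F$ covering all vertices. ''With high probability'' means with probability tending to $1$ as $n\to\infty$. *)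

(* Defs.v *)
From HB Require Import structures.
From mathcomp Require Import all_boot all_order all_algebra.
From mathcomp Require Import reals.

Set Implicit Arguments.
Unset Strict Implicit.
Unset Printing Implicit Defensive.

Import Order.TTheory GRing.Theory Num.Theory.

Local Open Scope ring_scope.

Definition pairs (V : finType) : {set {set V}} := [set e : {set V} | #|e| == 2].

(* Finite simple graphs on the vertex set V, given by their edge sets; a
   subtype of {set {set V}}, hence a finType over which one can sum. *)
Record sgraph (V : finType) :=
  SGraph { edges : {set {set V}}; _ : edges \subset pairs V }.

HB.instance Definition _ (V : finType) := [isSub for @edges V].
HB.instance Definition _ (V : finType) := [Finite of sgraph V by <:].

Lemma edges_sub (V : finType) (G : sgraph V) : edges G \subset pairs V.
Proof. by case: G. Qed.

Definition adj (V : finType) (G : sgraph V) : rel V :=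
  fun x y => [set x; y] \in edges G.

Lemma gunion_subproof (V : finType) (G H : sgraph V) :
  edges G :|: edges H \subset pairs V.
Proof. by rewrite subUset !edges_sub. Qed.

Definition gunion (V : finType) (G H : sgraph V) : sgraph V :=
  SGraph (gunion_subproof G H).

(* A forest has no cycle; the length bound excludes [::], which is trivially a
   ucycle, and the closed walks x, y, x. *)
Definition forest (V : finType) (G : sgraph V) : Prop :=
  forall s : seq V, (2 < size s)%N -> ~~ ucycleb (adj G) s.

(* (W, D) is a subgraph of G with vertex set W and edge set D; it need neither
   be induced nor spanning. *)
Definition subgraph (V : finType) (G : sgraph V)
    (S : {set V} * {set {set V}}) : bool :=
  (S.2 \subset edges G) && (cover S.2 \subset S.1).

Definition m1 (R : realType) (V : finType) (F : sgraph V) : R :=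
  \big[Num.max/0]_(S : {set V} * {set {set V}}
                     | subgraph F S && (2 <= #|S.1|)%N)
    (#|S.2|%:R / (#|S.1|%:R - 1)).

(* A copy of F in G is a subgraph of G isomorphic to F. *)
Definition copy (U V : finType) (F : sgraph U) (G : sgraph V)
    (S : {set V} * {set {set V}}) : bool :=
  subgraph G S &&
  [exists f : {ffun U -> V},
     [&& injectiveb f, S.1 == f @: [set: U]
       & S.2 == [set f @: e | e : {set U} in edges F]]].

Definition factor (U V : finType) (F : sgraph U) (G : sgraph V)
    (T : {set {set V} * {set {set V}}}) : bool :=
  [&& [forall S in T, copy F G S],
      [forall S in T, forall S' in T,
         (S != S') ==> [disjoint S.1 & S'.1]]
    & \bigcup_(S in T) S.1 == [set: V]].

Definition has_factor (U V : finType) (F : sgraph U) (G : sgraph V) : bool :=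
  [exists T : {set {set V} * {set {set V}}}, factor F G T].

(* Probability mass of H under the binomial random graph G(n, p) on V. *)
Definition gnp_mass (R : realType) (V : finType) (p : R) (H : sgraph V) : R :=
  \prod_(e in pairs V) (if e \in edges H then p else 1 - p).

Definition gnp_prob (R : realType) (V : finType) (p : R)
    (A : pred (sgraph V)) : R :=
  \sum_(H : sgraph V | A H) gnp_mass p H.

(* Main.v *)
(* A dense graph [G] contains disjoint linear-sized sets [X], [Y] such that any two not
   too small subsets [A] of [X] and [B] of [Y] span a fixed proportion of all possible
   edges: take the pair maximising [e(X,Y)^(s+1) / (|X||Y|)^s].  By Janson's
   inequality the random graph contains a transversal copy of [F] in any disjoint
   linear-sized vertex classes, so a greedy choice of copies covers all but a small
   linear number of vertices.  It need not have a copy of [F] through a given vertex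
   [v], because of the subgraphs of [F] through the root of density [m1].  By
   uncrossing, each of these contains an edge of one fixed matching avoiding the root,
   and the copies through [v] may take the edges of this matching from [G] between [X]
   and [Y].  The remaining slack is a power of [n]; hence, among any not too
   small set of uncovered vertices, some can still be covered, and after boundedly many
   rounds, each using fresh vertices and shrinking the uncovered set by a power of [n],
   nothing is left.

   To finish exactly, fix disjoint copies ("tiles") of [F] inside [X] beforehand.  A
   vertex [y] of [Y] joined by [G] to a whole tile may replace any vertex of it.  Since
   the law of the random graph is invariant under relabelling [X], the tiles behave
   like uniformly random sets of vertices, so regularity of the pair gives Hall's
   condition between the tiles and the last vertices of [Y]. *)

(* The random graph is exposed only once: it enters through four events, each uniform over all
   vertex classes that may come up later, and the factor is then built deterministically. A union
   bound over all families of classes costs [2 ^+ (#|V| * k)], which a failure probability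
   [expR (- C n)] beats when [C] is large; hence [c] is fixed only after the constants [gam] and
   [rho] that enter [C]. For copies rooted at one vertex, a tight set [D] leaves
   [n^(|D|-1) p^(e(D))] of constant order when [p] is at the threshold, so no such bound is
   available. Edges borrowed from [G] raise it by a power of [n], recorded as [K ^ 3]. With
   [l >= n / K ^ 2] roots the exponent [l K ^ 3 >= K n] still pays for all classes; with fewer roots
   the exponent [l K ^ 2] pays for the [(n+1)^((K+1) l)] choices of the roots and of [K l] used
   vertices. The borrowed edges form a matching because regularity then applies to one pair of
   classes at a time, each costing a factor [d] in the number of embeddings. Only lower bounds on
   edge counts are ever used, so a one-sided form of regularity is enough. *)
Require Import Defs.
From mathcomp Require Import all_boot all_order all_fingroup all_algebra.
From mathcomp Require Import reals sequences exp.
From mathcomp Require Import ring lra zify.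

Set Implicit Arguments.
Unset Strict Implicit.
Unset Printing Implicit Defensive.

Import Order.TTheory GRing.Theory Num.Theory.
Local Open Scope ring_scope.

(** * Harris and Janson inequalities *)

Section BernoulliExpectation.
Variables (R : realType) (T : finType).
Implicit Types (p : R) (s : seq T) (f g : {set T} -> R).

(* The expectation of [f] at the random subset of [s] that contains each element
   with probability [p], revealed one element at a time so that statements about
   product measures are proved by induction on [s]. *)
Fixpoint bexp p s f : R :=
  if s is e :: s' then p * bexp p s' (fun S => f (e |: S)) + (1 - p) * bexp p s' f
  else f set0.

Lemma eq_bexp p s f g :
  (forall S : {set T}, {subset S <= s} -> f S = g S) -> bexp p s f = bexp p s g.
Proof.
elim: s f g => [|e s IH] f g fg /=; first by apply: fg => x; rewrite inE.
congr (_ * _ + _ * _); apply: IH => S sS; apply: fg => x.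
  by rewrite !inE => /orP[->//|/sS ->]; rewrite orbT.
by move=> /sS xs; rewrite inE xs orbT.
Qed.

Lemma bexpD p s f g : bexp p s (fun S => f S + g S) = bexp p s f + bexp p s g.
Proof. by elim: s f g => [|e s IH] f g //=; rewrite !IH; ring. Qed.

Lemma bexpZ p s c f : bexp p s (fun S => c * f S) = c * bexp p s f.
Proof. by elim: s f => [|e s IH] f //=; rewrite !IH; ring. Qed.

Lemma bexp_cst p s c : bexp p s (fun=> c) = c.
Proof. by elim: s => [|e s IH] //=; rewrite !IH; ring. Qed.

Lemma bexp_sum p s (I : Type) (r : seq I) (P : pred I) (F : I -> {set T} -> R) :
  bexp p s (fun S => \sum_(i <- r | P i) F i S) =
  \sum_(i <- r | P i) bexp p s (F i).
Proof.
elim: r => [|i r IH].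
  rewrite big_nil -[RHS](bexp_cst p s); apply: eq_bexp => S _; exact: big_nil.
rewrite big_cons; case Pi: (P i); rewrite -IH -?bexpD; apply: eq_bexp => S _;
  by rewrite big_cons Pi.
Qed.

Lemma le_bexp p s f g : 0 <= p <= 1 ->
  (forall S : {set T}, {subset S <= s} -> f S <= g S) -> bexp p s f <= bexp p s g.
Proof.
move=> /andP[p0 p1]; elim: s f g => [|e s IH] f g fg /=.
  by apply: fg => x; rewrite inE.
apply: lerD; apply: ler_wpM2l; rewrite ?subr_ge0 //; apply: IH => S sS;
  apply: fg => x; first by rewrite !inE => /orP[->//|/sS ->]; rewrite orbT.
by move=> /sS xs; rewrite inE xs orbT.
Qed.

Lemma bexp_ge0 p s f : 0 <= p <= 1 -> (forall S, 0 <= f S) -> 0 <= bexp p s f.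
Proof. by move=> p01 f0; rewrite -(bexp_cst p s 0); apply: le_bexp. Qed.

(** Revealing one element leaves the deficit [p (1 - p) (a1 - a0) (b0 - b1)], nonnegative because
    [f] increases and [g] decreases; the two conditional terms follow by induction. *)
Lemma harris p s f g : 0 <= p <= 1 ->
  (forall A B : {set T}, A \subset B -> f A <= f B) ->
  (forall A B : {set T}, A \subset B -> g B <= g A) ->
  bexp p s (fun S => f S * g S) <= bexp p s f * bexp p s g.
Proof.
move=> p01; have /andP[p0 p1] := p01.
elim: s f g => [|e s IH] f g fi gd //=.
have IH1 := IH (fun S => f (e |: S)) (fun S => g (e |: S)).
have {}IH1 := IH1 (fun A B AB => fi _ _ (setUS _ AB)) (fun A B AB => gd _ _ (setUS _ AB)).
have IH0 := IH _ _ fi gd.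
have f01 : bexp p s f <= bexp p s (fun S => f (e |: S)).
  by apply: le_bexp => // S _; apply/fi/subsetUr.
have g10 : bexp p s (fun S => g (e |: S)) <= bexp p s g.
  by apply: le_bexp => // S _; apply/gd/subsetUr.
set a1 := bexp p s (fun S => f (e |: S)) in IH1 f01 *.
set b1 := bexp p s (fun S => g (e |: S)) in IH1 g10 *.
set a0 := bexp p s f in IH0 f01 *; set b0 := bexp p s g in IH0 g10 *.
apply: (@le_trans _ _ (p * (a1 * b1) + (1 - p) * (a0 * b0))).
  by apply: lerD; apply: ler_wpM2l; rewrite ?subr_ge0.
rewrite -subr_ge0.
rewrite (_ : _ - _ = (p * (1 - p)) * ((a1 - a0) * (b0 - b1))); last by ring.
by rewrite !mulr_ge0 ?subr_ge0.
Qed.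

Lemma bexp_indep p s f g :
  (forall e, e \in s -> (forall S, f (e |: S) = f S) \/ (forall S, g (e |: S) = g S)) ->
  bexp p s (fun S => f S * g S) = bexp p s f * bexp p s g.
Proof.
elim: s f g => [|e s IH] f g fg //=.
have ind f' g' : (forall e, e \in s ->
    (forall S, f' (e |: S) = f' S) \/ (forall S, g' (e |: S) = g' S)) ->
  bexp p s (fun S => f' S * g' S) = bexp p s f' * bexp p s g' by apply: IH.
rewrite !ind; first last.
- move=> e' e's; have e'es : e' \in e :: s by rewrite inE e's orbT.
  by case: (fg e' e'es) => h; [left|right] => S; rewrite setUCA h.
- by move=> e' e's; apply: fg; rewrite inE e's orbT.
have [h|h] := fg e (mem_head _ _).
  rewrite (eq_bexp p (f := fun S => f (e |: S)) (g := f)) => [|S _]; last exact: h.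
  by ring.
rewrite (eq_bexp p (f := fun S => g (e |: S)) (g := g)) => [|S _]; last exact: h.
by ring.
Qed.

Lemma bexp_subset p s (A : {set T}) : uniq s -> {subset A <= s} ->
  bexp p s (fun S => (A \subset S)%:R) = p ^+ #|A|.
Proof.
elim: s A => [|e s IH] A /=.
  move=> _ A0; have -> : A = set0.
    by apply/setP => x; rewrite inE; apply/negP => /A0.
  by rewrite sub0set cards0 expr0.
case/andP=> es us sA; have [eA|eA] := boolP (e \in A).
  rewrite (eq_bexp p (g := fun S => ((A :\ e) \subset S)%:R)); last first.
    by move=> S _; rewrite subDset.
  rewrite IH //; last first.
    move=> x; rewrite !inE => /andP[xe /sA]; rewrite inE (negPf xe) //.
  rewrite (eq_bexp p (g := fun=> 0)); last first.
    move=> S sS; case: (boolP (A \subset S)) => // /subsetP /(_ _ eA) /sS.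
    by rewrite (negPf es).
  by rewrite bexp_cst mulr0 addr0 (cardsD1 e A) eA exprS.
have sA' : {subset A <= s}.
  move=> x xA; move: (sA _ xA); rewrite inE => /orP[/eqP xe|//].
  by rewrite -xe xA in eA.
rewrite (eq_bexp p (f := fun S => (A \subset e |: S)%:R) (g := fun S => (A \subset S)%:R)).
  by rewrite IH //; ring.
move=> S sS; congr (nat_of_bool _)%:R.
have eS : e \notin S by apply/negP => /sS; rewrite (negPf es).
apply/subsetP/subsetP => h x xA; last by rewrite inE h ?orbT.
move: (h _ xA); rewrite !inE => /orP[/eqP xe|//].
by rewrite -xe xA in eA.
Qed.

End BernoulliExpectation.

Section Janson.
Variables (R : realType) (T I : finType) (p : R) (s : seq T) (A : I -> {set T}).
Hypotheses (p01 : 0 <= p <= 1) (us : uniq s) (As : forall i, {subset A i <= s}).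

Let meet i j := ~~ [disjoint A i & A j].
Let avoid (l : seq I) (S : {set T}) : R := (all (fun i => ~~ (A i \subset S)) l)%:R.

(* Janson's correlation sum, with each unordered pair of [l] counted once. *)
Fixpoint pair_weight (l : seq I) : R :=
  if l is i :: l' then
    \sum_(j <- l' | meet i j) p ^+ #|A i :|: A j| + pair_weight l'
  else 0.

Lemma avoid_antitone l (S S' : {set T}) : S \subset S' -> avoid l S' <= avoid l S.
Proof.
move=> SS'; rewrite /avoid ler_nat.
case: (boolP (all (fun i => ~~ (A i \subset S')) l)) => // h; suff -> : all (fun i => ~~ (A i \subset S)) l by [].
apply: sub_all h => i; apply: contra => AS; exact: subset_trans AS SS'.
Qed.

(** This bounds from below the conditional probability of [A i] given that all of [l] is avoided.
    The sets disjoint from [A i] are independent of it; those meeting it are subtracted by a union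
    bound, in which Harris' inequality separates [A i :|: A j] from the decreasing event. If the
    coefficient is negative, the claim is trivial. *)
Lemma janson_step i l :
  (p ^+ #|A i| - \sum_(j <- l | meet i j) p ^+ #|A i :|: A j|) * bexp p s (avoid l)
  <= bexp p s (fun S => (A i \subset S)%:R * avoid l S).
Proof.
set b := _ - _; have [b0|/ltW b0] := lerP 0 b; last first.
  apply: (@le_trans _ _ 0).
    by apply: mulr_le0_ge0 => //; apply: bexp_ge0.
  by apply: bexp_ge0 => // S; rewrite mulr_ge0.
pose l0 := [seq j <- l | ~~ meet i j].
apply: (@le_trans _ _ (b * bexp p s (avoid l0))).
  apply: ler_wpM2l => //; apply: le_bexp => // S _; rewrite ler_nat.
  case: (boolP (all (fun i => ~~ (A i \subset S)) l)) => // h; rewrite lt0b all_filter.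
  by apply: sub_all h => j /= ->; rewrite implybT.
rewrite /b mulrBl mulr_suml.
apply: (@le_trans _ _ (bexp p s (fun S => (A i \subset S)%:R * avoid l0 S -
   \sum_(j <- l | meet i j) ((A i :|: A j \subset S)%:R * avoid l0 S)))).
  rewrite [leRHS](eq_bexp p (g := fun S => (A i \subset S)%:R * avoid l0 S +
   (-1) * (\sum_(j <- l | meet i j) ((A i :|: A j \subset S)%:R * avoid l0 S)))); last first.
    by move=> S _; rewrite mulN1r.
  rewrite bexpD bexpZ mulN1r bexp_sum; apply: lerB.
    rewrite bexp_indep; first by rewrite bexp_subset.
    move=> e _; have [eA|eA] := boolP (e \in A i); [right|left] => S.
      congr (nat_of_bool _)%:R; apply: eq_in_all => j; rewrite mem_filter /meet negbK.
      case/andP=> dij _; congr (~~ _).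
      apply/subsetP/subsetP => h x xA; last by rewrite inE h ?orbT.
      move: (h _ xA); rewrite !inE => /orP[/eqP xe|//].
      by have := disjointFr dij eA; rewrite -xe xA.
    congr (nat_of_bool _)%:R; apply/subsetP/subsetP => h x xA; last by rewrite inE h ?orbT.
    move: (h _ xA); rewrite !inE => /orP[/eqP xe|//].
    by rewrite -xe xA in eA.
  apply: ler_sum => j _.
  rewrite -(bexp_subset p us (A := A i :|: A j)); last first.
    by move=> x; rewrite inE => /orP[] /As.
  apply: harris => // S S' SS'; last exact: avoid_antitone.
  rewrite ler_nat; case: (boolP (_ \subset S)) => // h.
  by rewrite (subset_trans h SS').
apply: le_bexp => // S _.
case: (boolP (A i \subset S)) => Ai; last first.
  by rewrite !mul0r sub0r oppr_le0 sumr_ge0 // => j _; rewrite mulr_ge0 ?ler0n.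
rewrite !mul1r; have [h|/allPn[j jl]] := boolP (all (fun i => ~~ (A i \subset S)) l).
  rewrite lerBlDr; apply: (@le_trans _ _ 1); first by rewrite lern1 leq_b1.
  rewrite {1}/avoid h lerDl; apply: sumr_ge0 => j _; by rewrite mulr_ge0 ?ler0n.
rewrite negbK => AjS.
have -> : avoid l S = 0.
  rewrite /avoid; case: (boolP (all (fun i => ~~ (A i \subset S)) l)) => // /allP /(_ _ jl).
  by rewrite AjS.
case: (boolP (all (fun i => ~~ (A i \subset S)) l0)) => h0; last first.
  rewrite /avoid (negPf h0) sub0r oppr_le0; apply: sumr_ge0 => j' _; by rewrite mulr_ge0 ?ler0n.
have mij : meet i j.
  case: (boolP (meet i j)) => // nm; move/allP: h0 => /(_ j).
  by rewrite mem_filter nm jl AjS => /(_ isT).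
rewrite /avoid h0 subr_le0 (big_rem j) //= mij subUset Ai AjS mulr1 lerDl.
by apply: sumr_ge0 => j' _; rewrite mulr_ge0.
Qed.

(** Each new index multiplies the avoidance probability by at most [1 - b <= expR (- b)], with [b]
    the coefficient of [janson_step]; the exponents add up. *)
Lemma janson_seq l :
  bexp p s (avoid l) <= expR (pair_weight l - \sum_(i <- l) p ^+ #|A i|).
Proof.
elim: l => [|i l IH].
  by rewrite big_nil subr0 expR0 (eq_bexp p (g := fun=> 1)) ?bexp_cst.
have := janson_step i l; set b := _ - _; move=> hb.
have -> : bexp p s (avoid (i :: l)) =
    bexp p s (avoid l) - bexp p s (fun S => (A i \subset S)%:R * avoid l S).
  rewrite -[X in _ - X]mul1r -mulNr -bexpZ -bexpD; apply: eq_bexp => S _.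
  by rewrite /avoid /=; case: (A i \subset S); case: (all _ l); rewrite /=; ring.
apply: (@le_trans _ _ (bexp p s (avoid l) * expR (- b))).
  apply: (@le_trans _ _ (bexp p s (avoid l) * (1 - b))).
    by rewrite mulrBr mulr1 lerD2l lerN2 mulrC.
  by apply: ler_wpM2l; [apply: bexp_ge0|apply: expR_ge1Dx].
rewrite big_cons /= (_ : _ - _ = (pair_weight l - \sum_(j <- l) p ^+ #|A j|) + - b).
  by rewrite expRD; apply: ler_wpM2r => //; apply: expR_ge0.
by rewrite /b; ring.
Qed.

Lemma pair_weight_le l : uniq l ->
  pair_weight l <= \sum_(i <- l) \sum_(j <- l | (j != i) && meet i j) p ^+ #|A i :|: A j|.
Proof.
have p0 : 0 <= p by case/andP: p01.
elim: l => [|i l IH] /=; first by rewrite big_nil.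
case/andP=> il ul; rewrite big_cons; apply: lerD.
  rewrite big_cons eqxx /= big_seq_cond [leRHS]big_seq_cond.
  rewrite (eq_bigl (fun j => (j \in l) && ((j != i) && meet i j))) // => j.
  case jl: (j \in l) => //=; case: eqP => // ji.
  by rewrite -ji jl in il.
apply: le_trans (IH ul) _; apply: ler_sum => j _.
by rewrite big_cons; case: ifP => // _; rewrite lerDr exprn_ge0.
Qed.

Lemma bexp_mem (q : R) (Q : {set I}) (i : I) : i \in Q ->
  bexp q (enum Q) (fun J => (i \in J)%:R) = q.
Proof.
move=> iQ; rewrite (eq_bexp q (g := fun J => ([set i] \subset J)%:R)) => [|J _].
  by rewrite bexp_subset ?enum_uniq ?cards1 ?expr1 // => j; rewrite mem_enum inE => /eqP ->.
by rewrite sub1set.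
Qed.

Lemma bexp_mem2 (q : R) (Q : {set I}) (i j : I) : i \in Q -> j \in Q -> j != i ->
  bexp q (enum Q) (fun J => ((i \in J) && (j \in J))%:R) = q ^+ 2.
Proof.
move=> iQ jQ ji; rewrite (eq_bexp q (g := fun J => ([set i; j] \subset J)%:R)) => [|J _].
  rewrite bexp_subset ?enum_uniq ?cards2 1?eq_sym ?ji // => j'; rewrite mem_enum !inE.
  by case/orP=> /eqP ->.
by rewrite subUset !sub1set.
Qed.

(* Boppana-Spencer applied to a random subfamily, each index being kept with
   probability [q = mu / (2 Delta)]. *)
Lemma janson (Q : {set I}) (mu Delta : R) :
  (forall i, i \in Q -> A i != set0) ->
  mu = \sum_(i in Q) p ^+ #|A i| ->
  \sum_(i in Q) \sum_(j in Q | meet i j) p ^+ #|A i :|: A j| <= Delta ->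
  0 < Delta ->
  bexp p s (fun S => [forall i in Q, ~~ (A i \subset S)]%:R) <=
    expR (- (mu ^+ 2 / (4 * Delta))).
Proof.
move=> A0 muE leD D0; set Z := bexp _ _ _.
have p0 : 0 <= p by case/andP: p01.
have mu0 : 0 <= mu by rewrite muE sumr_ge0 // => i _; rewrite exprn_ge0.
(* The diagonal terms [j = i] alone contribute [mu], since a nonempty set meets itself. This keeps
   [q] below 1. *)
have muD : mu <= Delta.
  apply: le_trans leD; rewrite muE; apply: ler_sum => i iQ.
  have mii : meet i i.
    by rewrite /meet -setI_eq0 setIid A0.
  rewrite (bigD1 i) ?iQ //= setUid lerDl sumr_ge0 // => j _; by rewrite exprn_ge0.
pose g (J : {set I}) : R := \sum_(i in Q) (i \in J)%:R * p ^+ #|A i| -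
  \sum_(i in Q) \sum_(j in Q | (j != i) && meet i j)
     ((i \in J) && (j \in J))%:R * p ^+ #|A i :|: A j|.
have hJ (J : {set I}) : {subset J <= enum Q} -> Z <= expR (- g J).
  move=> JQ; have JQ' j : j \in J -> j \in Q by move/JQ; rewrite mem_enum.
  apply: (@le_trans _ _ (bexp p s (avoid (enum J)))).
    apply: le_bexp => // S _; rewrite ler_nat; case: forallP => // h.
    rewrite lt0b; apply/allP => j; rewrite mem_enum => jJ.
    by move: (h j); rewrite JQ'.
  apply: le_trans (janson_seq _) _; rewrite ler_expR opprB; apply: lerB.
    apply: le_trans (pair_weight_le (enum_uniq _)) _.
    rewrite big_enum big_mkcond [leRHS]big_mkcond; apply: ler_sum => i _.
    case: ifP => iJ; last first.
      by case: ifP => // _; apply: sumr_ge0 => j _; rewrite mul0r.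
    rewrite JQ' // big_enum_cond big_mkcond [leRHS]big_mkcond; apply: ler_sum => j _.
    case jJ: (j \in J); first by rewrite JQ' //= mul1r.
    by rewrite /=; case: ifP => // _; rewrite mul0r.
  rewrite big_enum big_mkcond [leRHS]big_mkcond; apply: ler_sum => i _.
  case iJ: (i \in J); first by rewrite JQ' // mul1r.
  by case: ifP => // _; rewrite mul0r.
pose q := mu / (2 * Delta).
have q01 : 0 <= q <= 1.
  rewrite divr_ge0 ?mulr_ge0 ?(ltW D0) //= ler_pdivrMr ?mulr_gt0 // mul1r.
  by lra.
have Eg : mu ^+ 2 / (4 * Delta) <= bexp q (enum Q) g.
  rewrite /g (eq_bexp q (g := fun J => \sum_(i in Q) p ^+ #|A i| * (i \in J)%:R + (-1) *
   \sum_(i in Q) \sum_(j in Q | (j != i) && meet i j)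
      p ^+ #|A i :|: A j| * ((i \in J) && (j \in J))%:R)); last first.
    move=> J _; rewrite mulN1r; congr (_ - _).
      by apply: eq_bigr => i _; rewrite mulrC.
    by apply: eq_bigr => i _; apply: eq_bigr => j _; rewrite mulrC.
  rewrite bexpD bexpZ !bexp_sum mulN1r.
  under eq_bigr => i iQ do rewrite bexpZ bexp_mem //.
  under [X in _ - X]eq_bigr => i iQ.
    rewrite bexp_sum.
    under eq_bigr => j /andP[jQ /andP[ji _]] do rewrite bexpZ bexp_mem2 //.
    rewrite -mulr_suml; over.
  rewrite -!mulr_suml -muE.
  (* The chosen [q] maximises this quadratic, whence the value [mu ^+ 2 / (4 * Delta)]. *)
  apply: (@le_trans _ _ (mu * q - Delta * q ^+ 2)).
    rewrite /q le_eqVlt; apply/orP; left; apply/eqP; field; exact: lt0r_neq0.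
  apply: lerB => //; apply: ler_wpM2r; first by case/andP: q01 => q0 _; rewrite exprn_ge0.
  apply: le_trans leD; apply: ler_sum => i _; rewrite big_mkcond [leRHS]big_mkcond.
  apply: ler_sum => j _; case: (j \in Q) => //=.
  by case: (j != i) => //=; case: ifP => // _; rewrite exprn_ge0.
have [Z0|Z0] := ltP 0 Z; last by apply: le_trans Z0 (expR_ge0 _).
rewrite -[leLHS]lnK ?posrE // ler_expR lerNr; apply: le_trans Eg _.
(* No good [J] has to be picked: [hJ] bounds [g J] by [- ln Z] for every [J], hence also its
   mean. *)
rewrite -[leRHS](bexp_cst q (enum Q)); apply: le_bexp => // J JQ.
by rewrite lerNr -ler_expR lnK ?posrE // hJ.
Qed.

End Janson.

Section RandomEmbedding.
Variables (R : realType) (U V : finType).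
Implicit Types (E : {set {set U}}) (f g : {ffun U -> V}) (D : {set U}).

Definition image_edges f E : {set {set V}} := [set f @: e | e : {set U} in E].

Definition induced E D : {set {set U}} := [set e in E | e \subset D].

Lemma image_edges_pairs f E : injective f -> E \subset pairs U ->
  image_edges f E \subset pairs V.
Proof.
move=> fi Ep; apply/subsetP => _ /imsetP[e eE ->].
by move/subsetP: Ep => /(_ _ eE); rewrite !inE card_imset.
Qed.

Lemma card_image_edges f E : injective f -> #|image_edges f E| = #|E|.
Proof. by move=> fi; rewrite card_imset //; apply: imset_inj. Qed.

Lemma subset_image_edges f E (S : {set {set V}}) :
  reflect (forall e, e \in E -> f @: e \in S) (image_edges f E \subset S).
Proof.
apply: (iffP subsetP) => [h e eE|h _ /imsetP[e eE ->]]; last exact: h.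
exact/h/imset_f.
Qed.

(* The first hypothesis on [FF] makes the vertex classes of the functions disjoint,
   so two image copies meet exactly in the image of the set where the functions
   agree; splitting Janson's sum by that set gives the factor [2 ^+ #|U|]. *)
Lemma embedding_probability (p t : R) E (FF : {set {ffun U -> V}}) :
  0 < p <= 1 -> 0 < t -> E \subset pairs U -> E != set0 -> FF != set0 ->
  (forall f g u w, f \in FF -> g \in FF -> f u = g w -> u = w) ->
  (forall f D, f \in FF -> induced E D != set0 ->
     t * #|[set g in FF | [forall u in D, g u == f u]]|%:R <=
     #|FF|%:R * p ^+ #|induced E D|) ->
  bexp p (enum (pairs V)) (fun S => [forall f in FF, ~~ (image_edges f E \subset S)]%:R) <=
  expR (- (t / (4 * 2 ^+ #|U|))).
Proof.
move=> p01 t0 Ep E0 F0 part hyp; have /andP[p0 p1] := p01.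
have finj f : f \in FF -> injective f.
  by move=> fF u w fuw; apply: (part f f).
have N0 : 0 < #|FF|%:R :> R by rewrite ltr0n card_gt0.
set N := #|FF|%:R : R in N0 *.
pose mu := N * p ^+ #|E|.
have muP : 0 < mu by rewrite mulr_gt0 // exprn_gt0.
(* One share [mu ^+ 2 / t] for each possible agreement set [D]: by hypothesis, the pairs agreeing
   exactly on [D] weigh no more than that. *)
pose Delta := mu ^+ 2 * 2 ^+ #|U| / t.
have DP : 0 < Delta by rewrite divr_gt0 // mulr_gt0 ?exprn_gt0.
have -> : t / (4 * 2 ^+ #|U|) = mu ^+ 2 / (4 * Delta).
  rewrite /Delta; move: (2 ^+ #|U|) (lt0r_neq0 (exprn_gt0 #|U| (ltr0Sn R 1))) => a a0.
  by field; rewrite a0 !lt0r_neq0.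
pose A f := if f \in FF then image_edges f E else set0.
have AE f : f \in FF -> A f = image_edges f E by rewrite /A => ->.
rewrite (eq_bexp p (g := fun S => [forall f in FF, ~~ (A f \subset S)]%:R)); last first.
  move=> S _; congr (nat_of_bool _)%:R; apply: eq_forallb => f.
  by case fF: (f \in FF) => //=; rewrite AE.
apply: janson; first by rewrite (ltW p0).
- exact: enum_uniq.
- move=> f e; rewrite /A; case: ifP => fF; last by rewrite inE.
  by rewrite mem_enum => /(subsetP (image_edges_pairs (finj _ fF) Ep)).
- move=> f fF; rewrite AE // -card_gt0 card_image_edges; last exact: finj.
  by rewrite card_gt0.
- rewrite (eq_bigr (fun=> p ^+ #|E|)); last first.
    by move=> f fF; rewrite AE // card_image_edges //; apply: finj.
  by rewrite sumr_const /mu /N mulr_natl.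
- have DE : Delta = \sum_(f in FF) \sum_(D : {set U}) (N * p ^+ (2 * #|E|) / t).
    rewrite sumr_const sumr_const -/N.
    have -> : #|{: {set U}}| = (2 ^ #|U|)%N.
      by have := card_powerset [set: U]; rewrite powersetT !cardsT.
    rewrite -[RHS]mulr_natl -[X in _ * X]mulr_natl -/N natrX /Delta /mu mulnC exprM.
    by move: (2 ^+ #|U|) (p ^+ #|E|) => a b; ring.
  rewrite DE; apply: ler_sum => f fF.
  rewrite (partition_big (fun g => [set u | f u == g u]) predT) //=.
  apply: ler_sum => D _.
  have rhs0 : 0 <= N * p ^+ (2 * #|E|) / t.
    by rewrite !mulr_ge0 ?invr_ge0 ?exprn_ge0 // ltW.
  have union g : g \in FF -> ~~ [disjoint A f & A g] -> [set u | f u == g u] = D ->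
      (2 * #|E| <= #|A f :|: A g| + #|induced E D|)%N /\ induced E D != set0.
    move=> gF; rewrite !AE // => fg gD.
    have inter : image_edges f E :&: image_edges g E \subset image_edges f (induced E D).
      apply/subsetP => x; rewrite inE => /andP[/imsetP[e eE ->] /imsetP[e' e'E fe]].
      apply/imsetP; exists e => //; rewrite inE eE -gD; apply/subsetP => u ue.
      have : f u \in g @: e' by rewrite -fe imset_f.
      case/imsetP => w we' fu; have uw := part _ _ _ _ fF gF fu.
      by rewrite inE uw -fu uw.
    split.
      have := cardsUI (image_edges f E) (image_edges g E).
      rewrite !card_image_edges ?addnn -?mul2n => [<-||]; try exact: finj.
      rewrite leq_add2l (leq_trans (subset_leq_card inter)) //.
      by rewrite card_image_edges //; apply: finj.
    apply: contraNneq fg => i0; rewrite -setI_eq0 -subset0.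
    by apply: subset_trans inter _; rewrite i0 /image_edges imset0.
  have [D0|Dn0] := boolP (induced E D == set0).
    rewrite big1 // => g /andP[/andP[gF fg] /eqP gD].
    by have [_] := union _ gF fg gD; rewrite D0.
  apply: (@le_trans _ _ (\sum_(g in FF | [forall u in D, g u == f u])
      p ^+ (2 * #|E| - #|induced E D|))).
    rewrite big_mkcond [leRHS]big_mkcond; apply: ler_sum => g _.
    case: ifP => [/andP[/andP[gF fg] /eqP gD]|_]; last first.
      by case: ifP => // _; rewrite exprn_ge0 // ltW.
    have -> : [forall u in D, g u == f u].
      by apply/forall_inP => u; rewrite -gD inE eq_sym.
    rewrite gF; have [h _] := union _ gF fg gD.
    apply: ler_wiXn2l; [exact: ltW|exact: p1|].
    by rewrite leq_subLR addnC.
  rewrite sumr_const -mulr_natl ler_pdivlMr // mulrAC.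
  have -> : #|[pred g in FF | [forall u in D, g u == f u]]| =
      #|[set g in FF | [forall u in D, g u == f u]]|.
    by apply: eq_card => g; rewrite inE.
  rewrite [X in X * _]mulrC.
  apply: (le_trans (ler_wpM2r _ (hyp _ _ fF Dn0))); first by rewrite exprn_ge0 // ltW.
  rewrite -/N -mulrA -exprD subnKC //.
  apply: (@leq_trans #|E|); last by rewrite leq_pmull.
  by apply: subset_leq_card; apply/subsetP => e; rewrite inE => /andP[].
- exact: DP.
Qed.
End RandomEmbedding.

(** * The 1-density and tight sets *)

Section OneDensity.
Variables (R : realType) (U : finType) (F : sgraph U).
Let m : R := m1 R F.
Let E := edges F.

(** One-vertex sets are outside the maximum defining [m1], but both sides vanish there; so the bound
    applies to every nonempty intersection or union in the uncrossing. *)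
Lemma induced_edges_le (D : {set U}) : D != set0 ->
  #|induced E D|%:R <= m * (#|D|%:R - 1).
Proof.
move=> D0; have [D2|] := leqP 2 #|D|; last first.
  move=> D1; have /eqP/cards1P[x Dx] : #|D| = 1%N.
    by apply/eqP; rewrite eqn_leq -ltnS D1 card_gt0.
  have -> : induced E D = set0.
    apply/setP => e; rewrite !inE; apply/negP => /andP[eE eD].
    have := subsetP (edges_sub F) _ eE; rewrite inE => /eqP e2.
    by have := subset_leq_card eD; rewrite e2 Dx cards1.
  by rewrite Dx !cards1 cards0 subrr mulr0.
rewrite -ler_pdivrMr; last by rewrite subr_gt0 ltr1n.
pose S := (D, induced E D).
apply: (@le_bigmax_cond _ _ _ _ S (fun S => subgraph F S && (2 <= #|S.1|)%N)
   (fun S => #|S.2|%:R / (#|S.1|%:R - 1) : R)).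
rewrite D2 andbT /subgraph; apply/andP; split.
  by apply/subsetP => e; rewrite inE => /andP[].
by apply/bigcupsP => e; rewrite inE => /andP[].
Qed.

(** Sending a vertex to the edge towards its successor is injective: two vertices with the same edge
    would be successors of each other, which a cycle of length at least three excludes. *)
Lemma ucycle_induced (s : seq U) : (2 < size s)%N -> ucycleb (adj F) s ->
  (#|[set x in s]| <= #|induced E [set x in s]|)%N.
Proof.
move=> s2 /andP[cs us].
have next2 x : x \in s -> next s (next s x) != x.
  move=> xs; have [i s' rs] := rot_to xs.
  have us' : uniq (x :: s') by rewrite -rs rot_uniq.
  have ss' : (2 < size (x :: s'))%N by rewrite -rs size_rot.
  rewrite -!(next_rot i us) rs; case: s' us' ss' {rs} => [|a [|b s']] //= us' _.
  case/andP: us'; rewrite !inE !negb_or => /and3P[xa xb _] _.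
  by rewrite eqxx [a == x]eq_sym (negPf xa) eqxx eq_sym.
pose h x := [set x; next s x].
have hi : {in [set x in s] &, injective h}.
  move=> x y; rewrite !inE => xs ys hxy; apply/eqP/negPn/negP => xy.
  have : x \in h y by rewrite -hxy set21.
  rewrite !inE (negPf xy) /= => /eqP xny.
  have : y \in h x by rewrite hxy set21.
  rewrite !inE eq_sym (negPf xy) /= => /eqP ynx.
  by have := next2 _ ys; rewrite -xny -ynx eqxx.
rewrite -(card_in_imset hi); apply: subset_leq_card; apply/subsetP => _ /imsetP[x xs ->].
rewrite inE in xs; rewrite inE; apply/andP; split; first exact: (next_cycle cs xs).
by apply/subsetP => y; rewrite !inE => /orP[] /eqP ->; rewrite ?mem_next.
Qed.

(** A cycle on [l] vertices has density at least [l / (l - 1)]. This is where the hypothesis on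
    forests enters; the strict inequality is what yields an edge avoiding the root in
    [tight_edge_avoiding]. *)
Lemma m1_gt1 : ~ forest F -> 1 < m.
Proof.
move=> nf; rewrite ltNge; apply/negP => m1; apply: nf => s s2; apply/negP => us.
have D0 : [set x in s] != set0.
  by case: s s2 {us} => // x s _; apply/set0Pn; exists x; rewrite inE mem_head.
have := induced_edges_le D0; apply/negP; rewrite -ltNge.
have h : #|[set x in s]|%:R <= #|induced E [set x in s]|%:R :> R.
  by rewrite ler_nat; apply: ucycle_induced.
apply: lt_le_trans h; apply: (@le_lt_trans _ _ (1 * (#|[set x in s]|%:R - 1))).
  by apply: ler_wpM2r => //; rewrite subr_ge0 ler1n card_gt0.
by rewrite mul1r ltrBlDr ltrDl.
Qed.

Lemma induced_supermodular (D1 D2 : {set U}) :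
  (#|induced E D1| + #|induced E D2| <= #|induced E (D1 :&: D2)| + #|induced E (D1 :|: D2)|)%N.
Proof.
rewrite -cardsUI addnC; apply: leq_add; apply: subset_leq_card; apply/subsetP => e.
  by rewrite !inE subsetI => /andP[/andP[-> ->] /andP[_ ->]].
rewrite !inE => /orP[] /andP[-> h] /=; apply: subset_trans h _; [exact: subsetUl|exact: subsetUr].
Qed.

Hypothesis m_gt1 : 1 < m.

Section Root.
Variable x : U.

(* A tight set through the root [x] is an obstruction to covering a given vertex by
   a copy of [F] in the random graph alone. *)
Let tight (D : {set U}) :=
  [&& x \in D, (2 <= #|D|)%N & #|induced E D|%:R == m * (#|D|%:R - 1)].

(** Uncrossing: edge counts are supermodular, while [m * (#|D| - 1)] is modular. The density bound
    for the union therefore forces equality for the intersection. *)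
Lemma tight_inter (D1 D2 : {set U}) : tight D1 -> tight D2 ->
  D1 :&: D2 != [set x] -> tight (D1 :&: D2).
Proof.
case/and3P=> x1 _ /eqP e1 /and3P[x2 _ /eqP e2] I1.
have xI : x \in D1 :&: D2 by rewrite inE x1 x2.
have I0 : D1 :&: D2 != set0 by apply/set0Pn; exists x.
have U0 : D1 :|: D2 != set0 by apply/set0Pn; exists x; rewrite inE x1.
rewrite /tight xI /=; apply/andP; split.
  rewrite ltnNge; apply: contra I1 => I1; rewrite eq_sym eqEcard sub1set xI cards1 I1 //.
rewrite eq_le (induced_edges_le I0) /=.
have h := induced_supermodular D1 D2; rewrite -(ler_nat R) !natrD e1 e2 in h.
have hU := induced_edges_le U0.
have c : #|D1 :|: D2|%:R + #|D1 :&: D2|%:R = #|D1|%:R + #|D2|%:R :> R.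
  by rewrite -!natrD cardsUI.
have -> : #|D1 :&: D2|%:R = #|D1|%:R + #|D2|%:R - #|D1 :|: D2|%:R :> R by lra.
move: h hU; rewrite !mulrBr !mulrDr mulr1; lra.
Qed.

(** If every edge inside [D] contained [x], there would be at most [#|D| - 1] of them, too few for a
    tight set as [m > 1]. *)
Lemma tight_edge_avoiding (D : {set U}) : tight D ->
  exists z : U * U, [&& z.1 != z.2, [set z.1; z.2] \in E & [set z.1; z.2] \subset D :\ x].
Proof.
case/and3P=> xD D2 /eqP eD.
have [/existsP[e /andP[eE eDx]]|h] := boolP [exists e in E, e \subset D :\ x].
  have := subsetP (edges_sub F) _ eE; rewrite inE => /cards2P[a [b [ab eab]]].
  by exists (a, b); apply/and3P; rewrite /= -eab; split.
have : (#|induced E D| <= #|D :\ x|)%N.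
  apply: (@leq_trans #|[set [set x; y] | y in D :\ x]|); last exact: leq_imset_card.
  apply: subset_leq_card; apply/subsetP => e; rewrite inE => /andP[eE sD].
  have := subsetP (edges_sub F) _ eE; rewrite inE => /cards2P[a [b [ab eab]]].
  have xe : x \in e.
    apply: contraR h => xe; apply/existsP; exists e; rewrite eE /=.
    by rewrite subsetD1 sD xe.
  have aD : a \in D by apply: (subsetP sD); rewrite eab set21.
  have bD : b \in D by apply: (subsetP sD); rewrite eab set22.
  move: xe; rewrite eab !inE => /orP[] /eqP xe; apply/imsetP.
    by exists b; rewrite ?inE ?bD ?xe 1?eq_sym ?ab.
  by exists a; rewrite ?inE ?aD ?xe ?ab // setUC.
have D1 : (0 : R) < #|D|%:R - 1 by rewrite subr_gt0 ltr1n.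
have cD : #|D|%:R - 1 = #|D :\ x|%:R :> R.
  by rewrite (cardsD1 x D) xD natrD addrAC subrr add0r.
rewrite -(ler_nat R) eD -cD => h2; exfalso.
have : 1 * (#|D|%:R - 1) < m * (#|D|%:R - 1) by rewrite ltr_pM2r.
by rewrite mul1r; lra.
Qed.

(* One edge is chosen in each minimal tight set through [x]; by uncrossing,
   these sets pairwise meet only in [x]. *)
Lemma matching_in_tight_sets : exists M : {set U * U},
  [/\ forall z, z \in M ->
        [/\ z.1 != z.2, [set z.1; z.2] \in E, x != z.1 & x != z.2],
      {in M &, forall z z', z != z' -> [disjoint [set z.1; z.2] & [set z'.1; z'.2]]} &
      forall D : {set U}, x \in D -> (2 <= #|D|)%N ->
        #|induced (E :\: [set [set z.1; z.2] | z in M]) D|%:R < m * (#|D|%:R - 1)].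
Proof.
pose mint D := minset tight D.
pose ok (D : {set U}) (z : U * U) :=
  [&& z.1 != z.2, [set z.1; z.2] \in E & [set z.1; z.2] \subset D :\ x].
pose pk D := odflt (x, x) [pick z | ok D z].
have pkP D : mint D -> ok D (pk D).
  move/minsetp => tD; rewrite /pk; case: pickP => //= h.
  by have [z zo] := tight_edge_avoiding tD; have := h z; rewrite /ok zo.
have minI D1 D2 : mint D1 -> mint D2 -> D1 != D2 -> D1 :&: D2 = [set x].
  move=> m1 m2; apply: contraNeq => I1.
  have tI := tight_inter (minsetp m1) (minsetp m2) I1.
  have [/minsetinf h1 /minsetinf h2] := (m1, m2).
  by rewrite -(h1 _ tI (subsetIl _ _)) {1}(h2 _ tI (subsetIr _ _)).
exists [set pk D | D in [set D | mint D]]; split.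
- move=> z /imsetP[D mD ->]; move: mD; rewrite inE => /pkP/and3P[z12 zE zD].
  have [z1 z2] : (pk D).1 \in D :\ x /\ (pk D).2 \in D :\ x.
    by split; apply: (subsetP zD); rewrite ?set21 ?set22.
  rewrite !inE in z1 z2; case/andP: z1 => z1 _; case/andP: z2 => z2 _.
  by split=> //; rewrite eq_sym.
- move=> _ _ /imsetP[D1 mD1 ->] /imsetP[D2 mD2 ->] z12; rewrite !inE in mD1 mD2.
  have D12 : D1 != D2 by apply: contraNneq z12 => ->.
  have [/and3P[_ _ z1] /and3P[_ _ z2]] := (pkP _ mD1, pkP _ mD2).
  rewrite -setI_eq0 -subset0; apply: (subset_trans (setISS z1 z2)).
  apply/subsetP => y; rewrite !inE => /andP[/andP[yx y1] /andP[_ y2]].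
  have : y \in D1 :&: D2 by rewrite inE y1 y2.
  by rewrite (minI _ _ mD1 mD2 D12) inE (negPf yx).
move=> D xD D2; set E' := E :\: _.
have D0 : D != set0 by apply/set0Pn; exists x.
have sE : induced E' D \subset induced E D.
  by apply/subsetP => e; rewrite !inE => /andP[/andP[_ ->] ->].
(* A set that is not tight is already strictly below the bound. A tight one contains a minimal tight
   set, hence loses the edge chosen there. *)
have [tD|ntD] := boolP (tight D); last first.
  apply: (@le_lt_trans _ _ #|induced E D|%:R); first by rewrite ler_nat; apply: subset_leq_card.
  rewrite lt_neqAle induced_edges_le // andbT.
  by move: ntD; rewrite /tight xD D2.
have [D' mD' D'D] := minset_exists tD.
apply: lt_le_trans (induced_edges_le D0); rewrite ltr_nat; apply: proper_card.
have /and3P[_ zE zD] := pkP _ mD'.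
apply/properP; split=> //; exists [set (pk D').1; (pk D').2].
  rewrite inE zE; apply: subset_trans D'D; apply: subset_trans zD _; exact: subsetDl.
rewrite !inE zE andbT; apply/negP => /andP[/negP[]].
by apply/imsetP; exists (pk D') => //; apply/imsetP; exists D'; rewrite ?inE.
Qed.

End Root.
End OneDensity.

(** * Dense lower-regular pairs *)

Section EdgeCount.
Variables (R : realType) (V : finType) (r : rel V).
Implicit Types A B X Y : {set V}.

Definition ecount A B : nat := \sum_(x in A) \sum_(y in B) r x y.

Lemma ecount_deg A B : ecount A B = (\sum_(x in A) #|[set y in B | r x y]|)%N.
Proof.
apply: eq_bigr => x _; rewrite -sum1_card big_mkcond [RHS]big_mkcond.
by apply: eq_bigr => y _; rewrite inE; case: (y \in B); case: (r x y).
Qed.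

Lemma ecountDl A X B : A \subset X -> ecount X B = (ecount A B + ecount (X :\: A) B)%N.
Proof. by move=> AX; rewrite /ecount [LHS](big_setID A) /= (setIidPr AX). Qed.

Lemma ecountDr A B Y : B \subset Y -> ecount A Y = (ecount A B + ecount A (Y :\: B))%N.
Proof.
move=> BY; rewrite /ecount -big_split; apply: eq_bigr => x _.
by rewrite /= [LHS](big_setID B) /= (setIidPr BY).
Qed.

Lemma ecount_le A B : (ecount A B <= #|A| * #|B|)%N.
Proof.
rewrite ecount_deg -sum_nat_const; apply: leq_sum => x _.
by apply: subset_leq_card; apply/subsetP => y; rewrite inE => /andP[].
Qed.

Lemma ecountC A B : symmetric r -> ecount A B = ecount B A.
Proof.
move=> rs; rewrite /ecount exchange_big; apply: eq_bigr => x _.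
by apply: eq_bigr => y _; rewrite rs.
Qed.

Lemma ecount0l B : ecount set0 B = 0%N.
Proof. by rewrite /ecount big_set0. Qed.

Lemma ecount0r A : ecount A set0 = 0%N.
Proof. by rewrite /ecount big1 // => x _; rewrite big_set0. Qed.

(* A uniformly random cut contains each ordered pair with probability 1/4. *)
Lemma bipartition_ecount : irreflexive r ->
  exists A : {set V}, (ecount setT setT <= 4 * ecount A (~: A))%N.
Proof.
move=> ri; pose q : R := 2^-1.
have q01 : 0 <= q <= 1 by rewrite /q; lra.
have [A _ Amax] := @arg_maxnP {set V} set0 predT (fun A => ecount A (~: A)) isT.
exists A; rewrite -(ler_nat R) natrM.
have : bexp q (enum [set: V]) (fun S => (ecount S (~: S))%:R) <= (ecount A (~: A))%:R :> R.
  rewrite -[leRHS](bexp_cst q (enum [set: V])); apply: le_bexp => // S _.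
  by rewrite ler_nat; apply: Amax.
rewrite (eq_bexp q (g := fun S => \sum_x \sum_y (r x y)%:R *
     ((x \in S)%:R + (-1) * ((x \in S) && (y \in S))%:R))); last first.
  move=> S _; rewrite /ecount natr_sum big_mkcond; apply: eq_bigr => x _.
  rewrite natr_sum; case: ifP => xS; last by rewrite big1 // => y _; ring.
  rewrite big_mkcond; apply: eq_bigr => y _; rewrite inE.
  by case: (y \in S); case: (r x y) => /=; ring.
have Exy x y : bexp q (enum [set: V]) (fun S => (r x y)%:R *
     ((x \in S)%:R + (-1) * ((x \in S) && (y \in S))%:R)) = (r x y)%:R * 4^-1.
  have [->|yx] := eqVneq y x; first by rewrite bexpZ ri !mul0r.
  rewrite bexpZ bexpD bexpZ (bexp_mem q (in_setT x)).
  by rewrite (bexp_mem2 q (in_setT x) (in_setT y) yx) /q; congr (_ * _); field.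
rewrite bexp_sum; under eq_bigr do rewrite bexp_sum.
under eq_bigr do under eq_bigr do rewrite Exy.
under eq_bigr do rewrite -mulr_suml.
rewrite -mulr_suml ler_pdivrMr // mulrC; apply: le_trans.
rewrite /ecount natr_sum le_eqVlt; apply/orP; left; apply/eqP.
rewrite (eq_bigl predT) => [|x]; last by rewrite inE.
apply: eq_bigr => x _; rewrite natr_sum (eq_bigl predT) => [|y]; last by rewrite inE.
by [].
Qed.

Lemma exprD_ge2 (n : nat) (x y : R) : 0 <= x -> 0 <= y ->
  x ^+ n.+1 + n.+1%:R * x ^+ n * y <= (x + y) ^+ n.+1.
Proof.
move=> x0 y0; elim: n => [|n IH]; first by rewrite expr0 mulr1 mul1r !expr1.
rewrite [leRHS]exprS; apply: le_trans (ler_wpM2l _ IH); last exact: addr_ge0.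
rewrite -subr_ge0 (_ : _ - _ = n.+1%:R * x ^+ n * y ^+ 2); first by rewrite !mulr_ge0 ?exprn_ge0.
by rewrite -[n.+2]addn1 natrD [x ^+ (n.+1 + 1)]exprD [x ^+ n.+1]exprS; ring.
Qed.

(** The first two binomial terms of [(t + 1/(n+1))^(n+1)] already exceed [t^n]. This turns the
    maximality of a pair, a statement about powers, into an additive error [1/(n+1)]. *)
Lemma le_of_expr_le (n : nat) (u t : R) : 0 <= t ->
  u ^+ n.+1 <= t ^+ n -> u <= t + n.+1%:R^-1.
Proof.
move=> t0 ut; rewrite leNgt; apply/negP => tu.
have n0 : 0 < n.+1%:R :> R by rewrite ltr0n.
have h0 : 0 <= t + n.+1%:R^-1 by rewrite addr_ge0 // invr_ge0 ltW.
have : (t + n.+1%:R^-1) ^+ n.+1 < u ^+ n.+1.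
  by rewrite ltrXn2r.
apply/negP; rewrite -leNgt; apply: (le_trans ut).
apply: le_trans (exprD_ge2 n t0 _); last by rewrite invr_ge0 ltW.
rewrite mulrAC divff ?lt0r_neq0 // mul1r lerDr exprn_ge0 //.
Qed.

(* The pair maximising [e(X,Y)^(s+1) / (|X||Y|)^s] has almost no subpair denser
   than itself, so by complementation no large subpair can be sparse. *)
Lemma dense_regular_pair (eps eta : R) (s : nat) (A0 B0 : {set V}) :
  0 < eps -> 0 < eta -> 4 <= s.+1%:R * eta ^+ 2 ->
  [disjoint A0 & B0] -> (0 < #|V|)%N ->
  eps * #|V|%:R ^+ 2 <= (ecount A0 B0)%:R ->
  exists X Y : {set V}, [/\ [disjoint X & Y],
    eps ^+ s.+1 * #|V|%:R <= #|X|%:R, eps ^+ s.+1 * #|V|%:R <= #|Y|%:R &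
    forall A B, A \subset X -> B \subset Y ->
      eta * #|X|%:R <= #|A|%:R -> eta * #|Y|%:R <= #|B|%:R ->
      eps / 2 * (#|A|%:R * #|B|%:R) <= (ecount A B)%:R].
Proof.
move=> eps0 eta0 es dAB V0 eAB.
pose sz (Z : {set V} * {set V}) : R := #|Z.1|%:R * #|Z.2|%:R.
pose ec (Z : {set V} * {set V}) : R := (ecount Z.1 Z.2)%:R.
pose phi Z := ec Z ^+ s.+1 / sz Z ^+ s.
pose P (Z : {set V} * {set V}) := [&& [disjoint Z.1 & Z.2], Z.1 != set0 & Z.2 != set0].
set n : R := #|V|%:R in eAB *.
have n0 : 0 < n by rewrite ltr0n.
have ec_gt0 : 0 < (ecount A0 B0)%:R :> R.
  by apply: lt_le_trans eAB; rewrite mulr_gt0 ?exprn_gt0.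
have PAB : P (A0, B0).
  rewrite /P dAB /=; apply/andP; split; apply: contraTneq ec_gt0 => ->.
    by rewrite ecount0l ltxx.
  by rewrite ecount0r ltxx.
have [[X Y] PXY maxXY] := @Order.TotalTheory.arg_maxP _ R _ (A0, B0) P phi PAB.
have szP Z : P Z -> 0 < sz Z.
  by case/and3P=> _ Z1 Z2; rewrite mulr_gt0 ?ltr0n ?card_gt0.
have le_n (Z : {set V}) : #|Z|%:R <= n by rewrite ler_nat max_card.
have sz_le Z : sz Z <= n ^+ 2 by rewrite expr2 ler_pM.
have ec_ge0 Z : 0 <= ec Z by [].
have ec_le Z : ec Z <= sz Z by rewrite /ec /sz -natrM ler_nat ecount_le.
have base : eps ^+ s.+1 * n ^+ 2 <= phi (X, Y).
  apply: le_trans (maxXY _ PAB); rewrite /phi ler_pdivlMr ?exprn_gt0 ?szP //.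
  apply: (@le_trans _ _ (eps ^+ s.+1 * n ^+ 2 * (n ^+ 2) ^+ s)).
    apply: ler_wpM2l; first by rewrite !mulr_ge0 ?exprn_ge0 // ltW.
    by apply: lerXn2r; rewrite ?nnegrE ?exprn_ge0 ?(ltW n0) ?(ltW (szP _ PAB)).
  rewrite -mulrA -exprS -exprMn.
  by apply: lerXn2r; rewrite ?nnegrE ?mulr_ge0 ?exprn_ge0 ?(ltW n0) ?(ltW eps0).
set E := ec (X, Y); set S := sz (X, Y).
have S0 : 0 < S by apply: szP.
have phiS : phi (X, Y) <= S.
  rewrite /phi ler_pdivrMr ?exprn_gt0 // -/E -/S -exprS.
  by apply: lerXn2r; rewrite ?nnegrE ?ec_ge0 ?(ltW S0) // ec_le.
have bigS : eps ^+ s.+1 * n ^+ 2 <= S by apply: le_trans base phiS.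
(* The maximum is at least [eps ^+ s.+1 * n ^+ 2], and [S <= n ^+ 2]; extracting the root of order
   [s.+1] gives the density. *)
have Edense : eps * S <= E.
  rewrite -(@ler_pXn2r _ s.+1) ?nnegrE ?ec_ge0 ?mulr_ge0 ?(ltW eps0) ?(ltW S0) //.
  move: base; rewrite /phi ler_pdivlMr ?exprn_gt0 // -/E -/S; apply: le_trans.
  rewrite exprMn [S ^+ s.+1]exprS mulrA ler_wpM2r ?exprn_ge0 ?(ltW S0) //.
  by rewrite ler_wpM2l ?exprn_ge0 ?(ltW eps0) ?sz_le.
have E0 : 0 < E by apply: lt_le_trans Edense; rewrite mulr_gt0.
have dXY : [disjoint X & Y] by case/and3P: PXY.
(* By maximality, the ratios [u] of edges and [t] of areas of [(A, B)] to [(X, Y)] satisfy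
   [u ^+ s.+1 <= t ^+ s]. *)
have upper A B : A \subset X -> B \subset Y -> ec (A, B) <= E * (sz (A, B) / S + s.+1%:R^-1).
  move=> AX BY; have [A00|An] := eqVneq A set0.
    rewrite A00 /ec ecount0l mulr_ge0 ?(ltW E0) // addr_ge0 ?invr_ge0 ?divr_ge0 //.
      by rewrite mulr_ge0.
    exact: ltW.
  have [B00|Bn] := eqVneq B set0.
    rewrite B00 /ec ecount0r mulr_ge0 ?(ltW E0) // addr_ge0 ?invr_ge0 ?divr_ge0 //.
      by rewrite mulr_ge0.
    exact: ltW.
  have PA : P (A, B).
    rewrite /P An Bn !andbT /=; apply: disjointWl AX _; rewrite disjoint_sym.
    by apply: disjointWl BY _; rewrite disjoint_sym.
  rewrite mulrC -ler_pdivrMr //; apply: le_of_expr_le.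
    by rewrite divr_ge0 ?(ltW S0) // mulr_ge0.
  rewrite !expr_div_n ler_pdivrMr ?exprn_gt0 // mulrAC ler_pdivlMr ?exprn_gt0 //.
  have h : phi (A, B) <= phi (X, Y) by apply: maxXY.
  move: h; rewrite /phi -/E -/S ler_pdivrMr ?exprn_gt0 ?szP // mulrAC.
  by rewrite ler_pdivlMr ?exprn_gt0 // [X in _ -> _ <= X]mulrC.
exists X, Y; split => //.
- have : eps ^+ s.+1 * n ^+ 2 <= #|X|%:R * n.
    by apply: le_trans bigS _; rewrite /S /sz ler_wpM2l.
  by rewrite expr2 mulrA ler_pM2r.
- have : eps ^+ s.+1 * n ^+ 2 <= #|Y|%:R * n.
    by apply: le_trans bigS _; rewrite /S /sz mulrC ler_wpM2l.
  by rewrite expr2 mulrA ler_pM2r.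
move=> A B AX BY hA hB.
have e1 := ecountDl Y AX; have e2 := ecountDr A BY.
have u1 := upper (X :\: A) Y (subsetDl _ _) (subxx _).
have u2 := upper A (Y :\: B) AX (subsetDl _ _).
have cX : #|X :\: A|%:R = #|X|%:R - #|A|%:R :> R.
  by rewrite cardsD (setIidPr AX) natrB // subset_leq_card.
have cY : #|Y :\: B|%:R = #|Y|%:R - #|B|%:R :> R.
  by rewrite cardsD (setIidPr BY) natrB // subset_leq_card.
move: u1 u2; rewrite /ec /sz /= cX cY.
have -> : (ecount A B)%:R = E - (ecount (X :\: A) Y)%:R - (ecount A (Y :\: B))%:R :> R.
  by rewrite /E /ec /= e1 e2 !natrD; ring.
set e3 := (ecount (X :\: A) Y)%:R; set e4 := (ecount A (Y :\: B))%:R.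
set a : R := #|A|%:R in hA *; set b : R := #|B|%:R in hB *.
set x : R := #|X|%:R in hA *; set y : R := #|Y|%:R in hB *.
have SE : S = x * y by [].
set i := s.+1%:R^-1 => u1 u2.
(* The size of [s] is tuned so that the error [i] of each upper bound is at most a quarter of the
   relative area of [(A, B)]. *)
have iP : i <= eta ^+ 2 / 4.
  rewrite /i -[leLHS]mul1r ler_pdivrMr ?ltr0n //.
  rewrite (_ : eta ^+ 2 / 4 * _ = (s.+1%:R * eta ^+ 2) / 4); last by rewrite mulrAC [eta ^+ 2 * _]mulrC.
  by rewrite ler_pdivlMr // mul1r.
have x0 : 0 < x by case/and3P: PXY => _ h _; rewrite ltr0n card_gt0.
have y0 : 0 < y by case/and3P: PXY => _ _ h; rewrite ltr0n card_gt0.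
have ab : eta ^+ 2 * S <= a * b.
  rewrite SE (_ : eta ^+ 2 * _ = (eta * x) * (eta * y)); last by ring.
  by rewrite ler_pM // mulr_ge0 // ltW.
have iS : i <= a * b / S / 4.
  by apply: (le_trans iP); rewrite ler_pM2r ?invr_gt0 // ler_pdivlMr.
(* The two complementary pairs have total relative area [1 - a * b / S]; the errors [2 * i] consume
   half of what remains for [(A, B)]. *)
have hE : E - e3 - e4 >= E * (a * b / S / 2).
  have h : E * ((x - a) * y / S + i) + E * (a * (y - b) / S + i) <= E - E * (a * b / S / 2).
    rewrite -mulrDr -{2}[E]mulr1 -mulrBr ler_wpM2l ?(ltW E0) //.
    have -> : (x - a) * y / S + i + (a * (y - b) / S + i) = 1 - a * b / S + 2 * i.
      rewrite SE; field; by rewrite !lt0r_neq0.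
    by move: iS; lra.
  by move: h u1 u2; lra.
apply: le_trans hE.
rewrite (_ : eps / 2 * (a * b) = (eps * S) * (a * b / S / 2)); last first.
  by field; rewrite lt0r_neq0.
by rewrite ler_wpM2r // !mulr_ge0 ?invr_ge0 ?(ltW S0).
Qed.

End EdgeCount.

(** * Hall's theorem *)

(** Halmos-Vaughan induction: a proper nonempty set without surplus is matched first, and the rest
    outside its neighbourhood; if every such set has a surplus, any single edge can be fixed. *)
Lemma hall (T1 T2 : finType) (r : T1 -> T2 -> bool) (y0 : T2) (A : {set T1}) (B : {set T2}) :
  (forall S : {set T1}, S \subset A -> (#|S| <= #|[set y in B | [exists x in S, r x y]]|)%N) ->
  exists m : T1 -> T2,
    {in A &, injective m} /\ {in A, forall x, r x (m x) && (m x \in B)}.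
Proof.
pose N (C : {set T2}) (S : {set T1}) := [set y in C | [exists x in S, r x y]].
have [n] := ubnP #|A|; elim: n A B => // n IH A B /ltnSE An hallA.
have [A0|[a aA]] := set_0Vmem A.
  by exists (fun=> y0); split=> x; rewrite A0 inE.
have [|strict] := boolP [exists S : {set T1}, [&& S \proper A, S != set0 & #|N B S| <= #|S|]%N].
  case/existsP=> S /and3P[/properP[SA [b bA bS]] S0 NS].
  have [||m1 [m1i m1r]] := IH S B.
  - apply: leq_trans An; apply: proper_card; apply/properP; split=> //; by exists b.
  - by move=> S' S'S; apply: hallA; apply: subset_trans SA.
  have [||m2 [m2i m2r]] := IH (A :\: S) (B :\: N B S).
  - apply: leq_trans An; apply: proper_card; apply/properP; split; first exact: subsetDl.
    case/set0Pn: S0 => c cS; exists c; first exact: (subsetP SA).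
    by rewrite inE cS.
  - move=> S' S'A; have := hallA (S :|: S').
    have S'A1 : S' \subset A by apply: subset_trans S'A (subsetDl _ _).
    rewrite subUset SA S'A1 => /(_ isT).
    have SS' : [disjoint S & S'].
      rewrite disjoint_sym; apply: disjointWl S'A _.
      by rewrite -setI_eq0 setIDAC setDIl setDv setI0.
    have cU : #|S :|: S'| = (#|S| + #|S'|)%N.
      by rewrite cardsU (_ : S :&: S' = set0) ?cards0 ?subn0 //; apply/eqP; rewrite setI_eq0.
    set N' := [set y in B :\: N B S | _].
    have h2 : (#|N B (S :|: S')| <= #|N B S| + #|N'|)%N.
      rewrite -[X in (X <= _)%N](cardsID (N B S)); apply: leq_add.
        by apply: subset_leq_card; apply: subsetIr.
      apply: subset_leq_card; apply/subsetP => y; rewrite !inE => /andP[yN /andP[yB ex]].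
      rewrite yB andbT /= in yN *; rewrite yN /=.
      case/existsP: ex => x /andP[]; rewrite inE => /orP[xS|xS'] rxy.
        by case/negP: yN; apply/existsP; exists x; rewrite xS.
      by apply/existsP; exists x; rewrite xS'.
    by rewrite cU => h; rewrite /N in h2 NS; lia.
  exists (fun x => if x \in S then m1 x else m2 x); split.
    have cross x y : x \in S -> y \in A -> y \notin S -> m1 x <> m2 y.
      move=> xS yA yS mxy; have /andP[_] := m2r y (introT setDP (conj yA yS)).
      rewrite -mxy inE => /andP[/negP[]]; rewrite inE.
      have /andP[rx ->] := m1r _ xS; by apply/existsP; exists x; rewrite xS.
    move=> x y xA yA; case: ifPn => xS; case: ifPn => yS.
    - exact: m1i.
    - by move=> /(cross _ _ xS yA yS).
    - by move=> /esym /(cross _ _ yS xA xS).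
    - by apply: m2i; rewrite inE ?xS ?yS.
  move=> x xA; case: ifPn => xS; first exact: m1r.
  have /m2r/andP[-> ] : x \in A :\: S by rewrite inE xS.
  by rewrite inE => /andP[_ ->].
have [b /andP[bB rab]] : exists b, (b \in B) && r a b.
  have := hallA [set a]; rewrite sub1set aA cards1 card_gt0 => /(_ isT)/set0Pn[b].
  rewrite inE => /andP[bB /existsP[x /andP[/set1P -> rab]]]; exists b; exact/andP.
have [||m [mi mr]] := IH (A :\ a) (B :\ b).
- by apply: leq_trans An; rewrite [X in (_ <= X)%N](cardsD1 a) aA.
- move=> S SA; have [->|S0] := eqVneq S set0; first by rewrite cards0.
  have SpA : S \proper A.
    apply: sub_proper_trans SA _; exact: properD1.
  move: strict; rewrite negb_exists => /forallP/(_ S); rewrite SpA S0 /= -ltnNge => h.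
  rewrite -ltnS; apply: leq_trans h _.
  rewrite (cardsD1 b (N B S)) -add1n; apply: leq_add; first exact: leq_b1.
  apply: subset_leq_card; apply/subsetP => y; rewrite !inE => /and3P[-> -> ->] //.
exists (fun x => if x == a then b else m x); split.
  move=> x y xA yA; case: eqP => [->|/eqP xa]; case: eqP => [->|/eqP ya] //.
  - move=> bm; have /andP[_] := mr y (introT setD1P (conj ya yA)).
    by rewrite -bm !inE eqxx.
  - move=> bm; have /andP[_] := mr x (introT setD1P (conj xa xA)).
    by rewrite bm !inE eqxx.
  - by apply: mi; rewrite !inE ?xa ?ya.
move=> x xA; case: eqP => [->|/eqP xa]; first by rewrite rab bB.
have /andP[-> ] := mr x (introT setD1P (conj xa xA)).
by rewrite inE => /andP[_ ->].
Qed.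

(** * The binomial random graph *)

Section BernoulliSum.
Variables (R : realType) (T : finType).
Implicit Types (p : R) (D S : {set T}) (f : {set T} -> R).

Lemma bexp_sumE p (s : seq T) f : uniq s ->
  bexp p s f = \sum_(S : {set T} | S \subset [set x in s])
     \prod_(e <- s) (if e \in S then p else 1 - p) * f S.
Proof.
elim: s f => [|e s IH] f /=.
  move=> _; rewrite (big_pred1 set0) => [|S]; first by rewrite big_nil mul1r.
  by rewrite set_nil subset0.
case/andP=> es us; rewrite !IH // [RHS](bigID (fun S => e \in S)) /=; congr (_ + _).
  rewrite big_distrr /= (reindex_onto (fun S => S :\ e) (fun S => e |: S)); last first.
    move=> S sS; rewrite setU1K //; apply: contra es => eS.
    by have := subsetP sS _ eS; rewrite inE.
  apply: eq_big => [S|S /andP[sS /eqP eS]].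
    apply/andP/andP.
      case=> sS /eqP eS; split; last by rewrite -eS setU11.
      apply/subsetP => x xS; rewrite !inE; case: eqP => //= /eqP xe.
      by have := subsetP sS x; rewrite !inE xe xS; apply.
    case=> sS eS; split; last by rewrite setD1K.
    apply/subsetP => x; rewrite !inE => /andP[xe xS].
    by have := subsetP sS _ xS; rewrite !inE (negPf xe).
  have eS' : e \in S by rewrite -eS setU11.
  rewrite big_cons eS' eS mulrA; congr (_ * _ * _).
  apply: eq_big_seq => x xs; rewrite !inE; case: eqP => // xe.
  by rewrite -xe xs in es.
rewrite big_distrr /=; apply: eq_big => [S|S sS].
  apply/idP/andP => [sS|[sS eS]].
    split; last by apply: contra es => /(subsetP sS); rewrite inE.
    by apply: subset_trans sS _; apply/subsetP => x; rewrite !inE orbC => ->.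
  apply/subsetP => x xS; have := subsetP sS _ xS; rewrite !inE => /orP[/eqP xe|//].
  by rewrite -xe xS in eS.
rewrite big_cons ifN ?mulrA //.
by apply: contra es => /(subsetP sS); rewrite inE.
Qed.

Lemma bexp_setE p D f :
  bexp p (enum D) f = \sum_(S : {set T} | S \subset D)
     p ^+ #|S| * (1 - p) ^+ #|D :\: S| * f S.
Proof.
rewrite bexp_sumE ?enum_uniq // set_enum; apply: eq_bigr => S SD; congr (_ * _).
rewrite big_enum (bigID (fun e => e \in S)) /=; congr (_ * _).
  rewrite (eq_bigr (fun=> p)) => [|e /andP[_ ->] //].
  rewrite prodr_const; congr (_ ^+ _); apply: eq_card => e.
  by rewrite unfold_in andb_idl // => /(subsetP SD).
rewrite (eq_bigr (fun=> 1 - p)) => [|e /andP[_ /negPf ->] //].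
by rewrite prodr_const; congr (_ ^+ _); apply: eq_card => e; rewrite inE unfold_in andbC.
Qed.

End BernoulliSum.

Section BinomialGraph.
Variables (R : realType) (V : finType).
Implicit Types (p : R) (S : {set {set V}}) (pi : {perm V}).

Lemma gnp_probE p (Q : pred {set {set V}}) :
  gnp_prob p (fun H : sgraph V => Q (edges H)) = bexp p (enum (pairs V)) (fun S => (Q S)%:R).
Proof.
pose G0 : sgraph V := SGraph (sub0set (pairs V)).
rewrite bexp_sumE ?enum_uniq // set_enum.
rewrite (reindex_onto (@edges V) (insubd G0)); last by move=> S SD; exact: insubdK.
rewrite /gnp_prob big_mkcond; apply: eq_big => [H|H _].
  by rewrite edges_sub valKd eqxx.
rewrite /gnp_mass big_enum; case: (Q (edges H)); by rewrite ?mulr1 ?mulr0.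
Qed.

Definition relabel pi S : {set {set V}} := [set pi @: e | e : {set V} in S].

Lemma relabelK pi : cancel (relabel pi) (relabel (pi^-1)%g).
Proof.
move=> S; rewrite /relabel -imset_comp -[RHS]imset_id; apply: eq_imset => e /=.
by rewrite -imset_comp -[RHS]imset_id; apply: eq_imset => x /=; rewrite permK.
Qed.

Lemma relabel_pairs pi S : (relabel pi S \subset pairs V) = (S \subset pairs V).
Proof.
apply/subsetP/subsetP => h e eS.
  have := h (pi @: e) (imset_f _ eS); rewrite !inE card_imset //; exact: perm_inj.
case/imsetP: eS => e' /h; rewrite !inE => e'2 ->; rewrite card_imset //; exact: perm_inj.
Qed.

(** By [bexp_setE] the mass of [S] depends only on its cardinality and that of its complement, both
    unchanged by relabelling. *)
Lemma bexp_relabel p pi (f : {set {set V}} -> R) :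
  bexp p (enum (pairs V)) (fun S => f (relabel pi S)) = bexp p (enum (pairs V)) f.
Proof.
rewrite !bexp_setE [RHS](reindex_onto (relabel pi) (relabel (pi^-1)%g)) /=; last first.
  by move=> S _; rewrite -{1}[pi]invgK relabelK.
apply: eq_big => [S|S sS]; first by rewrite relabel_pairs relabelK eqxx andbT.
have c S' : #|relabel pi S'| = #|S'|.
  by rewrite card_imset //; apply: imset_inj; apply: perm_inj.
have sS' : relabel pi S \subset pairs V by rewrite relabel_pairs.
by rewrite !cardsDS // c.
Qed.

Lemma image_edges_relabel (U : finType) pi (f : {ffun U -> V}) (E : {set {set U}}) S :
  (image_edges [ffun u => pi (f u)] E \subset relabel pi S) = (image_edges f E \subset S).
Proof.
have fE (e : {set U}) : [ffun u => pi (f u)] @: e = pi @: (f @: e).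
  by rewrite -imset_comp; apply: eq_imset => u; rewrite ffunE.
apply/subset_image_edges/subset_image_edges => h e eE.
  have := h _ eE; rewrite fE => /imsetP[e' e'S]; move/(imset_inj (@perm_inj _ pi)) => -> //.
by rewrite fE; apply: imset_f; apply: h.
Qed.

End BinomialGraph.

(** * Rooted copies *)

Section ConstrainedEmbedding.
Variables (R : realType) (U V : finType) (r : rel V).
Implicit Types (S : U -> {set V}) (f g : {ffun U -> V}) (l : seq (U * U)).

Lemma card_ffun_prod S : #|[set f : {ffun U -> V} | [forall u, f u \in S u]]| = (\prod_u #|S u|)%N.
Proof.
have -> : #|[set f : {ffun U -> V} | [forall u, f u \in S u]]| =
    #|(family S : simpl_pred {ffun U -> V})|.
  by apply: eq_card => f; rewrite inE; apply/forallP/familyP => h u; apply: h.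
by rewrite card_family foldrE big_map big_enum.
Qed.

Lemma ecount_card (A B : {set V}) :
  ecount r A B = #|[set z : V * V | [&& z.1 \in A, z.2 \in B & r z.1 z.2]]|.
Proof.
rewrite /ecount pair_big -sum1_card big_mkcond [RHS]big_mkcond; apply: eq_bigr => z _ /=.
by rewrite inE; case: (z.1 \in A); case: (z.2 \in B); case: (r _ _).
Qed.

Definition transversals S l : {set {ffun U -> V}} :=
  [set f : {ffun U -> V} | [forall u, f u \in S u] && all (fun z => r (f z.1) (f z.2)) l].

(* Exchanging the values at the two ends of the new pair with an edge of
   [r] is an involution, whence the double counting. *)
Lemma transversals_cons S z l : z.1 != z.2 ->
  {in l, forall z', [disjoint [set z.1; z.2] & [set z'.1; z'.2]]} ->
  (#|transversals S l| * ecount r (S z.1) (S z.2) <=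
   #|transversals S (z :: l)| * (#|S z.1| * #|S z.2|))%N.
Proof.
case: z => a b /= ab dis; rewrite ecount_card -cardsX -cardsX -cardsX.
set A := setX _ _; set B := setX _ _.
pose upd f (y : V * V) : {ffun U -> V} :=
  [ffun u => if u == a then y.1 else if u == b then y.2 else f u].
pose Phi (x : {ffun U -> V} * (V * V)) := (upd x.1 x.2, (x.1 a, x.1 b)).
have PhiK : involutive Phi.
  case=> f [y w]; rewrite /Phi /=; congr (_, (_, _)).
  - apply/ffunP => u; rewrite !ffunE /=; case: eqP => [->|_] //; by case: eqP => [->|].
  - by rewrite ffunE eqxx.
  - by rewrite ffunE eqxx eq_sym (negPf ab).
rewrite -(card_imset _ (inv_inj PhiK)); apply: subset_leq_card.
apply/subsetP => x /imsetP[[f [y w]] h ->]; move: h; rewrite !inE /=.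
case/andP=> /andP[/forallP fS fl] /and3P[yS wS yw]; rewrite ?inE /= !fS !andbT.
apply/and3P; split.
- by apply/forallP => u; rewrite ffunE; case: eqP => [->//|_]; case: eqP => [->|].
- by rewrite !ffunE !eqxx eq_sym (negPf ab).
apply/allP => z' zl; have := allP fl _ zl; have := dis _ zl.
rewrite -setI_eq0 => /eqP/setP dz.
have ne u : u \in [set z'.1; z'.2] -> upd f (y, w) u = f u.
  move=> uz; have := dz u; rewrite in_setI uz andbT !inE => /negbT.
  by rewrite negb_or ffunE => /andP[/negPf -> /negPf ->].
by rewrite !ne ?set21 ?set22.
Qed.

Lemma card_transversals (d : R) S l : 0 <= d -> uniq l ->
  (forall u, S u != set0) ->
  (forall z, z \in l -> z.1 != z.2) ->
  {in l &, forall z z', z != z' -> [disjoint [set z.1; z.2] & [set z'.1; z'.2]]} ->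
  (forall z, z \in l -> d * (#|S z.1|%:R * #|S z.2|%:R) <= (ecount r (S z.1) (S z.2))%:R) ->
  d ^+ size l * \prod_u #|S u|%:R <= #|transversals S l|%:R.
Proof.
move=> d0 + Sn; elim: l => [|z l IH] /= ul ne dis reg.
  rewrite mul1r -natr_prod -card_ffun_prod ler_nat; apply: subset_leq_card.
  by apply/subsetP => f; rewrite !inE andbT.
case/andP: ul => zl ul.
have {}IH := IH ul (fun z' z'l => ne z' (mem_behead (z'l : z' \in behead (z :: l))))
  (fun z1 z2 h1 h2 => dis z1 z2 (mem_behead (h1 : z1 \in behead (z :: l)))
      (mem_behead (h2 : z2 \in behead (z :: l))))
  (fun z' z'l => reg z' (mem_behead (z'l : z' \in behead (z :: l)))).
have SS : 0 < #|S z.1|%:R * #|S z.2|%:R :> R.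
  by rewrite mulr_gt0 // ltr0n card_gt0.
rewrite exprS -mulrA; apply: (le_trans (ler_wpM2l d0 IH)).
rewrite -(ler_pM2r SS) [leRHS]mulrA mulrAC -[leRHS]mulrA.
have := @transversals_cons S z l (ne _ (mem_head _ _)).
have dl : {in l, forall z', [disjoint [set z.1; z.2] & [set z'.1; z'.2]]}.
  move=> z' z'l; apply: dis; rewrite ?mem_head ?inE ?z'l ?orbT //.
  by apply: contraNneq zl => ->.
move=> /(_ dl); rewrite -(ler_nat R) !natrM; apply: le_trans.
by rewrite mulrC; apply: ler_wpM2l => //; apply: reg; exact: mem_head.
Qed.

(** At most the product of [#|S u|] over [u] outside [D] many transversals agree with a given one on
    [D], against at least [d ^+ #|M|] times the full product in total; the ratio is the quantity
    compared with [t]. For empty [E] the event is impossible, as a transversal exists. *)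
Lemma constrained_embedding (p d t : R) (E : {set {set U}}) (M : {set U * U}) S :
  0 < p <= 1 -> 0 < d -> 0 < t -> E \subset pairs U ->
  (forall u, S u != set0) -> (forall u w v, v \in S u -> v \in S w -> u = w) ->
  (forall z, z \in M -> z.1 != z.2) ->
  {in M &, forall z z', z != z' -> [disjoint [set z.1; z.2] & [set z'.1; z'.2]]} ->
  (forall z, z \in M -> d * (#|S z.1|%:R * #|S z.2|%:R) <= (ecount r (S z.1) (S z.2))%:R) ->
  (forall D : {set U}, induced E D != set0 ->
     t <= d ^+ #|M| * \prod_(u in D) #|S u|%:R * p ^+ #|induced E D|) ->
  bexp p (enum (pairs V)) (fun X =>
     [forall f in transversals S (enum M), ~~ (image_edges f E \subset X)]%:R) <=
  expR (- (t / (4 * 2 ^+ #|U|))).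
Proof.
move=> p01 dpos t0 EU Sn dis Mne Mdis reg ht; have d0 := ltW dpos.
have cT : d ^+ #|M| * \prod_u #|S u|%:R <= #|transversals S (enum M)|%:R.
  rewrite cardE; apply: card_transversals => //; rewrite ?enum_uniq //.
  - by move=> z; rewrite mem_enum; apply: Mne.
  - by move=> z z'; rewrite !mem_enum; apply: Mdis.
  - by move=> z; rewrite mem_enum; apply: reg.
have Tn : transversals S (enum M) != set0.
  rewrite -card_gt0 -(ltr_nat R); apply: lt_le_trans cT.
  by rewrite mulr_gt0 ?exprn_gt0 // prodr_gt0 // => u _; rewrite ltr0n card_gt0.
have [E0|En] := eqVneq E set0.
  rewrite (eq_bexp p (g := fun=> 0)) ?bexp_cst ?expR_ge0 // => X _.
  case: forallP => // h; case/set0Pn: Tn => f fT.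
  by have := h f; rewrite fT E0 /image_edges imset0 sub0set.
have p0 : 0 < p by case/andP: p01.
apply: embedding_probability => //.
  move=> f g u w; rewrite !inE => /andP[/forallP fS _] /andP[/forallP gS _] fg.
  by apply: (dis u w (f u)) => //; rewrite fg.
move=> f D fT Dn.
apply: (@le_trans _ _ (t * \prod_(u | u \notin D) #|S u|%:R)).
  rewrite ler_wpM2l ?(ltW t0) //.
  have -> : \prod_(u | u \notin D) #|S u|%:R =
      (\prod_u #|if u \in D then [set f u] else S u|)%:R :> R.
    rewrite natr_prod big_mkcond; apply: eq_bigr => u _.
    by case: (u \in D); rewrite ?cards1.
  rewrite -card_ffun_prod ler_nat; apply: subset_leq_card; apply/subsetP => g.
  rewrite !inE => /andP[/andP[/forallP gS _] /forall_inP gf].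
  by apply/forallP => u; case: ifP => [/gf/eqP ->|_]; rewrite ?set11.
apply: (@le_trans _ _ (d ^+ #|M| * \prod_u #|S u|%:R * p ^+ #|induced E D|)); last first.
  by rewrite ler_wpM2r // exprn_ge0 // ltW.
rewrite [X in _ <= _ * X * _](bigID (fun u => u \in D)) /= mulrA mulrAC.
by rewrite ler_wpM2r ?ht // prodr_ge0.
Qed.

End ConstrainedEmbedding.

Section UnionBounds.
Variables (R : realType) (T V : finType).

Lemma bexp_union (p : R) (s : seq T) (I : finType) (P : pred I) (B : I -> pred {set T})
    (Q : pred {set T}) : 0 <= p <= 1 ->
  (forall X, Q X -> exists2 i, P i & B i X) ->
  bexp p s (fun X => (Q X)%:R) <= \sum_(i | P i) bexp p s (fun X => (B i X)%:R).
Proof.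
move=> p01 QB; rewrite -bexp_sum; apply: le_bexp => // X _.
case: (boolP (Q X)) => [/QB[i Pi BX]|_]; last exact: sumr_ge0.
by rewrite (bigD1 i) //= BX lerDl sumr_ge0.
Qed.

(** A set of at most [a] elements is the range of a list of length [a] padded with [None]. *)
Lemma card_small_sets (a : nat) :
  (#|[set W : {set V} | #|W| <= a]| <= #|V|.+1 ^ a)%N.
Proof.
have -> : (#|V|.+1 ^ a = #|{: {ffun 'I_a -> option V}}|)%N.
  by rewrite card_ffun card_option card_ord.
pose h (g : {ffun 'I_a -> option V}) := [set v | [exists i, g i == Some v]].
apply: leq_trans (leq_imset_card h _); apply: subset_leq_card.
apply/subsetP => W; rewrite inE => Wa; apply/imsetP.
exists [ffun i : 'I_a => nth None (map Some (enum W)) i] => //.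
apply/setP => v; rewrite inE; apply/idP/existsP => [vW|[i]].
  have iW : (index v (enum W) < #|W|)%N by rewrite cardE index_mem mem_enum.
  exists (Ordinal (leq_trans iW Wa)); rewrite ffunE /= (nth_map v) -?cardE //.
  by rewrite nth_index ?mem_enum.
rewrite ffunE => /eqP h1; have [iW|iW] := ltnP i #|W|.
  move: h1; rewrite (nth_map v) -?cardE // => -[<-].
  by rewrite -mem_enum mem_nth // -cardE.
by move: h1; rewrite nth_default // size_map -cardE.
Qed.

(** The sets of size [i >= 1] contribute at most [((#|V|+1) Y)^i], which is at most its value at
    [i = 1]; there are at most [#|V|+1] sizes. *)
Lemma sum_nonempty_sets (Y : R) : 0 <= Y -> #|V|.+1%:R * Y <= 1 ->
  \sum_(L : {set V} | L != set0) Y ^+ #|L| <= #|V|.+1%:R * (#|V|.+1%:R * Y).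
Proof.
move=> Y0 Y1; have sL (L : {set V}) : (#|L| < #|V|.+1)%N by rewrite ltnS max_card.
rewrite (partition_big (fun L : {set V} => Ordinal (sL L)) predT) //=.
apply: (@le_trans _ _ (\sum_(i < #|V|.+1) #|V|.+1%:R * Y)); last first.
  by rewrite sumr_const card_ord -[leLHS]mulr_natl.
apply: ler_sum => i _; have [i0|i0] := posnP i.
  rewrite big_pred0 => [|L]; first by rewrite !mulr_ge0.
  apply/negP => /andP[L0 /eqP iE]; move: i0; rewrite -iE /= => /eqP.
  by rewrite cards_eq0 (negPf L0).
apply: (@le_trans _ _ ((#|V|.+1%:R * Y) ^+ i)); last first.
  rewrite -[leRHS]expr1; apply: ler_wiXn2l => //; exact: mulr_ge0.
rewrite exprMn -natrX.
apply: (@le_trans _ _ (\sum_(L in [set W : {set V} | #|W| <= i]%N) Y ^+ i)); last first.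
  rewrite sumr_const -[leLHS]mulr_natl ler_wpM2r ?exprn_ge0 // ler_nat.
  exact: card_small_sets.
rewrite big_mkcond [leRHS]big_mkcond; apply: ler_sum => L _; rewrite inE.
case: ifP => [/andP[_ /eqP <-] /=|_]; first by rewrite leqnn.
by case: ifP => // _; rewrite exprn_ge0.
Qed.

End UnionBounds.

(** * The events required of the random graph, and their failure probabilities *)

Section Events.
Variables (R : realType) (U V : finType) (F : sgraph U) (G : sgraph V).
Variables (x : U) (M : {set U * U}) (p c d rho : R) (K : nat).
Let E := edges F.
Let E' := E :\: [set [set z.1; z.2] | z in M].
Let n : R := #|V|%:R.
Let k := #|U|.
Implicit Types (S : {ffun U -> {set V}}) (X : {set {set V}}).

Hypothesis p01 : 0 < p <= 1.
Hypothesis n_gt0 : 0 < n.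
Hypothesis c_ge1 : 1 <= c.
Hypothesis Hc : forall D : {set U}, induced E D != set0 ->
  c * n <= n ^+ #|D| * p ^+ #|induced E D|.

Let p01' : 0 <= p <= 1. Proof. by case/andP: p01 => /ltW -> ->. Qed.

Definition disjoint_family S :=
  [forall u, forall w, (u != w) ==> [disjoint S u & S w]].

Lemma disjoint_familyP S :
  reflect (forall u w v, v \in S u -> v \in S w -> u = w) (disjoint_family S).
Proof.
apply: (iffP forallP) => [h u w v vu vw|h u].
  have [//|uw] := eqVneq u w; have := forallP (h u) w; rewrite uw /= => dis.
  by have := disjointFr dis vu; rewrite vw.
apply/forallP => w; apply/implyP => uw; rewrite -setI_eq0; apply/eqP/setP => v.
rewrite !inE; apply/negP => /andP[vu vw]; by rewrite (h u w v) ?eqxx in uw.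
Qed.

Lemma card_set_families : #|{: {ffun U -> {set V}}}| = (2 ^ (#|V| * k))%N.
Proof.
rewrite card_ffun; have := card_powerset [set: V]; rewrite powersetT !cardsT => ->.
by rewrite expnM.
Qed.

Lemma union_over_families (P : pred {ffun U -> {set V}})
    (B : {ffun U -> {set V}} -> pred {set {set V}}) (Q : pred {set {set V}}) (q : R) :
  (forall X, Q X -> exists2 S, P S & B S X) -> 0 <= q ->
  (forall S, P S -> bexp p (enum (pairs V)) (fun X => (B S X)%:R) <= q) ->
  bexp p (enum (pairs V)) (fun X => (Q X)%:R) <= 2 ^+ (#|V| * k) * q.
Proof.
move=> QB q0 hB; apply: le_trans (bexp_union _ p01' QB) _.
apply: (@le_trans _ _ (\sum_(S | P S) q)); first exact: ler_sum.
rewrite sumr_const -[leLHS]mulr_natl ler_wpM2r // -natrX ler_nat -card_set_families.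
exact: max_card.
Qed.

(** Quantifying over all families inside the event allows later greedy choices of classes to depend
    on the random graph. *)
Definition spread (gam : R) : pred {set {set V}} := fun X =>
  [forall S : {ffun U -> {set V}},
    (disjoint_family S && [forall u, gam * n <= #|S u|%:R]) ==>
    [exists f : {ffun U -> V}, [forall u, f u \in S u] && (image_edges f E \subset X)]].

Lemma prod_card_ge (S : {ffun U -> {set V}}) (D : {set U}) (a : R) : 0 < a <= 1 ->
  (forall u, u \in D -> a * n <= #|S u|%:R) ->
  a ^+ k * n ^+ #|D| <= \prod_(u in D) #|S u|%:R.
Proof.
case/andP=> a0 a1 hS; apply: (@le_trans _ _ (\prod_(u in D) (a * n))).
  rewrite prodr_const exprMn ler_wpM2r ?exprn_ge0 ?(ltW n_gt0) //.
  by apply: ler_wiXn2l; rewrite ?(ltW a0) // max_card.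
by apply: ler_prod => u uD; rewrite hS // mulr_ge0 ?(ltW a0) ?(ltW n_gt0).
Qed.

Lemma spread_probability (gam : R) : 0 < gam <= 1 ->
  bexp p (enum (pairs V)) (fun X => (~~ spread gam X)%:R) <=
  2 ^+ (#|V| * k) * expR (- (gam ^+ k * (c * n) / (4 * 2 ^+ k))).
Proof.
move=> g01; have /andP[g0 g1] := g01.
pose P S := disjoint_family S && [forall u, gam * n <= #|S u|%:R].
apply: (@union_over_families P (fun S X =>
   [forall f in transversals (adj G) S (enum (set0 : {set U * U})), ~~ (image_edges f E \subset X)])).
- move=> X /forallPn[S]; rewrite negb_imply => /andP[PS /existsPn h].
  exists S => //; apply/forall_inP => f; rewrite inE => /andP[fS _].
  by have := h f; rewrite fS.
- exact: expR_ge0.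
move=> S /andP[/disjoint_familyP dS /forallP Sn].
have c0 : 0 < c by apply: lt_le_trans c_ge1.
apply: (@constrained_embedding _ _ _ (adj G) p 1) => //.
- by rewrite !mulr_gt0 ?exprn_gt0.
- exact: edges_sub.
- move=> u; rewrite -card_gt0 -(ltr_nat R); apply: lt_le_trans (Sn u).
  exact: mulr_gt0.
- by move=> z; rewrite inE.
- by move=> z z'; rewrite inE.
- by move=> z; rewrite inE.
move=> D Dn; rewrite cards0 expr0 mul1r.
apply: (@le_trans _ _ (gam ^+ k * n ^+ #|D| * p ^+ #|induced E D|)).
  by rewrite -mulrA ler_wpM2l ?exprn_ge0 ?(ltW g0) ?Hc.
rewrite ler_wpM2r ?exprn_ge0 ?prod_card_ge //.
by case/andP: p01'.
Qed.

Hypothesis HK : forall D : {set U}, x \in D -> (2 <= #|D|)%N ->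
  K%:R ^+ 3 * n <= n ^+ #|D| * p ^+ #|induced E' D|.
Hypothesis Mok : forall z, z \in M ->
  [/\ z.1 != z.2, [set z.1; z.2] \in E, x != z.1 & x != z.2].
Hypothesis Mdis :
  {in M &, forall z z', z != z' -> [disjoint [set z.1; z.2] & [set z'.1; z'.2]]}.
Hypothesis d01 : 0 < d <= 1.
Hypothesis rho01 : 0 < rho <= 1.

(** The edges of [M] are left to [G], through [transversals]; only [E'] is demanded of the random
    graph. *)
Definition rooted_copy (S : {ffun U -> {set V}}) : pred {set {set V}} := fun X =>
  [exists f in transversals (adj G) S (enum M), image_edges f E' \subset X].

(** For Janson's inequality, a set [D] containing the root contributes [#|S x| * K ^ 3] by [HK], and
    a set avoiding it [c * n] by [Hc]; [tau] is a common lower bound. *)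
Lemma rooted_copy_probability S (tau : R) :
  disjoint_family S -> S x != set0 ->
  (forall u, u != x -> rho * n <= #|S u|%:R) ->
  (forall z, z \in M ->
     d * (#|S z.1|%:R * #|S z.2|%:R) <= (ecount (adj G) (S z.1) (S z.2))%:R) ->
  0 < tau -> tau <= #|S x|%:R * K%:R ^+ 3 -> tau <= c * n ->
  bexp p (enum (pairs V)) (fun X => (~~ rooted_copy S X)%:R) <=
  expR (- (d ^+ #|M| * (rho ^+ k * tau) / (4 * 2 ^+ k))).
Proof.
move=> /disjoint_familyP dS Sx Sn Sreg tau0 tau1 tau2.
have [/andP[d0 d1] /andP[r0 r1] /andP[p0 p1]] := And3 d01 rho01 p01.
have E'E : E' \subset E by exact: subsetDl.
have E'U : E' \subset pairs U by apply: subset_trans E'E (edges_sub F).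
rewrite (eq_bexp p (g := fun X => [forall f in transversals (adj G) S (enum M),
   ~~ (image_edges f E' \subset X)]%:R)); last first.
  move=> X _; rewrite /rooted_copy negb_exists; congr (nat_of_bool _)%:R.
  by apply: eq_forallb => f; rewrite negb_and implybE.
apply: (@constrained_embedding _ _ _ (adj G) p d) => //.
- by rewrite !mulr_gt0 ?exprn_gt0.
- move=> u; have [->//|ux] := eqVneq u x.
  by rewrite -card_gt0 -(ltr_nat R); apply: lt_le_trans (Sn u ux); apply: mulr_gt0.
- by move=> z /Mok[].
move=> D Dn; rewrite -mulrA ler_wpM2l ?exprn_ge0 ?(ltW d0) //.
have [e] := set0Pn _ Dn; rewrite inE => /andP[eE' eD].
have eE : e \in E by apply: (subsetP E'E).
have D2 : (2 <= #|D|)%N.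
  have := subsetP E'U _ eE'; rewrite inE => /eqP e2.
  by have := subset_leq_card eD; rewrite e2.
have [xD|xD] := boolP (x \in D).
  rewrite (big_setD1 x) //=.
  apply: (@le_trans _ _ (#|S x|%:R * (rho ^+ k * n ^+ #|D :\ x|) * p ^+ #|induced E' D|)).
    have h : K%:R ^+ 3 <= n ^+ #|D :\ x| * p ^+ #|induced E' D|.
      rewrite -(ler_pM2r n_gt0); apply: (le_trans (HK xD D2)).
      by rewrite (cardsD1 x D) xD exprS -mulrA mulrC.
    rewrite [#|S x|%:R * _]mulrCA -!mulrA ler_wpM2l ?exprn_ge0 ?(ltW r0) //.
    by apply: (le_trans tau1); rewrite ler_wpM2l.
  rewrite ler_wpM2r ?exprn_ge0 ?(ltW p0) // ler_wpM2l // prod_card_ge //.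
  by move=> u; rewrite !inE => /andP[ux _]; apply: Sn.
apply: (@le_trans _ _ (rho ^+ k * n ^+ #|D| * p ^+ #|induced E' D|)).
  rewrite -mulrA ler_wpM2l ?exprn_ge0 ?(ltW r0) //; apply: (le_trans tau2).
  have Dn' : induced E D != set0 by apply/set0Pn; exists e; rewrite inE eE.
  apply: (le_trans (Hc Dn')); rewrite ler_wpM2l ?exprn_ge0 ?(ltW n_gt0) //.
  apply: ler_wiXn2l; rewrite ?(ltW p0) //; apply: subset_leq_card.
  by apply/subsetP => y; rewrite !inE => /andP[/andP[_ ->] ->].
rewrite ler_wpM2r ?exprn_ge0 ?(ltW p0) // prod_card_ge //.
by move=> u uD; apply: Sn; apply: contraNneq xD => <-.
Qed.

Definition regular_on (S : U -> {set V}) :=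
  [forall z in M, d * (#|S z.1|%:R * #|S z.2|%:R) <= (ecount (adj G) (S z.1) (S z.2))%:R].

(* With at least [n / K ^ 2] roots, the failure probability beats a union bound over
   all vertex classes; with fewer roots, as in [few_roots], it only beats one over
   prescribed classes [T j u] with a small set [W] of used vertices removed. *)
Definition many_roots : pred {set {set V}} := fun X =>
  [forall S : {ffun U -> {set V}},
    [&& disjoint_family S, [forall u, (u != x) ==> (rho * n <= #|S u|%:R)],
        n <= #|S x|%:R * K%:R ^+ 2 & regular_on S] ==> rooted_copy S X].

Lemma many_roots_probability : c <= K%:R ->
  bexp p (enum (pairs V)) (fun X => (~~ many_roots X)%:R) <=
  2 ^+ (#|V| * k) * expR (- (d ^+ #|M| * (rho ^+ k * (c * n)) / (4 * 2 ^+ k))).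
Proof.
move=> cK; pose P S := [&& disjoint_family S, [forall u, (u != x) ==> (rho * n <= #|S u|%:R)],
        n <= #|S x|%:R * K%:R ^+ 2 & regular_on S].
apply: (@union_over_families P (fun S X => ~~ rooted_copy S X)).
- by move=> X /forallPn[S]; rewrite negb_imply => /andP[PS h]; exists S.
- exact: expR_ge0.
have c0 : 0 < c by apply: lt_le_trans c_ge1.
move=> S /and4P[dS /forallP Sn Sx /forall_inP reg].
apply: rooted_copy_probability => //.
- apply: contraTneq Sx => ->; by rewrite cards0 mul0r -ltNge.
- by move=> u; have /implyP := Sn u.
- exact: mulr_gt0.
(* Two factors of [K] turn the number of roots into [n], and the third exceeds [c]. *)
rewrite exprSr mulrA mulrC; apply: ler_pM => //; exact: ltW.
Qed.

Variables (J : finType) (T : J -> U -> {set V}).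
Hypothesis Tdis : forall j u w v, u != x -> w != x -> v \in T j u -> v \in T j w -> u = w.
Hypothesis Tbig : forall j u, u != x -> 2 * rho * n <= #|T j u|%:R.
Hypothesis Treg : forall j z (A B : {set V}), z \in M -> A \subset T j z.1 -> B \subset T j z.2 ->
  (#|T j z.1| <= 2 * #|A|)%N -> (#|T j z.2| <= 2 * #|B|)%N ->
  d * (#|A|%:R * #|B|%:R) <= (ecount (adj G) A B)%:R.

Definition root_system j (L W : {set V}) : {ffun U -> {set V}} :=
  [ffun u => if u == x then L else T j u :\: W].

Definition few_roots : pred {set {set V}} := fun X =>
  [forall j, forall L : {set V}, forall W : {set V},
    [&& L != set0, [forall u, (u != x) ==> [disjoint L & T j u]],
        (#|L| * K ^ 2 <= #|V|)%N & (#|W| <= K * #|L|)%N] ==>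
    rooted_copy (root_system j L W) X].

(** Removing at most [rho * n] vertices costs at most half of each class, by the factor 2 in [Tbig];
    [Treg] is formulated for halves for this reason. *)
Lemma root_system_ok j (L W : {set V}) : 1 <= rho * K%:R ->
  [forall u, (u != x) ==> [disjoint L & T j u]] ->
  rho^-1 * #|W|%:R <= n ->
  [/\ disjoint_family (root_system j L W),
    forall u, u != x -> rho * n <= #|root_system j L W u|%:R &
    forall z, z \in M -> d * (#|root_system j L W z.1|%:R * #|root_system j L W z.2|%:R) <=
     (ecount (adj G) (root_system j L W z.1) (root_system j L W z.2))%:R].
Proof.
move=> rK /forallP LT Wn; have /andP[r0 r1] := rho01.
have Wn' : #|W|%:R <= rho * n by move: Wn; rewrite mulrC ler_pdivrMr // mulrC.
have cT u : #|T j u|%:R <= #|T j u :\: W|%:R + #|W|%:R :> R.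
  rewrite -natrD ler_nat -(cardsID W (T j u)) addnC leq_add2l.
  by apply: subset_leq_card; apply: subsetIr.
have big u : u != x -> rho * n <= #|T j u :\: W|%:R.
  by move=> ux; have := Tbig j ux; have := cT u; move: Wn'; rewrite -mulrA; lra.
have half u : u != x -> (#|T j u| <= 2 * #|T j u :\: W|)%N.
  move=> ux; rewrite -(ler_nat R) natrM.
  by have := Tbig j ux; have := cT u; move: Wn'; rewrite -mulrA; lra.
split.
- apply/disjoint_familyP => u w v; rewrite !ffunE.
  case: eqP => [->|/eqP ux]; case: eqP => [->//|/eqP wx].
  + rewrite inE => vL /andP[_ vT]; have := LT w; rewrite wx /= => dis.
    by have := disjointFr dis vL; rewrite vT.
  + rewrite inE => /andP[_ vT] vL; have := LT u; rewrite ux /= => dis.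
    by have := disjointFr dis vL; rewrite vT.
  by rewrite !inE => /andP[_ vu] /andP[_ vw]; apply: (Tdis ux wx vu vw).
- by move=> u ux; rewrite ffunE (negPf ux); apply: big.
move=> z zM; have [_ _ x1 x2] := Mok zM; rewrite !ffunE ![_ == x]eq_sym.
rewrite (negPf x1) (negPf x2); apply: (@Treg j z) => //; rewrite ?subsetDl //;
  by apply: half; rewrite eq_sym.
Qed.

(** A pair [(L, W)] fails with probability at most [q ^+ #|L|], and there are at most
    [(n+1)^(K #|L|)] sets [W]. With one more factor [n+1] per element for the choice of [L], the
    union bound is a geometric sum over [#|L|]. *)
Lemma few_roots_probability (q : R) :
  1 <= rho * K%:R ->
  expR (- (d ^+ #|M| * (rho ^+ k * K%:R ^+ 2) / (4 * 2 ^+ k))) = q ->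
  #|V|.+1%:R ^+ K.+1 * q <= 1 ->
  bexp p (enum (pairs V)) (fun X => (~~ few_roots X)%:R) <=
  #|J|%:R * #|V|.+1%:R * (#|V|.+1%:R ^+ K.+1 * q).
Proof.
move=> rK qE q1; have /andP[r0 r1] := rho01.
have q0 : 0 <= q by rewrite -qE expR_ge0.
have K0 : (0 < K)%N by case: (posnP K) => // K00; move: rK; rewrite K00 mulr0 ler10.
pose P (i : J * ({set V} * {set V})) := [&& i.2.1 != set0,
   [forall u, (u != x) ==> [disjoint i.2.1 & T i.1 u]],
    (#|i.2.1| * K ^ 2 <= #|V|)%N & (#|i.2.2| <= K * #|i.2.1|)%N].
apply: le_trans (@bexp_union _ _ p _ _ P (fun i X => ~~ rooted_copy (root_system i.1 i.2.1 i.2.2) X) _ p01' _) _.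
  move=> X /forallPn[j /forallPn[L /forallPn[W]]]; rewrite negb_imply => /andP[h1 h2].
  by exists (j, (L, W)).
apply: (@le_trans _ _ (\sum_(i | P i) q ^+ #|i.2.1|)).
  apply: ler_sum => -[j [L W]] /= /and4P /= [L0 LT Ln WK].
  have c0 : 0 < c by apply: lt_le_trans c_ge1.
  have Wn : rho^-1 * #|W|%:R <= n.
    apply: (@le_trans _ _ (K%:R * (K * #|L|)%:R)).
      by apply: ler_pM; rewrite ?invr_ge0 ?(ltW r0) ?ler_nat // -div1r ler_pdivrMr // mulrC.
    by rewrite -natrM ler_nat; apply: leq_trans Ln; rewrite mulnA mulnn mulnC.
  have [s1 s2 s3] := root_system_ok rK LT Wn.
  have Lx : root_system j L W x = L by rewrite ffunE eqxx.
  have l0 : 0 < #|L|%:R :> R by rewrite ltr0n card_gt0.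
  have k0 : 0 < K%:R :> R by rewrite ltr0n.
  have K1 : 1 <= K%:R :> R by rewrite ler1n.
  apply: le_trans (rooted_copy_probability (tau := #|L|%:R * K%:R ^+ 2) s1 _ s2 s3 _ _ _) _.
  - by rewrite Lx.
  - by rewrite mulr_gt0 ?exprn_gt0.
  - by rewrite Lx ler_wpM2l // ler_weXn2l.
  - apply: (@le_trans _ _ n); first by rewrite -natrX -natrM ler_nat.
    by rewrite ler_peMl // ltW.
  rewrite -qE -expRM_natl ler_expR -mulr_natl mulrN lerN2 le_eqVlt; apply/orP; left.
  by apply/eqP; ring.
rewrite -(pair_big_dep predT (fun j (LW : {set V} * {set V}) => P (j, LW))
   (fun j (LW : {set V} * {set V}) => q ^+ #|LW.1|)) /=.
apply: (@le_trans _ _ (\sum_(j : J) #|V|.+1%:R * (#|V|.+1%:R ^+ K.+1 * q))); last first.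
  by rewrite sumr_const -[leLHS]mulr_natl mulrA.
apply: ler_sum => j _.
apply: (@le_trans _ _ (\sum_(L : {set V} | L != set0)
    \sum_(W : {set V} | W \in [set W : {set V} | #|W| <= K * #|L|]%N) q ^+ #|L|)).
  rewrite pair_big_dep /= big_mkcond [leRHS]big_mkcond; apply: ler_sum => -[L W] _.
  rewrite /P /= inE; case: ifP => [/and4P[-> _ _ ->] //|_].
  by case: ifP => // _; rewrite exprn_ge0.
pose Y := #|V|.+1%:R ^+ K * q.
apply: (@le_trans _ _ (\sum_(L : {set V} | L != set0) Y ^+ #|L|)).
  apply: ler_sum => L _; rewrite sumr_const -[leLHS]mulr_natl /Y exprMn ler_wpM2r ?exprn_ge0 //.
  by rewrite -exprM -natrX ler_nat card_small_sets.
have Y0 : 0 <= Y by rewrite mulr_ge0 ?exprn_ge0.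
have YE : #|V|.+1%:R * Y = #|V|.+1%:R ^+ K.+1 * q by rewrite mulrA -exprS.
by rewrite -YE; apply: sum_nonempty_sets; rewrite // YE.
Qed.

End Events.

(** * Well-spread tiles *)

Section CommonNeighbours.
Variables (R : realType) (U V : finType) (r : rel V) (X Y : {set V}) (d eta : R).
Hypotheses (d01 : 0 < d <= 1) (eta0 : 0 < eta).
Hypothesis reg : forall A B : {set V}, A \subset X -> B \subset Y ->
  eta * #|X|%:R <= #|A|%:R -> eta * #|Y|%:R <= #|B|%:R ->
  d * (#|A|%:R * #|B|%:R) <= (ecount r A B)%:R.

Definition common (Z : {set V}) (s : seq V) := [set y in Z | all (fun x => r x y) s].

(** Otherwise the vertices of low degree would themselves form, with [B], a subpair that is large
    and too sparse. *)
Lemma few_low_degree (B : {set V}) : B \subset Y -> eta * #|Y|%:R <= #|B|%:R ->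
  #|[set x in X | #|[set y in B | r x y]|%:R < d * #|B|%:R]|%:R <= eta * #|X|%:R.
Proof.
move=> BY hB; set A := [set x in X | _]; rewrite leNgt; apply/negP => hA.
have AX : A \subset X by apply/subsetP => x; rewrite inE => /andP[].
have := reg AX BY (ltW hA) hB; apply/negP; rewrite -ltNge ecount_deg natr_sum.
have A0 : A != set0.
  apply: contraTneq hA => ->; rewrite cards0 -leNgt; apply: mulr_ge0 => //; exact: ltW.
have -> : d * (#|A|%:R * #|B|%:R) = \sum_(x in A) (d * #|B|%:R).
  by rewrite sumr_const -[RHS]mulr_natl; ring.
have [x xA] := set0Pn _ A0.
rewrite (bigD1 x) //= [X in _ < X](bigD1 x) //=; apply: ltr_leD.
  by move: xA; rewrite inE => /andP[].
by apply: ler_sum => y /andP[]; rewrite inE => /andP[_ /ltW].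
Qed.

(** In a bad tuple either the tail is already bad, or the head has low degree into the still large
    common neighbourhood of the tail. The second case costs a fraction [eta] at each of the [k]
    steps. *)
Lemma bad_tuples (k : nat) (Z : {set V}) : Z \subset Y -> eta * #|Y|%:R <= d ^+ k * #|Z|%:R ->
  #|[set t : k.-tuple V | all (mem X) t && (#|common Z t|%:R < d ^+ k * #|Z|%:R)]|%:R
  <= k%:R * eta * #|X|%:R ^+ k.
Proof.
move=> ZY; have /andP[d0 d1] := d01; elim: k => [|k IH] hZ.
  rewrite mul0r mul0r; rewrite (_ : [set t | _] = set0) ?cards0 //.
  apply/setP => t; rewrite !inE mul1r tuple0 /= (_ : common Z [::] = Z) ?ltxx //.
  by apply/setP => y; rewrite !inE andbT.
have hZ' : eta * #|Y|%:R <= d ^+ k * #|Z|%:R.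
  by apply: (le_trans hZ); rewrite ler_wpM2r // ler_wiXn2l // ltW.
have {}IH := IH hZ'; set Bk := [set t : k.-tuple V | _] in IH.
pose low (t : k.-tuple V) := [set x in X | #|[set y in common Z t | r x y]|%:R < d * #|common Z t|%:R].
pose Gk := [set t : k.-tuple V | all (mem X) t && (d ^+ k * #|Z|%:R <= #|common Z t|%:R)].
pose C1 := setX X Bk.
pose C2 := [set z : V * k.-tuple V | (z.2 \in Gk) && (z.1 \in low z.2)].
set Bk1 := [set t : k.+1.-tuple V | _].
have split_card : (#|Bk1| <= #|C1| + #|C2|)%N.
  pose h (t : k.+1.-tuple V) := (thead t, [tuple of behead t]).
  have hi : injective h.
    move=> t t' [h1 h2]; rewrite (tuple_eta t) (tuple_eta t') h1; congr [tuple of _ :: _].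
    by apply: val_inj.
  rewrite -(card_imset _ hi); apply: leq_trans (leq_card_setU _ _).
  apply: subset_leq_card; apply/subsetP => _ /imsetP[t tB ->].
  move: tB; rewrite /h; case/tupleP: t => x t; rewrite theadE inE /= => /andP[/andP[xX tX] lowt].
  have -> : [tuple of behead [tuple of x :: t]] = t by apply: val_inj.
  rewrite !inE /= xX tX /=.
  case: (ltP #|common Z t|%:R (d ^+ k * #|Z|%:R)) => //= hh.
  have -> : [set y in common Z t | r x y] = common Z (x :: t).
    by apply/setP => y; rewrite !inE /= -andbA; congr (_ && _); rewrite andbC.
  by apply: (lt_le_trans lowt); rewrite exprS -mulrA ler_wpM2l // ltW.
have cardG : #|Gk|%:R <= #|X|%:R ^+ k :> R.
  rewrite -natrX ler_nat.
  apply: (@leq_trans #|[set f : {ffun 'I_k -> V} | [forall i, f i \in X]]|); last first.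
    by rewrite card_ffun_prod prod_nat_const card_ord.
  pose h (t : k.-tuple V) : {ffun 'I_k -> V} := [ffun i => tnth t i].
  have hi : injective h.
    by move=> t t' /ffunP e; apply: eq_from_tnth => i; have := e i; rewrite !ffunE.
  rewrite -(card_imset _ hi); apply: subset_leq_card.
  apply/subsetP => _ /imsetP[t tG ->]; rewrite inE; apply/forallP => i; rewrite ffunE.
  by move: tG; rewrite inE => /andP[/allP tX _]; apply: tX; exact: mem_tnth.
have cardC2 : #|C2|%:R <= eta * #|X|%:R * #|X|%:R ^+ k.
  have -> : #|C2| = (\sum_(t in Gk) #|low t|)%N.
    rewrite -sum1_card big_mkcond /= (eq_bigr (fun z : V * k.-tuple V =>
      ((z.2 \in Gk) && (z.1 \in low z.2) : nat))) => [|z _]; last by rewrite inE; case: ifP.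
    rewrite -(pair_big predT predT (fun x t => ((t \in Gk) && (x \in low t) : nat))) /=.
    rewrite exchange_big [RHS]big_mkcond; apply: eq_bigr => t _.
    case: ifP => tG /=; last by rewrite big1.
    by rewrite -sum1_card [RHS]big_mkcond; apply: eq_bigr => x _; case: ifP.
  rewrite natr_sum; apply: (@le_trans _ _ (\sum_(t in Gk) eta * #|X|%:R)).
    apply: ler_sum => t; rewrite inE => /andP[_ ht]; apply: few_low_degree.
      by apply: subset_trans ZY; apply/subsetP => y; rewrite inE => /andP[].
    exact: le_trans ht.
  rewrite sumr_const -[leLHS]mulr_natl mulrC ler_wpM2l // mulr_ge0 // ltW //.
have cardC1 : #|C1|%:R <= #|X|%:R * (k%:R * eta * #|X|%:R ^+ k).
  by rewrite cardsX natrM ler_wpM2l.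
apply: (@le_trans _ _ (#|C1|%:R + #|C2|%:R)); first by rewrite -natrD ler_nat.
apply: (le_trans (lerD cardC1 cardC2)); rewrite -addn1 natrD exprD expr1 le_eqVlt.
by apply/orP; left; apply/eqP; ring.
Qed.

Definition common_ffun (Z : {set V}) (f : {ffun U -> V}) := [set y in Z | [forall u, r (f u) y]].

Lemma bad_functions (Z : {set V}) : Z \subset Y -> eta * #|Y|%:R <= d ^+ #|U| * #|Z|%:R ->
  #|[set f : {ffun U -> V} | [forall u, f u \in X] &&
      (#|common_ffun Z f|%:R < d ^+ #|U| * #|Z|%:R)]|%:R
  <= #|U|%:R * eta * #|X|%:R ^+ #|U|.
Proof.
move=> ZY hZ; apply: le_trans (bad_tuples ZY hZ); rewrite ler_nat.
rewrite -(card_imset _ (can_inj (@fgraphK U V))); apply: subset_leq_card.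
apply/subsetP => _ /imsetP[f fB ->]; move: fB; rewrite !inE => /andP[/forallP fX hf].
have allf (P : pred V) : all P (fgraph f) = [forall u, P (f u)].
  rewrite -codom_ffun; apply/allP/forallP => h u; first by apply: h; exact: codom_f.
  by case/codomP => w ->.
rewrite allf; apply/andP; split; first exact/forallP.
have -> // : common Z (fgraph f) = common_ffun Z f.
by apply/setP => y; rewrite !inE allf.
Qed.

End CommonNeighbours.

(** * Uniform injections from random permutations *)

Section PermutationCounting.
Variables (J V : finType) (X : {set V}).
Local Open Scope group_scope.

Definition injections : {set {ffun J -> V}} :=
  [set g : {ffun J -> V} | injectiveb g && [forall j, g j \in X]].

Definition symm : {set {perm V}} := [set s | perm_on X s].

Definition act_ffun (s : {perm V}) (t : {ffun J -> V}) : {ffun J -> V} := [ffun j => s (t j)].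

Lemma card_injections : #|injections| = (#|X| ^_ #|J|)%N.
Proof.
by rewrite -card_inj_ffuns_on; apply: eq_card => g; rewrite !inE andbC.
Qed.

Lemma act_injections s t : s \in symm -> t \in injections -> act_ffun s t \in injections.
Proof.
rewrite !inE => sX /andP[/injectiveP ti /forallP tX]; apply/andP; split.
  by apply/injectiveP => i j; rewrite !ffunE => /perm_inj; apply: ti.
by apply/forallP => j; rewrite ffunE perm_closed.
Qed.

(** The permutation is corrected one index at a time by a transposition, which does not disturb the
    indices already settled. *)
Lemma perm_extension (g g' : {ffun J -> V}) : g \in injections -> g' \in injections ->
  exists2 s, s \in symm & act_ffun s g = g'.
Proof.
rewrite !inE => /andP[/injectiveP gi /forallP gX] /andP[/injectiveP gi' /forallP gX'].
suff [s sX sg] : exists2 s, s \in symm & {in enum J, forall j, s (g j) = g' j}.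
  by exists s => //; apply/ffunP => j; rewrite ffunE sg // mem_enum.
elim: (enum J) (enum_uniq J) => [|j l IH] /=.
  by move=> _; exists 1 => //; rewrite inE perm_on1.
case/andP=> jl /IH[s sX sl]; rewrite inE in sX.
exists (s * tperm (s (g j)) (g' j)).
  rewrite inE; apply: perm_onM => //; apply: subset_trans (tperm_on _ _) _.
  by apply/subsetP => v; rewrite !inE => /orP[] /eqP ->; rewrite ?perm_closed.
move=> i; rewrite inE permM => /orP[/eqP ->|il]; first by rewrite tpermL.
have ij : j != i by apply: contraNneq jl => ->.
rewrite (sl _ il) tpermD // ?(inj_eq gi') // -(sl _ il) (inj_eq perm_inj) (inj_eq gi) //.
Qed.

(* The symmetric group acts transitively on injections, so a random
   permutation carries a fixed injection to a uniform one. *)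
Lemma card_symm_orbit (t : {ffun J -> V}) (B : {set {ffun J -> V}}) : t \in injections ->
  (#|[set s in symm | act_ffun s t \in B]| * #|injections| <= #|B :&: injections| * #|symm|)%N.
Proof.
move=> tI; pose N g := #|[set s in symm | act_ffun s t == g]|.
have Nle g g' : g \in injections -> g' \in injections -> (N g <= N g')%N.
  move=> gI g'I; have [s sX sg] := perm_extension gI g'I.
  rewrite /N -(card_imset _ (mulIg s)); apply: subset_leq_card.
  apply/subsetP => _ /imsetP[w + ->]; rewrite !inE => /andP[wX /eqP wt].
  rewrite inE in sX; rewrite perm_onM //=; apply/eqP/ffunP => j.
  have wj : w (t j) = g j by rewrite -wt ffunE.
  by rewrite ffunE permM wj -sg ffunE.
have sumN (C : {set {ffun J -> V}}) :
    #|[set s in symm | act_ffun s t \in C]| = (\sum_(g in C :&: injections) N g)%N.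
  rewrite -sum1_card (partition_big (fun s => act_ffun s t) (mem (C :&: injections))) /=.
    apply: eq_bigr => g gC; rewrite /N -sum1_card; apply: eq_bigl => s.
    rewrite !inE -!andbA; case: (perm_on X s) => //=.
    case: eqP => [->|]; rewrite ?andbF ?andbT //; by case/setIP: gC.
  by move=> s; rewrite inE => /andP[sX sC]; rewrite inE sC act_injections.
have symE : #|symm| = (\sum_(g in injections) N g)%N.
  rewrite -[injections in RHS]setTI -sumN; apply: eq_card => s; rewrite !inE andbT //.
rewrite sumN symE big_distrl -sum_nat_const; apply: leq_sum => g /setIP[_ gI] /=.
by rewrite mulnC -sum_nat_const; apply: leq_sum => g' g'I; apply: Nle.
Qed.

(** It compares uniform injections with uniform functions, where the tiles are independent, at the
    price of a factor 2 per vertex. *)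
Lemma ffact_lower (n j : nat) : (2 * j <= n)%N -> (n ^ j <= 2 ^ j * n ^_ j)%N.
Proof.
elim: j => [|j IH] h; first by rewrite ffactn0.
rewrite ffactnSr expnSr expnS.
rewrite (_ : 2 * 2 ^ j * (n ^_ j * (n - j)) = (2 ^ j * n ^_ j) * (2 * (n - j)))%N; last by ring.
by apply: leq_mul; [apply: IH; lia|lia].
Qed.

End PermutationCounting.

Lemma card_union_bound (T I : finType) (B : {set T}) (P : pred I) (A : I -> {set T}) :
  (forall t, t \in B -> exists2 i, P i & t \in A i) ->
  (#|B| <= \sum_(i | P i) #|A i|)%N.
Proof.
move=> h; under eq_bigr do rewrite -sum1_card big_mkcond /=.
rewrite exchange_big -sum1_card big_mkcond; apply: leq_sum => t _.
case: ifP => // /h[i Pi tA]; by rewrite (bigD1 i) //= tA.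
Qed.

Section Tiles.
Variables (R : realType) (U V : finType) (E : {set {set U}}) (r : rel V).
Variables (X Y : {set V}) (p d eta : R) (m q : nat).
Let k := #|U|.
Let h := #|Y|.
Let J : finType := ('I_m * U)%type.

Definition tile (t : {ffun 'I_m * U -> V}) (i : 'I_m) : {ffun U -> V} := [ffun u => t (i, u)].

Definition meagre (t : {ffun 'I_m * U -> V}) (Z : {set V}) : {set 'I_m} :=
  [set i | #|common_ffun r Z (tile t i)|%:R < d ^+ k * #|Z|%:R].

(** Sets of fewer than [h / q] elements are negligible throughout; writing the threshold with [q]
    multiplied out keeps it in the natural numbers. *)
Definition ill_spread : {set {ffun 'I_m * U -> V}} :=
  [set t | [exists Z : {set V}, [&& Z \subset Y, (h <= q * #|Z|)%N & (h <= q * #|meagre t Z|)%N]]].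

Definition copies_of (t : {ffun 'I_m * U -> V}) (S : {set {set V}}) :=
  [forall i, image_edges (tile t i) E \subset S].

Definition tiles_exist : pred {set {set V}} := fun S =>
  [exists t in injections ('I_m * U)%type X, copies_of t S].

Definition good_tiles : pred {set {set V}} := fun S =>
  [exists t in injections ('I_m * U)%type X, copies_of t S && (t \notin ill_spread)].

Hypotheses (p01 : 0 <= p <= 1) (d01 : 0 < d <= 1) (eta0 : 0 < eta).
Hypothesis reg : forall A B : {set V}, A \subset X -> B \subset Y ->
  eta * #|X|%:R <= #|A|%:R -> eta * #|Y|%:R <= #|B|%:R ->
  d * (#|A|%:R * #|B|%:R) <= (ecount r A B)%:R.
Hypothesis eta_d : eta * q%:R <= d ^+ k.
Hypothesis eta_q : k%:R * eta * 2 ^+ (k.+3 * q) <= 1.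
Hypothesis mh : (m <= h)%N.
Hypothesis mX : (2 * (m * k) <= #|X|)%N.
Hypothesis q0 : (0 < q)%N.

(** For a fixed [Z] and a fixed set of at least [h / q] meagre tiles, each such tile has probability
    at most [k * eta], so [eta_q] yields a total of [2 ^- (k.+3 * h)]. A factor [4 ^ h] pays for the
    choice of the two sets. Of the remaining [2 ^- (k.+1 * h)], the passage from functions to
    injections will use [2 ^ (k * h)]. *)
Lemma card_ill_spread :
  #|ill_spread :&: injections ('I_m * U)%type X|%:R * 2 ^+ (k.+1 * h) <=
  #|X|%:R ^+ (m * k) :> R.
Proof.
pose low Z := [set f : {ffun U -> V} | [forall u, f u \in X] &&
      (#|common_ffun r Z f|%:R < d ^+ k * #|Z|%:R)].
pose all_X := [set f : {ffun U -> V} | [forall u, f u \in X]].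
pose W (i : {set V} * {set 'I_m}) (j : 'I_m) := if j \in i.2 then low i.1 else all_X.
pose A i := [set t : {ffun 'I_m * U -> V} | [forall j, tile t j \in W i j]].
pose P (i : {set V} * {set 'I_m}) := [&& i.1 \subset Y, (h <= q * #|i.1|)%N & (h <= q * #|i.2|)%N].
have cA i : P i -> #|A i|%:R * 2 ^+ (k.+3 * h) <= #|X|%:R ^+ (m * k) :> R.
  case: i => Z I0 /and3P /= [ZY hZ hI].
  have -> : #|A (Z, I0)| = #|[set g : {ffun 'I_m -> {ffun U -> V}} | [forall j, g j \in W (Z, I0) j]]|.
    pose cur (t : {ffun 'I_m * U -> V}) : {ffun 'I_m -> {ffun U -> V}} := [ffun j => tile t j].
    pose unc (g : {ffun 'I_m -> {ffun U -> V}}) : {ffun 'I_m * U -> V} := [ffun z => g z.1 z.2].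
    have curK : cancel cur unc by move=> t; apply/ffunP => -[j u]; rewrite !ffunE.
    have uncK : cancel unc cur.
      by move=> g; apply/ffunP => j; apply/ffunP => u; rewrite !ffunE.
    rewrite -(card_imset _ (can_inj curK)); apply: eq_card => g; rewrite inE.
    apply/imsetP/forallP => [[t + ->] j|hg].
      by rewrite inE => /forallP /(_ j); rewrite ffunE.
    exists (unc g); last by rewrite uncK.
    rewrite inE; apply/forallP => j; have := hg j.
    by rewrite -{1}[g]uncK ffunE.
  rewrite card_ffun_prod natr_prod.
  have cX : #|all_X|%:R = #|X|%:R ^+ k :> R.
    by rewrite card_ffun_prod prod_nat_const natrX cardT -cardE.
  have clow : #|low Z|%:R <= (k%:R * eta) * #|X|%:R ^+ k.
    apply: (bad_functions d01 eta0 reg ZY).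
    have : h%:R <= q%:R * #|Z|%:R :> R by rewrite -natrM ler_nat.
    move=> hh; apply: (@le_trans _ _ (eta * (q%:R * #|Z|%:R))).
      by rewrite ler_wpM2l // ltW.
    by rewrite mulrA ler_wpM2r.
  have ke0 : 0 <= k%:R * eta by rewrite mulr_ge0 // ltW.
  apply: (@le_trans _ _ ((\prod_(j < m) (if j \in I0 then (k%:R * eta) * #|X|%:R ^+ k else #|X|%:R ^+ k)) * 2 ^+ (k.+3 * h))).
    rewrite ler_wpM2r ?exprn_ge0 //; apply: ler_prod => j _; rewrite /W /=.
    by case: ifP => _; rewrite ler0n /= ?cX.
  have -> : \prod_(j < m) (if j \in I0 then (k%:R * eta) * #|X|%:R ^+ k else #|X|%:R ^+ k) =
     (k%:R * eta) ^+ #|I0| * (#|X|%:R ^+ k) ^+ m.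
    rewrite (eq_bigr (fun j => (if j \in I0 then k%:R * eta else 1) * #|X|%:R ^+ k)).
      by rewrite big_split /= -big_mkcond /= !prodr_const card_ord.
    by move=> j _; case: ifP => //; rewrite mul1r.
  rewrite mulrAC -[(_ ^+ k) ^+ m]exprM [(k * m)%N]mulnC -[leRHS]mul1r ler_wpM2r ?exprn_ge0 //.
  apply: (@le_trans _ _ ((k%:R * eta * 2 ^+ (k.+3 * q)) ^+ #|I0|)); last first.
    by apply: exprn_ile1 => //; rewrite mulr_ge0 ?exprn_ge0.
  rewrite [leRHS]exprMn ler_wpM2l ?exprn_ge0 // -exprM ler_weXn2l ?ler1n //.
  by rewrite -mulnA leq_mul2l hI orbT.
have cB : (#|ill_spread :&: injections ('I_m * U)%type X| <= \sum_(i | P i) #|A i|)%N.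
  apply: card_union_bound => t; rewrite !inE => /andP[/existsP[Z /and3P[ZY hZ hm]] /andP[_ /forallP tX]].
  exists (Z, meagre t Z); first by rewrite /P /= ZY hZ hm.
  rewrite inE; apply/forallP => j; rewrite /W /=.
  have tj : [forall u, tile t j u \in X] by apply/forallP => u; rewrite ffunE.
  by case: ifP => jm; rewrite inE tj //=; move: jm; rewrite inE.
have cP : (#|P| <= 2 ^ h * 2 ^ h)%N.
  apply: (@leq_trans #|setX (powerset Y) [set: {set 'I_m}]|).
    by apply: subset_leq_card; apply/subsetP => i /and3P[iY _ _]; rewrite !inE iY.
  rewrite cardsX card_powerset leq_mul2l; apply/orP; right.
  have := card_powerset [set: 'I_m]; rewrite powersetT !cardsT card_ord => ->.
  by rewrite leq_exp2l.
have X0 : 0 <= #|X|%:R ^+ (m * k) :> R by rewrite exprn_ge0.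
have p2 : 0 < 2 ^+ (2 * h) :> R by rewrite exprn_gt0.
rewrite -(ler_pM2r p2) -mulrA -exprD -mulnDl addnC add2n.
apply: (@le_trans _ _ (\sum_(i | P i) #|A i|%:R * 2 ^+ (k.+3 * h))).
  by rewrite -mulr_suml -natr_sum ler_wpM2r ?exprn_ge0 // ler_nat.
apply: (le_trans (ler_sum _ cA)); rewrite sumr_const -[leLHS]mulr_natl mulrC.
rewrite ler_wpM2l // mulnC exprM expr2 -natrX -natrM ler_nat -expnMn.
rewrite (_ : (2 * 2) ^ h = 2 ^ h * 2 ^ h)%N ?expnMn //.
Qed.

(* The random graph is invariant under relabelling by permutations of [X], so one may
   fix the tiles found and relabel them at random; regularity then makes an
   ill-spread configuration exponentially rare. *)
Lemma tiles_ill_spread_probability :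
  bexp p (enum (pairs V)) (fun S => (tiles_exist S && ~~ good_tiles S)%:R) * 2 ^+ h <= 1.
Proof.
pose Q S := tiles_exist S && ~~ good_tiles S.
pose I := injections ('I_m * U)%type X.
have copies_act s t S : copies_of (act_ffun s t) (relabel s S) = copies_of t S.
  apply: eq_forallb => i; rewrite -(image_edges_relabel s (tile t i)).
  have -> // : tile (act_ffun s t) i = [ffun u => s (tile t i u)].
  by apply/ffunP => u; rewrite !ffunE.
have s0 : 0 < #|symm X|%:R :> R.
  by rewrite ltr0n card_gt0; apply/set0Pn; exists 1%g; rewrite inE perm_on1.
have cJ : #|(('I_m * U)%type : finType)| = (m * k)%N by rewrite card_prod card_ord.
have X1 : (#|X| ^ (m * k) <= 2 ^ (m * k) * #|I|)%N.
  by rewrite card_injections cJ ffact_lower.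
have pointwise S : (\sum_(s in symm X) (Q (relabel s S))%:R) * 2 ^+ h <= #|symm X|%:R :> R.
  have [/existsP[s1 /andP[s1X /existsP[t1 /andP[t1I ct1]]]]|none] :=
      boolP [exists s in symm X, tiles_exist (relabel s S)]; last first.
    rewrite big1 ?mul0r // => s sX; rewrite /Q.
    move: none; rewrite negb_exists => /forallP/(_ s); rewrite sX /= => /negPf -> //.
  (* The tiles are pulled back to [S] itself, so that they are fixed before the permutation [s] is
     averaged over. *)
  pose t := act_ffun (s1^-1)%g t1.
  have s1X' : (s1^-1)%g \in symm X by move: s1X; rewrite !inE; apply: perm_onV.
  have tI : t \in I by apply: act_injections.
  have ct : copies_of t S.
    by rewrite -(copies_act s1) (_ : act_ffun s1 t = t1) //; apply/ffunP => j; rewrite !ffunE permKV.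
  (* The relabelled tiles are copies in the relabelled graph; were they not ill-spread, they would
     witness [good_tiles] there. *)
  have Qs s : s \in symm X -> Q (relabel s S) -> act_ffun s t \in ill_spread.
    move=> sX /andP[_]; apply: contraR => ni; apply/existsP; exists (act_ffun s t).
    by rewrite act_injections //= copies_act ct.
  have h1 : \sum_(s in symm X) (Q (relabel s S))%:R <=
      #|[set s in symm X | act_ffun s t \in ill_spread]|%:R :> R.
    rewrite -sum1_card natr_sum big_mkcond [leRHS]big_mkcond; apply: ler_sum => s _.
    rewrite inE; case sX: (s \in symm X) => //=.
    by case: (boolP (Q _)) => [/(Qs _ sX) ->//|_]; case: ifP.
  apply: (le_trans (ler_wpM2r _ h1)); first exact: exprn_ge0.
  have := card_symm_orbit ill_spread tI; rewrite -(ler_nat R) !natrM -/I.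
  set a := #|[set s in symm X | _]|%:R => h2.
  have := card_ill_spread; rewrite -/I; set b := #|ill_spread :&: I|%:R in h2 * => h3.
  have I0 : 0 < #|I|%:R :> R by rewrite ltr0n card_gt0; apply/set0Pn; exists t.
  have X2 : #|X|%:R ^+ (m * k) <= 2 ^+ (k * h) * #|I|%:R :> R.
    rewrite -!natrX -natrM ler_nat; apply: (leq_trans X1); rewrite leq_mul2r.
    by apply/orP; right; rewrite leq_exp2l // mulnC leq_mul2l mh orbT.
  have P2 : 0 < 2 ^+ (k * h) :> R by rewrite exprn_gt0.
  have h4 : b * 2 ^+ h <= #|I|%:R.
    rewrite -(ler_pM2r P2) -mulrA -exprD -mulSn [leRHS]mulrC.
    exact: le_trans h3 X2.
  rewrite -(ler_pM2r I0) mulrAC; apply: (le_trans (ler_wpM2r _ h2)); first exact: exprn_ge0.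
  by rewrite [leLHS]mulrAC [leLHS]mulrC ler_wpM2l // ltW.
rewrite -(ler_pM2r s0) mul1r mulrAC.
have -> : bexp p (enum (pairs V)) (fun S => (Q S)%:R) * #|symm X|%:R =
    bexp p (enum (pairs V)) (fun S => \sum_(s in symm X) (Q (relabel s S))%:R).
  rewrite bexp_sum (eq_bigr (fun=> bexp p (enum (pairs V)) (fun S => (Q S)%:R))).
    by rewrite sumr_const mulr_natr.
  by move=> s _; apply: (bexp_relabel p s (fun S => (Q S)%:R)).
rewrite mulrC -bexpZ -[leRHS](bexp_cst p (enum (pairs V))); apply: le_bexp => // S _.
by rewrite mulrC; apply: pointwise.
Qed.

End Tiles.

(** * Covering by copies *)

Section Tiled.
Variables (U V : finType) (F : sgraph U) (H : {set {set V}}).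
Let E := edges F.
Let k := #|U|.

Definition spanned (B : {set V}) :=
  exists f : {ffun U -> V}, [/\ injective f, f @: [set: U] = B & image_edges f E \subset H].

(** An inductive form of a factor on a vertex set, convenient for gluing along disjoint unions; the
    family of copies is recovered in [tiled_factor]. *)
Inductive tiled : {set V} -> Prop :=
| tiled0 : tiled set0
| tiledS A B : tiled A -> spanned B -> [disjoint A & B] -> tiled (B :|: A).

Lemma spanned_card B : spanned B -> #|B| = k.
Proof. by case=> f [fi <- _]; rewrite card_imset // cardsT. Qed.

Lemma tiledU A B : tiled A -> tiled B -> [disjoint A & B] -> tiled (A :|: B).
Proof.
elim=> {A} [|A C tA IH sC dAC] tB dis; first by rewrite set0U.
rewrite -setUA; apply: tiledS => //.
  by apply: IH => //; apply: disjointWl dis; exact: subsetUr.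
rewrite -setI_eq0 setIUl setU_eq0 !setI_eq0 dAC disjoint_sym.
by apply: disjointWl dis; exact: subsetUl.
Qed.

Lemma tiled_card A : tiled A -> (k %| #|A|)%N.
Proof.
elim=> {A} [|A B tA IH sB dAB]; first by rewrite cards0 dvdn0.
rewrite cardsU (_ : B :&: A = set0) ?cards0 ?subn0; last first.
  by apply/eqP; rewrite setI_eq0 disjoint_sym.
by rewrite (spanned_card sB) dvdn_add.
Qed.

Lemma tiled_factor A : tiled A ->
  exists T : {set {set V} * {set {set V}}},
    [/\ forall S, S \in T -> exists f : {ffun U -> V},
          [/\ injective f, S.1 = f @: [set: U], S.2 = image_edges f E & S.2 \subset H],
        forall S S', S \in T -> S' \in T -> S != S' -> [disjoint S.1 & S'.1] &
        \bigcup_(S in T) S.1 = A].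
Proof.
elim=> {A} [|A B tA [T [T1 T2 T3]] [f [fi fB fE]] dAB].
  exists set0; split=> [S|S S'|]; rewrite ?inE //.
  by rewrite big_set0.
pose S0 := (B, image_edges f E).
have dS S : S \in T -> [disjoint S.1 & B].
  by move=> ST; apply: disjointWl dAB; rewrite -T3; apply: (bigcup_max S).
exists (S0 |: T); split.
- by move=> S /setU1P[->|/T1//]; exists f; rewrite /= fB.
- move=> S S' /setU1P[->|ST] /setU1P[->|ST'] ne /=.
  + by rewrite eqxx in ne.
  + by rewrite disjoint_sym dS.
  + by rewrite dS.
  + exact: T2.
by rewrite bigcup_setU big_set1 T3.
Qed.

Lemma greedy_tiling (g : nat) (A : {set V}) : (0 < k)%N ->
  (forall B : {set V}, B \subset A -> (g <= #|B|)%N -> exists2 C : {set V}, C \subset B & spanned C) ->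
  exists L : {set V}, [/\ L \subset A, (#|L| < g)%N \/ L = set0 & tiled (A :\: L)].
Proof.
move=> k0; have [n] := ubnP #|A|; elim: n A => // n IH A /ltnSE An hA.
have [gA|gA] := ltnP #|A| g.
  by exists A; split=> //; [left|rewrite setDv; exact: tiled0].
have [C CA sC] := hA A (subxx _) gA.
have cC := spanned_card sC.
have [||L [LA Lg tL]] := IH (A :\: C).
- apply: leq_trans An; rewrite cardsDS // cC ltn_subrL k0 /=.
  by apply: leq_trans (subset_leq_card CA); rewrite cC.
- by move=> B BA; apply: hA; apply: subset_trans BA (subsetDl _ _).
exists L; split=> //; first exact: subset_trans LA (subsetDl _ _).
have -> : A :\: L = C :|: ((A :\: C) :\: L).
  apply/setP => v; rewrite !inE; have := subsetP LA v; have := subsetP CA v; rewrite !inE.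
  by case: (v \in C); case: (v \in L); case: (v \in A) => //= h1 h2;
    rewrite ?(implyP (introT implyP h1)) //; have := h2 isT.
apply: tiledS => //; rewrite -setI_eq0; apply/eqP/setP => v; rewrite !inE.
by case: (v \in C); rewrite ?andbF.
Qed.

(** Unlike in [greedy_tiling], the leftover has a prescribed size, because it must equal the number
    of good tiles for the final matching. *)
Lemma exact_tiling (s j : nat) (A : {set V}) : #|A| = (s + k * j)%N -> (0 < k)%N ->
  (forall B : {set V}, B \subset A -> (s <= #|B|)%N -> exists2 C : {set V}, C \subset B & spanned C) ->
  exists L : {set V}, [/\ L \subset A, #|L| = s & tiled (A :\: L)].
Proof.
move=> + k0; elim: j A => [|j IH] A cA hA.
  by exists A; split=> //; [rewrite cA muln0 addn0|rewrite setDv; exact: tiled0].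
have [|C CA sC] := hA A (subxx _); first by rewrite cA leq_addr.
have cC := spanned_card sC.
have [||L [LA Lg tL]] := IH (A :\: C).
- by rewrite cardsDS // cC cA mulnS; lia.
- by move=> B BA; apply: hA; apply: subset_trans BA (subsetDl _ _).
exists L; split=> //; first exact: subset_trans LA (subsetDl _ _).
have -> : A :\: L = C :|: ((A :\: C) :\: L).
  apply/setP => v; rewrite !inE; have := subsetP LA v; have := subsetP CA v; rewrite !inE.
  by case: (v \in C); case: (v \in L); case: (v \in A) => //= h1 h2;
    rewrite ?(implyP (introT implyP h1)) //; have := h2 isT.
apply: tiledS => //; rewrite -setI_eq0; apply/eqP/setP => v; rewrite !inE.
by case: (v \in C); rewrite ?andbF.
Qed.

(** [Q] is the condition for continuing: uncovered vertices of [L] are covered one at a time, each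
    using [k.-1] new vertices of [S], until [Q] fails for the uncovered set. *)
Lemma greedy_cover (L S : {set V}) (Q : pred {set V}) : [disjoint L & S] ->
  (forall L' W : {set V}, L' \subset L -> Q L' -> W \subset S -> (#|W| <= k.-1 * #|L|)%N ->
     exists v (B : {set V}), [/\ v \in L', B \subset S :\: W & spanned (v |: B)]) ->
  exists L' W : {set V}, [/\ L' \subset L, ~~ Q L', W \subset S,
    tiled ((L :\: L') :|: W) & #|W| = (k.-1 * (#|L| - #|L'|))%N].
Proof.
move=> dLS hQ.
have main n : forall L' W : {set V}, (#|L'| < n)%N -> L' \subset L -> W \subset S ->
    tiled ((L :\: L') :|: W) -> #|W| = (k.-1 * (#|L| - #|L'|))%N ->
    exists L' W : {set V}, [/\ L' \subset L, ~~ Q L', W \subset S,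
      tiled ((L :\: L') :|: W) & #|W| = (k.-1 * (#|L| - #|L'|))%N].
  elim: n => // n IH L' W /ltnSE L'n L'L WS tLW cW.
  have [QL|nQ] := boolP (Q L'); last by exists L', W.
  have [|v [B [vL BSW sB]]] := hQ L' W L'L QL WS.
    by rewrite cW leq_mul2l leq_subr orbT.
  have vL0 := subsetP L'L _ vL.
  have vS : v \notin S by rewrite (disjointFr dLS).
  have BS : B \subset S by apply: subset_trans BSW (subsetDl _ _).
  have vB : v \notin B by apply: contra vS; apply: subsetP BS _.
  have BW : [disjoint B & W].
    rewrite -setI_eq0; apply/eqP/setP => w; rewrite !inE; apply/negP => /andP[wB wW].
    by have := subsetP BSW _ wB; rewrite inE wW.
  have cB : #|B| = k.-1 by have := spanned_card sB; rewrite cardsU1 vB => <-.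
  have cL : #|L'| = #|L' :\ v|.+1 by rewrite (cardsD1 v) vL.
  have eqS : (L :\: (L' :\ v)) :|: (W :|: B) = (v |: B) :|: ((L :\: L') :|: W).
    apply/setP => w; rewrite !inE; case: (eqVneq w v) => [->|wv] /=; first by rewrite vL0.
    by case: (w \in L); case: (w \in L'); case: (w \in W); case: (w \in B).
  apply: (IH (L' :\ v) (W :|: B)).
  - by rewrite -ltnS -cL.
  - by apply: subset_trans L'L; exact: subsetDl.
  - by rewrite subUset WS.
  - rewrite eqS; apply: tiledS => //; rewrite -setI_eq0; apply/eqP/setP => w.
    rewrite !inE; apply/negP => /andP[h /orP[/eqP wv|wB]].
      by move: h; rewrite wv vL /= => /(subsetP WS); rewrite (negPf vS).
    case/orP: h => [/andP[_ wL]|wW]; last by rewrite (disjointFr BW wB) in wW.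
    by have := disjointFr dLS wL; rewrite (subsetP BS).
  rewrite cardsU (_ : W :&: B = set0) ?cards0 ?subn0; last first.
    by apply/eqP; rewrite setI_eq0 disjoint_sym.
  have := subset_leq_card L'L; rewrite cW cB cL => h.
  by rewrite addnC -mulnS; congr (_ * _)%N; lia.
apply: (main #|L|.+1 L set0) => //; rewrite ?sub0set //.
  by rewrite setDv setU0; exact: tiled0.
by rewrite cards0 subnn muln0.
Qed.

Lemma tiled_absorb (A L W : {set V}) : L \subset A -> [disjoint A & W] ->
  tiled (A :\: L) -> tiled (L :|: W) -> tiled (A :|: W).
Proof.
move=> LA dAW t1 t2; have -> : A :|: W = (A :\: L) :|: (L :|: W).
  by rewrite setUA -{1}(setID A L) (setIidPr LA) [L :|: _]setUC.
apply: tiledU => //; rewrite -setI_eq0; apply/eqP/setP => v; rewrite !inE.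
apply/negP => /andP[/andP[vL vA] /orP[h|vW]]; first by rewrite h in vL.
by rewrite (disjointFr dAW vA) in vW.
Qed.

(** [A] is first tiled by itself down to fewer than [g] vertices, and only these use up vertices of
    [S]; so the bound on [W] does not depend on the size of [A]. *)
Lemma absorb_set (A S : {set V}) (g : nat) : (0 < k)%N -> [disjoint A & S] ->
  (forall B : {set V}, B \subset A -> (g <= #|B|)%N -> exists2 C : {set V}, C \subset B & spanned C) ->
  (forall v (W : {set V}), v \in A -> W \subset S -> (#|W| <= k * g)%N ->
     exists2 B : {set V}, B \subset S :\: W & spanned (v |: B)) ->
  exists W : {set V}, [/\ W \subset S, (#|W| <= k * g)%N & tiled (A :|: W)].
Proof.
move=> k0 dAS hA hS; have [L [LA Lg tL]] := greedy_tiling k0 hA.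
have cL : (k.-1 * #|L| <= k * g)%N.
  by apply: leq_mul; [exact: leq_pred|case: Lg => [/ltnW //|->]; rewrite cards0].
have dLS : [disjoint L & S] by apply: disjointWl dAS.
have [L' W' L'L|L' [W [L'L]]] := @greedy_cover L S (fun L' => L' != set0) dLS.
  move=> /set0Pn[v vL] WS hW.
  have [B BS sB] := hS v W' (subsetP LA _ (subsetP L'L _ vL)) WS (leq_trans hW cL).
  by exists v, B.
rewrite negbK => /eqP L0 WS; rewrite L0 setD0 cards0 subn0 => tLW cW.
exists W; split=> //; first by rewrite cW.
apply: tiled_absorb tL tLW => //.
by rewrite disjoint_sym; apply: disjointWl WS _; rewrite disjoint_sym.
Qed.

End Tiled.

Lemma tiled_has_factor (U V : finType) (F : sgraph U) (G : sgraph V) :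
  tiled F (edges G) [set: V] -> has_factor F G.
Proof.
move/tiled_factor => [T [T1 T2 T3]]; apply/existsP; exists T; apply/and3P; split.
- apply/forall_inP => S /T1[f [fi S1 S2 SG]]; rewrite /copy /subgraph SG /=.
  apply/andP; split; last first.
    by apply/existsP; exists f; rewrite S1 S2 !eqxx andbT andbT; apply/injectiveP.
  apply/bigcupsP => e; rewrite S2 S1 => /imsetP[e' _ ->]; apply: imsetS; exact: subsetT.
- apply/forall_inP => S ST; apply/forall_inP => S' ST'; apply/implyP; exact: T2.
- by rewrite T3.
Qed.

Section Replace.
Variables (U V : finType) (F : sgraph U) (G : sgraph V) (S : {set {set V}}).

Lemma spanned_copy (f : {ffun U -> V}) : injective f -> image_edges f (edges F) \subset S ->
  spanned F (edges G :|: S) (f @: [set: U]).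
Proof. by move=> fi fS; exists f; split=> //; apply: subset_trans fS (subsetUr _ _). Qed.

(** After the exchange, the edges at [u0] come from [G] and all others from the copy in [S]. *)
Lemma spanned_replace (f : {ffun U -> V}) (u0 : U) (v : V) : injective f ->
  image_edges f (edges F) \subset S -> v \notin f @: [set: U] ->
  (forall u, adj G (f u) v) ->
  spanned F (edges G :|: S) (v |: f @: (~: [set u0])).
Proof.
move=> fi fS vf fv; pose f' : {ffun U -> V} := [ffun u => if u == u0 then v else f u].
have vne u : f u != v by apply: contraNneq vf => <-; apply: imset_f.
exists f'; split.
- move=> a b; rewrite !ffunE; case: eqP => [->|_]; case: eqP => [->|_] //.
  + by move=> h; have := vne b; rewrite h eqxx.
  + by move=> h; have := vne a; rewrite h eqxx.
  + exact: fi.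
- rewrite -(setUCr [set u0]) imsetU imset_set1 ffunE eqxx; congr (_ |: _).
  by apply: eq_in_imset => u; rewrite !inE ffunE => /negPf ->.
apply/subset_image_edges => e eF; rewrite inE.
have [u0e|u0e] := boolP (u0 \in e); last first.
  apply/orP; right; have := elimT (subset_image_edges f (edges F) S) fS _ eF.
  suff -> : f' @: e = f @: e by [].
  apply: eq_in_imset => u ue; rewrite ffunE; case: eqP => // uu0.
  by rewrite -uu0 ue in u0e.
apply/orP; left; have := subsetP (edges_sub F) _ eF; rewrite inE => /cards2P[a [b [ab eab]]].
have key a' b' : a' != b' -> e = [set a'; b'] -> u0 = a' -> f' @: e \in edges G.
  move=> ab' -> ua; rewrite imsetU1 imset_set1 !ffunE ua eqxx eq_sym (negPf ab') setUC.
  exact: fv.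
move: u0e; rewrite eab !inE -eab => /orP[] /eqP ue; first exact: (key a b).
by apply: (key b a) => //; rewrite 1?eq_sym // eab setUC.
Qed.

End Replace.

(** * Matching the tiles with the last vertices *)

Section HallTiling.
Variables (R : realType) (U V : finType) (F : sgraph U) (G : sgraph V) (S : {set {set V}}).
Variables (X1 Y1 : {set V}) (d : R) (m q b : nat) (t : {ffun 'I_m * U -> V}) (u0 : U).
Let E := edges F.
Let k := #|U|.
Let h := #|Y1|.
Let r := adj G.
Let c1 := d ^+ k.

Hypothesis d0 : 0 < d.
Hypothesis h0 : (0 < h)%N.
Hypothesis q0 : (0 < q)%N.
Hypothesis dXY : [disjoint X1 & Y1].
Hypothesis tI : t \in injections ('I_m * U)%type X1.
Hypothesis tS : copies_of E t S.
Hypothesis tgood : t \notin ill_spread U r Y1 d m q.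
Hypothesis slack_deg : 2 * h%:R <= q%:R * (c1 * h%:R - (h%:R - m%:R)).
Hypothesis b_large : (2 * h <= q * b)%N.
Hypothesis b_small : b%:R * q%:R <= c1 * (q%:R * m%:R - h%:R).

Definition good : {set 'I_m} := ~: meagre r d t Y1.

(** These vertices would violate Hall's condition from the other side; they are absorbed separately
    beforehand. *)
Definition bad_vertices : {set V} :=
  [set y in Y1 | #|[set i | y \in common_ffun r Y1 (tile t i)]| < b]%N.

(* Each good tile gives up its vertex [t (i, u0)], to be replaced by a common
   [G]-neighbour of the tile in [Y1]. *)
Definition tile_vertices : {set V} := \bigcup_(i in good) tile t i @: (~: [set u0]).

Lemma meagre_small (Z : {set V}) : Z \subset Y1 -> (h <= q * #|Z|)%N ->
  (q * #|meagre r d t Z| < h)%N.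
Proof.
move=> ZY hZ; rewrite ltnNge; apply: contra tgood => hm; rewrite inE.
by apply/existsP; exists Z; rewrite ZY hZ.
Qed.

Lemma meagre_Y1 : (q * #|meagre r d t Y1| < h)%N.
Proof. by apply: meagre_small => //; rewrite leq_pmull. Qed.

Lemma card_good : (#|good| + #|meagre r d t Y1| = m)%N.
Proof. by rewrite addnC /good cardsC card_ord. Qed.

(** Double counting: if the set were not negligible, all but [h / q] tiles would be joined to a
    fraction [c1] of it, so on average a bad vertex would see at least [c1 * (m - h / q) >= b]
    tiles. *)
Lemma bad_vertices_small : (q * #|bad_vertices| < h)%N.
Proof.
rewrite ltnNge; apply/negP => hB; set B := bad_vertices in hB.
have BY : B \subset Y1 by apply/subsetP => y; rewrite inE => /andP[].
have hm := meagre_small BY hB.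
have c0 : 0 < c1 by rewrite exprn_gt0.
have B0 : 0 < #|B|%:R :> R.
  by rewrite ltr0n; case: posnP => // B0; move: hB; rewrite B0 muln0 leqNgt h0.
have up : (\sum_(y in B) #|[set i | y \in common_ffun r Y1 (tile t i)]|)%:R <= b%:R * #|B|%:R :> R.
  rewrite -natrM ler_nat mulnC -sum_nat_const; apply: leq_sum => y.
  by rewrite inE => /andP[_ /ltnW].
have exch : (\sum_(y in B) #|[set i | y \in common_ffun r Y1 (tile t i)]| =
    \sum_(i < m) #|common_ffun r B (tile t i)|)%N.
  rewrite (eq_bigr (fun y => \sum_(i < m) (y \in common_ffun r Y1 (tile t i) : nat))%N); last first.
    by move=> y _; rewrite -sum1_card big_mkcond; apply: eq_bigr => i _; rewrite inE; case: ifP.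
  rewrite exchange_big; apply: eq_bigr => i _; rewrite -sum1_card big_mkcond [RHS]big_mkcond.
  apply: eq_bigr => y _.
  rewrite [y \in common_ffun r Y1 _]inE [y \in common_ffun r B _]inE.
  case: ifP => yB //=; have yY := subsetP BY _ yB; rewrite yY /=.
  by case: [forall u, _].
have low : (m%:R - #|meagre r d t B|%:R) * (c1 * #|B|%:R) <=
    (\sum_(i < m) #|common_ffun r B (tile t i)|)%:R.
  have -> : m%:R - #|meagre r d t B|%:R = #|~: meagre r d t B|%:R :> R.
    have := cardsC (meagre r d t B); rewrite card_ord.
    move: #|meagre r d t B| #|~: meagre r d t B| => a a' aE; rewrite -aE.
    by rewrite natrD addrAC subrr add0r.
  rewrite natr_sum (bigID (mem (~: meagre r d t B))) /= -[leLHS]addr0; apply: lerD; last first.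
    by apply: sumr_ge0.
  apply: (@le_trans _ _ (\sum_(i in ~: meagre r d t B) c1 * #|B|%:R)).
    by rewrite sumr_const -[leRHS]mulr_natl.
  by apply: ler_sum => j; rewrite !inE -leNgt.
have h1 : (m%:R - #|meagre r d t B|%:R) * c1 <= b%:R.
  rewrite -(ler_pM2r B0) -mulrA; apply: (le_trans low).
  by rewrite -exch.
have hm' : q%:R * #|meagre r d t B|%:R < h%:R :> R by rewrite -natrM ltr_nat.
have q0' : 0 < q%:R :> R by rewrite ltr0n.
have h2 : (m%:R - #|meagre r d t B|%:R) * c1 * q%:R <= b%:R * q%:R by rewrite ler_pM2r.
have h3 : c1 * (q%:R * #|meagre r d t B|%:R) < c1 * h%:R by rewrite ltr_pM2l.
have := le_trans h2 b_small; move: h3; set mu := #|meagre r d t B|%:R.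
by rewrite !mulrBr !mulrBl => h3 h4; lra.
Qed.

Lemma good_degree i : i \in good -> c1 * h%:R <= #|common_ffun r Y1 (tile t i)|%:R.
Proof. by rewrite !inE -leNgt. Qed.

(** For [#|I| < h / q], one good tile alone has enough neighbours: at least [c1 * h], minus the
    [h - #|Y|] vertices missing from [Y]. For larger [I], fewer than [h / q] vertices of [Y] escape
    the neighbourhood of [I], else some tile of [I] would not be meagre to them. If Hall's condition
    failed, an escaping [y] would see [b] tiles, all meagre or in [good :\: I], but there are fewer
    than [2 * h / q] of these. *)
Lemma hall_condition (Y : {set V}) : Y \subset Y1 :\: bad_vertices -> #|Y| = #|good| ->
  forall I : {set 'I_m}, I \subset good ->
    (#|I| <= #|[set y in Y | [exists i in I, y \in common_ffun r Y1 (tile t i)]]|)%N.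
Proof.
move=> YY cY I Ig; set N := [set y in Y | _].
have [->|[i iI]] := set_0Vmem I; first by rewrite cards0.
have YY1 : Y \subset Y1 by apply: subset_trans YY (subsetDl _ _).
have mY := meagre_Y1; have cg := card_good.
have NY : N \subset Y by apply/subsetP => y; rewrite inE => /andP[].
have [small|big] := ltnP (q * #|I|)%N h.
  have sub : (#|common_ffun r Y1 (tile t i)| <= #|N| + (h - #|Y|))%N.
    rewrite -cardsDS // -[X in (X <= _)%N](cardsID Y); apply: leq_add.
      apply: subset_leq_card; apply/subsetP => y; rewrite inE => /andP[yi yY].
      by rewrite inE yY /=; apply/existsP; exists i; rewrite iI.
    by apply: subset_leq_card; apply: setSD; apply/subsetP => y; rewrite inE => /andP[].
  have hY : (#|Y| <= h)%N := subset_leq_card YY1.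
  have := le_trans (good_degree (subsetP Ig _ iI)) (_ : _ <= (#|N| + (h - #|Y|))%:R :> R).
  rewrite ler_nat => /(_ sub); rewrite natrD natrB // => hd.
  have q0' : 0 < q%:R :> R by rewrite ltr0n.
  have hd' : q%:R * (c1 * h%:R) <= q%:R * (#|N|%:R + (h%:R - #|Y|%:R)) by rewrite ler_pM2l.
  have mY' : q%:R * (m%:R - #|Y|%:R) <= h%:R :> R.
    have -> : m%:R - #|Y|%:R = #|meagre r d t Y1|%:R :> R.
      by move: cg; rewrite -cY; move: #|meagre r d t Y1| => a <-; rewrite natrD addrAC subrr add0r.
    by rewrite -natrM ler_nat ltnW.
  have hN : h%:R <= q%:R * #|N|%:R :> R.
    move: hd' slack_deg mY'; lra.
  rewrite -natrM ler_nat in hN.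
  by rewrite -(leq_pmul2l q0); apply: leq_trans (ltnW small) hN.
rewrite leqNgt; apply/negP => NI.
have smallZ : (q * #|Y :\: N| < h)%N.
  rewrite ltnNge; apply/negP => hZ.
  have ZY : Y :\: N \subset Y1 by apply: subset_trans YY1; exact: subsetDl.
  have hm := meagre_small ZY hZ.
  have /subsetPn[j jI] : ~~ (I \subset meagre r d t (Y :\: N)).
    apply: contraL hm => /subset_leq_card hI; rewrite -leqNgt; apply: leq_trans big _.
    by rewrite leq_mul2l hI orbT.
  rewrite inE -leNgt => hc.
  have Z0 : (0 < #|Y :\: N|)%N.
    by case: posnP => // Z0; move: hZ; rewrite Z0 muln0 leqNgt h0.
  have : (0 < #|common_ffun r (Y :\: N) (tile t j)|)%N.
    by rewrite -(ltr_nat R); apply: lt_le_trans hc; rewrite mulr_gt0 ?exprn_gt0 ?ltr0n.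
  rewrite card_gt0 => /set0Pn[y]; rewrite inE => /andP[/setDP[yY /negP yN] yj].
  apply: yN; rewrite inE yY /=; apply/existsP; exists j; rewrite jI inE yj andbT /=.
  exact: (subsetP YY1).
have [y /setDP[yY yN]] : exists y, y \in Y :\: N.
  apply/set0Pn; rewrite -card_gt0 cardsDS // subn_gt0 cY.
  by apply: leq_trans NI _; apply: subset_leq_card.
have yB : y \notin bad_vertices by have := subsetP YY _ yY; rewrite inE => /andP[].
have yY1 := subsetP YY1 _ yY.
move: yB; rewrite inE yY1 /= -leqNgt => yb.
have sub : [set j | y \in common_ffun r Y1 (tile t j)] \subset (good :\: I) :|: meagre r d t Y1.
  apply/subsetP => j; rewrite inE => yj; rewrite in_setU in_setD in_setC.
  case: (boolP (j \in meagre r d t Y1)) => jm; rewrite ?orbT //= orbF andbT.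
  apply: contra yN => jI; rewrite inE yY; apply/existsP.
  by exists j; rewrite jI.
have := leq_trans yb (leq_trans (subset_leq_card sub) (leq_card_setU _ _)).
rewrite cardsDS // => h1.
have h2 : (#|good| - #|I| <= #|Y :\: N|)%N.
  by rewrite cardsDS // cY leq_sub2l // ltnW.
have h3 : (q * b <= q * #|Y :\: N| + q * #|meagre r d t Y1|)%N.
  by rewrite -mulnDr leq_mul2l (leq_trans h1) ?orbT // leq_add2r.
move: h3; rewrite leqNgt => /negP[]; apply: leq_trans b_large.
by rewrite mul2n -addnn -addSn leq_add // ltnW.
Qed.

Lemma hall_tiling (Y : {set V}) : Y \subset Y1 :\: bad_vertices -> #|Y| = #|good| ->
  tiled F (edges G :|: S) (tile_vertices :|: Y).
Proof.
move=> YY cY; have [g0|[i0 i0g]] := set_0Vmem good.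
  move: cY; rewrite g0 cards0 => /eqP; rewrite cards_eq0 => /eqP ->.
  by rewrite /tile_vertices g0 big_set0 setU0; exact: tiled0.
have YY1 : Y \subset Y1 by apply: subset_trans YY (subsetDl _ _).
have [mu [mui mur]] := hall (t (i0, u0)) (hall_condition YY cY).
have muY i : i \in good -> mu i \in Y by move/mur/andP => [].
have /andP[/injectiveP ti /forallP tX] : injectiveb t && [forall j, t j \in X1].
  by move: tI; rewrite inE.
pose B i := mu i |: tile t i @: (~: [set u0]).
have tileX i v : v \in tile t i @: (~: [set u0]) -> v \in X1.
  by case/imsetP => u _ ->; rewrite ffunE.
have sB i : i \in good -> spanned F (edges G :|: S) (B i).
  move=> ig; apply: spanned_replace.
  - by move=> u w; rewrite !ffunE => /ti[].
  - by have /forallP := tS; apply.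
  - apply/negP => /imsetP[u _]; rewrite ffunE => mt.
    have := subsetP YY1 _ (muY _ ig); rewrite mt => hY.
    by have := disjointFr dXY (tX (i, u)); rewrite hY.
  - move=> u; have /andP[+ _] := mur _ ig; rewrite inE => /andP[_ /forallP]; exact.
have tA n : forall A : {set 'I_m}, #|A| = n -> A \subset good ->
    tiled F (edges G :|: S) (\bigcup_(i in A) B i).
  elim: n => [|n IH] A cA Ag.
    have -> : A = set0 by apply/eqP; rewrite -cards_eq0 cA.
    by rewrite big_set0; exact: tiled0.
  have [A0|[i iA]] := set_0Vmem A; first by rewrite A0 cards0 in cA.
  rewrite (big_setD1 i) //=; apply: tiledS.
  - apply: IH; first by move: cA; rewrite (cardsD1 i) iA => -[].
    by apply: subset_trans Ag; exact: subsetDl.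
  - by apply: sB; apply: (subsetP Ag).
  have ig := subsetP Ag _ iA.
  rewrite -setI_eq0; apply/eqP/setP => v; rewrite in_setI in_set0; apply/negP => /andP[].
  case/bigcupP => j; rewrite !inE => /andP[ji jA] vj vi.
  have jg := subsetP Ag _ jA.
  have nXY w : w \in X1 -> w \in Y -> False.
    by move=> wX /(subsetP YY1) wY; have := disjointFr dXY wX; rewrite wY.
  case/orP: vj => [/eqP vj|vj]; case/orP: vi => [/eqP vi|vi].
  + by move: ji; rewrite (mui j i) ?eqxx // -vj.
  + by apply: (nXY v (tileX _ _ vi)); rewrite vj muY.
  + by apply: (nXY v (tileX _ _ vj)); rewrite vi muY.
  move: vj vi => /imsetP[u _ ->] /imsetP[w _]; rewrite !ffunE => /ti[ij _].
  by rewrite ij eqxx in ji.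
have -> : tile_vertices :|: Y = \bigcup_(i in good) B i.
  have imY : mu @: good = Y.
    apply/eqP; rewrite eqEcard card_in_imset // cY leqnn andbT.
    by apply/subsetP => _ /imsetP[i ig ->]; apply: muY.
  apply/setP => v; rewrite inE; apply/orP/bigcupP.
    case=> [/bigcupP[i ig vi]|]; first by exists i; rewrite // inE vi orbT.
    by rewrite -imY => /imsetP[i ig ->]; exists i; rewrite // inE set11.
  case=> i ig /setU1P[->|vi]; [right; exact: muY|left; apply/bigcupP; by exists i].
by apply: (tA #|good|).
Qed.

End HallTiling.

Lemma disjoint_mem (V : finType) (A B : {set V}) : [disjoint A & B] ->
  forall v, ~~ ((v \in A) && (v \in B)).
Proof. by move=> dis v; apply/negP => /andP[vA]; rewrite (disjointFr dis vA). Qed.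

(** Bookkeeping of three absorptions: each [Z] joins leftover vertices to the [Wb], [Wc] or [Wd]
    spent on them. Everything is a Boolean condition on membership, checked vertex by vertex. *)
Lemma leftover_partition (V : finType) (X1 X2 Y1 Y2 Wb By Wc Wd Tt : {set V}) :
  [disjoint X1 & X2] -> [disjoint X1 & Y1] -> [disjoint X1 & Y2] ->
  [disjoint X2 & Y1] -> [disjoint X2 & Y2] -> [disjoint Y1 & Y2] ->
  Wb \subset X2 :|: Y2 -> By \subset Y1 -> Wc \subset X2 :\: Wb -> Wd \subset Y1 :\: By ->
  Tt \subset X1 ->
  let Z1 := ~: (X1 :|: X2 :|: Y1 :|: Y2) :|: Wb in
  let Z2 := (Y2 :\: Wb) :|: By :|: Wc in
  let Z3 := (X2 :\: Wb :\: Wc) :|: (X1 :\: Tt) :|: Wd in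
  [/\ [disjoint Z1 & Z2], [disjoint Z1 :|: Z2 & Z3] &
    ~: (Z1 :|: Z2 :|: Z3) = Tt :|: (Y1 :\: By :\: Wd)].
Proof.
move=> /disjoint_mem d1 /disjoint_mem d2 /disjoint_mem d3 /disjoint_mem d4.
move=> /disjoint_mem d5 /disjoint_mem d6.
move=> /subsetP s1 /subsetP s2 /subsetP s3 /subsetP s4 /subsetP s5 Z1 Z2 Z3.
have brute v : [/\ ~~ ((v \in Z1) && (v \in Z2)), ~~ ((v \in Z1 :|: Z2) && (v \in Z3)) &
    (v \in ~: (Z1 :|: Z2 :|: Z3)) = (v \in Tt :|: (Y1 :\: By :\: Wd))].
  have := d1 v; have := d2 v; have := d3 v; have := d4 v; have := d5 v; have := d6 v.
  have := introT implyP (s1 v); have := introT implyP (s2 v); have := introT implyP (s3 v).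
  have := introT implyP (s4 v); have := introT implyP (s5 v); rewrite !inE.
  case: (v \in X1); case: (v \in X2) => //=; case: (v \in Y1) => //=;
  case: (v \in Y2) => //=; case: (v \in Wb) => //=; case: (v \in By) => //=;
  case: (v \in Wc) => //=; case: (v \in Wd) => //=; by case: (v \in Tt).
split.
- by rewrite -setI_eq0; apply/eqP/setP => v; rewrite in_setI in_set0; have [/negPf ->] := brute v.
- by rewrite -setI_eq0; apply/eqP/setP => v; rewrite in_setI in_set0; have [_ /negPf ->] := brute v.
by apply/setP => v; have [_ _ ->] := brute v.
Qed.

Lemma adjC (V : finType) (G : sgraph V) : symmetric (adj G).
Proof. by move=> a b; rewrite /adj setUC. Qed.

(** * Assembling the factor *)

Section Assembly.
Variables (R : realType) (U V : finType) (F : sgraph U) (G : sgraph V) (S : {set {set V}}).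
Variables (X1 X2 Y1 Y2 : {set V}) (d : R) (m q b g a1 a2 : nat).
Variables (t : {ffun 'I_m * U -> V}) (u0 : U).
Let k := #|U|.
Let h := #|Y1|.
Let H := edges G :|: S.
Let c1 := d ^+ k.
Let rest := ~: (X1 :|: X2 :|: Y1 :|: Y2).

Hypothesis d0 : 0 < d.
Hypothesis h0 : (0 < h)%N.
Hypothesis q0 : (0 < q)%N.
Hypothesis g0 : (0 < g)%N.
Hypotheses (d12 : [disjoint X1 & X2]) (d1Y1 : [disjoint X1 & Y1]) (d1Y2 : [disjoint X1 & Y2]).
Hypotheses (d2Y1 : [disjoint X2 & Y1]) (d2Y2 : [disjoint X2 & Y2]) (dY12 : [disjoint Y1 & Y2]).
Hypothesis copies : forall A : {set V}, (g <= #|A|)%N -> exists f : {ffun U -> V},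
  [/\ injective f, forall u, f u \in A & image_edges f (edges F) \subset S].
Hypothesis degX : forall x, x \in X1 :|: X2 -> (a1 <= #|[set y in Y1 | adj G x y]|)%N.
Hypothesis degY : forall y, y \in Y1 :|: Y2 -> (a2 <= #|[set x in X2 | adj G y x]|)%N.
Hypothesis rooted_cover : forall L : {set V}, L \subset rest -> (#|L| < g)%N ->
  exists W : {set V}, [/\ W \subset X2 :|: Y2, tiled F H (L :|: W) & (#|W| <= k * g)%N].
Hypothesis tI : t \in injections ('I_m * U)%type X1.
Hypothesis tS : copies_of (edges F) t S.
Hypothesis tgood : t \notin ill_spread U (adj G) Y1 d m q.
Hypothesis slack_deg : 2 * h%:R <= q%:R * (c1 * h%:R - (h%:R - m%:R)).
Hypothesis b_large : (2 * h <= q * b)%N.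
Hypothesis b_small : b%:R * q%:R <= c1 * (q%:R * m%:R - h%:R).
Hypothesis a2_large : (2 * (k * g) + g <= a2)%N.
Hypothesis a1_large : (h + q * (k * g + g) <= q * a1)%N.
Hypothesis m_small : (h + q * (k * g + m) <= q * h)%N.
Hypothesis m_large : (h + q * g <= q * m)%N.
Hypothesis divk : (k %| #|V|)%N.

Let k0 : (0 < k)%N.
Proof. by apply/card_gt0P; exists u0. Qed.

Lemma spanned_in (A : {set V}) : (g <= #|A|)%N ->
  exists2 C : {set V}, C \subset A & spanned F H C.
Proof.
move=> /copies[f [fi fA fS]]; exists (f @: [set: U]); last exact: spanned_copy.
by apply/subsetP => _ /imsetP[u _ ->].
Qed.

(* [v] takes over the role of one vertex in a copy of [F] inside its
   [G]-neighbourhood, all of its edges coming from [G]. *)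
Lemma star_completion (v : V) (A : {set V}) : (g <= #|A|)%N ->
  (forall w, w \in A -> adj G v w) -> exists2 B : {set V}, B \subset A & spanned F H (v |: B).
Proof.
move=> /copies[f [fi fA fS]] vA; exists (f @: (~: [set u0])).
  by apply/subsetP => _ /imsetP[u _ ->].
apply: spanned_replace => //; last by move=> u; rewrite adjC; apply/vA/fA.
apply/negP => /imsetP[u _ vu]; have := vA _ (fA u); rewrite -vu /adj setUid => vE.
by have := subsetP (edges_sub G) _ vE; rewrite inE cards1.
Qed.

(** Of the [a] neighbours in [N], at most [s] are missing from [T] and [k * g] are used up; the
    remaining [g] still contain a copy to complete. *)
Lemma star_absorb (A T N : {set V}) (a s : nat) : [disjoint A & T] -> T \subset N ->
  (forall v, v \in A -> (a <= #|[set w in N | adj G v w]|)%N) ->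
  (#|N :\: T| <= s)%N -> (s + k * g + g <= a)%N ->
  exists W : {set V}, [/\ W \subset T, (#|W| <= k * g)%N & tiled F H (A :|: W)].
Proof.
move=> dAT TN deg cT sa; apply: absorb_set => //.
  by move=> B _; apply: spanned_in.
move=> v W vA WT cW; pose B := [set w in T :\: W | adj G v w].
have cB : (g <= #|B|)%N.
  have sub : [set w in N | adj G v w] \subset B :|: ((N :\: T) :|: W).
    apply/subsetP => w; rewrite !inE; case: (w \in T); case: (w \in W); case: (w \in N);
    by case: (adj G v w).
  rewrite -(leq_add2l (s + k * g)); apply: leq_trans sa _.
  apply: leq_trans (deg v vA) (leq_trans (subset_leq_card sub) _).
  apply: leq_trans (leq_card_setU _ _) _; rewrite addnC leq_add2r.
  by apply: leq_trans (leq_card_setU _ _) (leq_add cT cW).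
have [|C CB sC] := star_completion (v := v) cB; first by move=> w; rewrite inE => /andP[].
exists C => //; apply: subset_trans CB _; by apply/subsetP => w; rewrite inE => /andP[].
Qed.

Lemma tiled_setT : tiled F H [set: V].
Proof.
pose By := bad_vertices G Y1 b t.
pose gd := good G Y1 d t.
pose Tt := tile_vertices G Y1 d t u0.
have cBy : (q * #|By| < h)%N by apply: (bad_vertices_small (d := d)).
have cg : (#|gd| + #|meagre (adj G) d t Y1| = m)%N by apply: card_good.
have cm : (q * #|meagre (adj G) d t Y1| < h)%N by apply: meagre_Y1.
have /andP[/injectiveP ti /forallP tX] : injectiveb t && [forall j, t j \in X1].
  by move: tI; rewrite inE.
have ByY : By \subset Y1 by apply/subsetP => y; rewrite inE => /andP[].
have TtE : Tt = t @: setX gd (~: [set u0]).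
  apply/setP => v; apply/bigcupP/imsetP.
    case=> i ig /imsetP[u uu ->]; exists (i, u); rewrite ?ffunE //.
    by apply/setXP; split.
  case=> -[i u] /setXP[ig uu] ->; exists i => //; apply/imsetP; exists u => //.
  by rewrite ffunE.
have TtX : Tt \subset X1 by rewrite TtE; apply/subsetP => _ /imsetP[j _ ->].
have cTt : #|Tt| = (#|gd| * k.-1)%N.
  by rewrite TtE card_imset // cardsX cardsC1.
have mem_dis (A B : {set V}) : (forall v, v \in A -> v \in B -> False) -> [disjoint A & B].
  by move=> hAB; rewrite -setI_eq0; apply/eqP/setP => v; rewrite !inE; apply/negP => /andP[/hAB].
have [L0 [L0R L0g tL0]] := @greedy_tiling U V F H g rest k0 (fun B _ => @spanned_in B).
have L0g' : (#|L0| < g)%N by case: L0g => // ->; rewrite cards0.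
have [Wb [WbS tWb cWb]] := rooted_cover L0R L0g'.
have dRW : [disjoint rest & Wb].
  apply: mem_dis => v; rewrite !inE => vr /(subsetP WbS); rewrite inE => /orP[] vW;
  by move: vr; rewrite vW ?orbT.
have t1 : tiled F H (rest :|: Wb) by apply: tiled_absorb tL0 tWb.
(* What is left of [Y2], together with the bad vertices of [Y1], is absorbed through [X2]. *)
have [|||||Wc [WcS cWc t2]] := @star_absorb ((Y2 :\: Wb) :|: By) (X2 :\: Wb) X2 a2 (k * g).
- apply: mem_dis => v; rewrite inE => /orP[] vA /setDP[vX _].
    by case/setDP: vA => vY _; have := disjointFr d2Y2 vX; rewrite vY.
  by have := disjointFr d2Y1 vX; rewrite (subsetP ByY).
- exact: subsetDl.
- move=> v vA; apply: degY; case/setUP: vA => [/setDP[vY _]|/(subsetP ByY) vY];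
  by rewrite inE vY ?orbT.
- apply: leq_trans cWb; apply: subset_leq_card; apply/subsetP => v.
  by rewrite !inE; case: (v \in Wb) => //=; rewrite andNb.
- by rewrite addnn -mul2n.
(* The rest of [X2], and all of [X1] outside the reduced tiles, are absorbed through [Y1]; from then
   on only [Tt] and part of [Y1] are uncovered. *)
have [|||||Wd [WdS cWd t3]] := @star_absorb ((X2 :\: Wb :\: Wc) :|: (X1 :\: Tt)) (Y1 :\: By) Y1 a1 #|By|.
- apply: mem_dis => v; rewrite inE => /orP[] vA /setDP[vY _].
    by case/setDP: vA => /setDP[vX _] _; have := disjointFr d2Y1 vX; rewrite vY.
  by case/setDP: vA => vX _; have := disjointFr d1Y1 vX; rewrite vY.
- exact: subsetDl.
- move=> v vA; apply: degX; case/setUP: vA => [/setDP[/setDP[vX _] _]|/setDP[vX _]];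
  by rewrite inE vX ?orbT.
- apply: subset_leq_card; apply/subsetP => v; rewrite in_setD in_setD.
  by case: (v \in By) => //=; rewrite andNb.
- have : (q * (#|By| + k * g + g) < q * a1)%N.
    apply: leq_trans a1_large; rewrite -addnA mulnDr -addSn leq_add2r; exact: cBy.
  by rewrite ltn_pmul2l // => /ltnW.
have [dZ12 dZ3 compl] := leftover_partition d12 d1Y1 d1Y2 d2Y1 d2Y2 dY12 WbS ByY WcS WdS TtX.
rewrite -/rest in dZ12 dZ3 compl.
have tZ := tiledU (tiledU t1 t2 dZ12) t3 dZ3.
set Z := (rest :|: Wb) :|: _ :|: _ in tZ compl.
set Y' := Y1 :\: By :\: Wd in compl.
have Y'Y1 : Y' \subset Y1 by apply: subset_trans (subsetDl _ _) (subsetDl _ _).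
have dTY : [disjoint Tt & Y'].
  by apply: mem_dis => v /(subsetP TtX) vX /(subsetP Y'Y1) vY; have := disjointFr d1Y1 vX; rewrite vY.
have cTY : #|Tt :|: Y'| = (#|Tt| + #|Y'|)%N.
  by rewrite cardsU (_ : Tt :&: Y' = set0) ?cards0 ?subn0 //; apply/eqP; rewrite setI_eq0.
have cY' : (#|gd| <= #|Y'|)%N.
  have c1' : (h <= #|By| + (#|Wd| + #|Y'|))%N.
    rewrite -[h](cardsID By) (setIidPr ByY) leq_add2l -[X in (X <= _)%N](cardsID Wd) leq_add2r.
    by apply: subset_leq_card; exact: subsetIr.
  have : (q * m <= q * #|Y'|)%N.
    have h1 : (q * h <= q * #|By| + (q * (k * g) + q * #|Y'|))%N.
      rewrite -!mulnDr leq_mul2l; apply/orP; right; apply: leq_trans c1' _.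
      by rewrite leq_add2l leq_add2r.
    have h2 : (h + (q * (k * g) + q * m) <= q * h)%N by rewrite -mulnDr.
    by move: h1 h2 cBy; clear; lia.
  rewrite leq_pmul2l //; apply: leq_trans.
  by have := leq_addr #|meagre (adj G) d t Y1| #|gd|; rewrite cg.
(* Each good tile has [k.-1] vertices in [Tt] and awaits one vertex of [Y']; so the surplus of [Y']
   is a multiple of [k] because [#|V|] is. *)
have dv : (k %| #|Y'| - #|gd|)%N.
  have := divk; rewrite -cardsT -(setUCr Z) cardsU setICr cards0 subn0.
  rewrite (dvdn_addr _ (tiled_card tZ)) compl cTY cTt.
  rewrite -{1}(subnKC cY') addnA -mulnSr prednK // dvdn_addr //.
  exact: dvdn_mull.
have [||Yf [YfY cYf tYf]] := @exact_tiling U V F H #|gd| ((#|Y'| - #|gd|) %/ k) Y' _ k0.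
- by rewrite mulnC divnK // subnKC.
- move=> B _ hB; apply: spanned_in; apply: leq_trans hB.
  rewrite -(leq_pmul2l q0).
  have h1 : (q * m = q * #|gd| + q * #|meagre (adj G) d t Y1|)%N by rewrite -mulnDr cg.
  by move: m_large cm h1; rewrite -/h; clear; lia.
have YfB : Yf \subset Y1 :\: By by apply: subset_trans YfY (subsetDl _ _).
have tH : tiled F H (Tt :|: Yf).
  by apply: (@hall_tiling R U V F G S X1 Y1 d m q b t u0).
have tL : tiled F H ((Y' :\: Yf) :|: (Tt :|: Yf)).
  apply: tiledU => //; apply: mem_dis => v /setDP[vY vf] /setUP[vT|]; last exact/negP.
  by have := disjointFr dTY vT; rewrite vY.
have eqC : (Y' :\: Yf) :|: (Tt :|: Yf) = ~: Z.
  rewrite compl setUCA; congr (_ :|: _); apply/setP => v; rewrite in_setU in_setD.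
  by case: (boolP (v \in Yf)) => [/(subsetP YfY) ->|]; rewrite ?orbT ?orbF.
rewrite -(setUCr Z) -eqC; apply: tiledU => //.
by rewrite eqC -setI_eq0 setICr.
Qed.

End Assembly.

(** * Covering the exceptional vertices by rooted copies *)

Section RootedCover.
Variables (R : realType) (U V : finType) (F : sgraph U) (G : sgraph V) (S : {set {set V}}).
Variables (x : U) (M : {set U * U}) (d rho : R) (K r g : nat) (T : 'I_r.+1 -> U -> {set V}).
Let k := #|U|.
Let H := edges G :|: S.
Variable Res : {set V}.

Hypothesis Mok : forall z, z \in M ->
  [/\ z.1 != z.2, [set z.1; z.2] \in edges F, x != z.1 & x != z.2].
Hypothesis rho01 : 0 < rho <= 1.
Hypothesis Tdis : forall i j u w v, u != x -> w != x -> v \in T i u -> v \in T j w ->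
  i = j /\ u = w.
Hypothesis Tbig : forall j u, u != x -> 2 * rho * #|V|%:R <= #|T j u|%:R.
Hypothesis Treg : forall j z (A B : {set V}), z \in M -> A \subset T j z.1 -> B \subset T j z.2 ->
  (#|T j z.1| <= 2 * #|A|)%N -> (#|T j z.2| <= 2 * #|B|)%N ->
  d * (#|A|%:R * #|B|%:R) <= (ecount (adj G) A B)%:R.
Hypothesis TRes : forall j u, u != x -> [disjoint Res & T j u].
Hypothesis rhoK : 1 <= rho * K%:R.
Hypothesis gV : (k * g)%:R <= rho * #|V|%:R.
Hypothesis V0 : (0 < #|V|)%N.
Hypothesis Kr : (k ^ r * #|V| < K ^ r)%N.
Hypothesis many : many_roots F G x M d rho K S.
Hypothesis few : few_roots F G x M K T S.

Let lev (j : 'I_r.+1) := \bigcup_(u | u != x) T j u.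

Let k0 : (0 < k)%N.
Proof. by apply/card_gt0P; exists x. Qed.

Let Tdis1 j u w v : u != x -> w != x -> v \in T j u -> v \in T j w -> u = w.
Proof. by move=> ux wx vu vw; have [_ ->] := Tdis ux wx vu vw. Qed.

Lemma rooted_copy_spanned j (L W : {set V}) : disjoint_family (root_system x T j L W) ->
  rooted_copy F G M (root_system x T j L W) S ->
  exists v (B : {set V}), [/\ v \in L, B \subset lev j :\: W & spanned F H (v |: B)].
Proof.
move=> /disjoint_familyP dis /existsP[f /andP[fT fS]].
move: fT; rewrite inE => /andP[/forallP fin /allP fM].
have fi : injective f by move=> u w fuw; apply: (dis u w (f u)) => //; rewrite fuw.
exists (f x), (f @: (~: [set x])); split.
- by have := fin x; rewrite ffunE eqxx.
- apply/subsetP => _ /imsetP[u + ->]; rewrite !inE => ux.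
  have := fin u; rewrite ffunE (negPf ux) inE => /andP[-> fu] /=.
  by apply/bigcupP; exists u.
exists f; split=> //.
  by rewrite -(setUCr [set x]) imsetU imset_set1.
apply/subset_image_edges => e eF; rewrite inE.
have [eM|eM] := boolP (e \in [set [set z.1; z.2] | z in M]).
  case/imsetP: eM => z zM ->; rewrite imsetU1 imset_set1.
  by rewrite -/(adj G (f z.1) (f z.2)) fM ?mem_enum.
have := elimT (subset_image_edges f _ S) fS e; rewrite inE eM eF => /(_ isT) ->.
by rewrite orbT.
Qed.

Lemma disjoint_levels (L : {set V}) j : L \subset Res -> [disjoint L & lev j].
Proof.
move=> LR; rewrite -setI_eq0; apply/eqP/setP => v; rewrite in_setI in_set0.
apply/negP => /andP[vL /bigcupP[u ux vT]].
by have := disjointFr (TRes j ux) (subsetP LR _ vL); rewrite vT.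
Qed.

Lemma root_ok (L : {set V}) j : L \subset Res -> [forall u, (u != x) ==> [disjoint L & T j u]].
Proof.
by move=> LR; apply/forallP => u; apply/implyP => ux; apply: disjointWl (TRes j ux).
Qed.

(* Each level divides the number of uncovered roots by [K / k]; [Kr] ensures that
   [r] levels suffice. *)
Lemma cover_step j (L : {set V}) : L \subset Res -> (#|L| * K ^ 2 <= #|V|)%N ->
  exists L' W : {set V}, [/\ L' \subset L, (K * #|L'| <= k * #|L|)%N,
    W \subset lev j, tiled F H ((L :\: L') :|: W) & #|W| = (k.-1 * (#|L| - #|L'|))%N].
Proof.
move=> LR LK; pose Q (L' : {set V}) := (L' != set0) && (k.-1 * #|L| < K * #|L'|)%N.
have [|L' [W [L'L nQ WS tW cW]]] := @greedy_cover U V F H L (lev j) Q (disjoint_levels j LR).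
  move=> L' W L'L /andP[L'0 hQ] WS cW.
  have L'K : (#|L'| * K ^ 2 <= #|V|)%N.
    by apply: leq_trans LK; rewrite leq_mul2r subset_leq_card ?orbT.
  have WK : (#|W| <= K * #|L'|)%N by apply: leq_trans cW (ltnW hQ).
  have L'R := subset_trans L'L LR.
  have rc : rooted_copy F G M (root_system x T j L' W) S.
    move/forallP: few => /(_ j)/forallP/(_ L')/forallP/(_ W)/implyP; apply.
    by rewrite L'0 root_ok // L'K.
  have rW : rho^-1 * #|W|%:R <= #|V|%:R.
    have /andP[r0 _] := rho01.
    apply: (@le_trans _ _ (K%:R * (K * #|L'|)%:R)).
      by apply: ler_pM; rewrite ?invr_ge0 ?(ltW r0) ?ler_nat // -div1r ler_pdivrMr // mulrC.
    by rewrite -natrM ler_nat; apply: leq_trans L'K; rewrite mulnA mulnn mulnC.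
  have [dis _ _] := root_system_ok Mok rho01 Tdis1 Tbig Treg rhoK (root_ok j L'R) rW.
  exact: rooted_copy_spanned dis rc.
exists L', W; split=> //; move: nQ; rewrite negb_and negbK => /orP[/eqP ->|].
  by rewrite cards0 muln0.
by rewrite -leqNgt => h; apply: leq_trans h _; rewrite leq_mul2r leq_pred orbT.
Qed.

(** The event [many_roots] holds for arbitrary classes, so the used set may be of linear size here;
    the round ends when too few roots remain for this event. *)
Lemma cover_first (L : {set V}) : L \subset Res -> (#|L| <= g)%N ->
  exists L' W : {set V}, [/\ L' \subset L, (#|L'| * K ^ 2 <= #|V|)%N,
    W \subset lev ord0, tiled F H ((L :\: L') :|: W) & #|W| = (k.-1 * (#|L| - #|L'|))%N].
Proof.
move=> LR Lg; pose Q (L' : {set V}) := (#|V| < #|L'| * K ^ 2)%N.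
have [|L' [W [L'L nQ WS tW cW]]] := @greedy_cover U V F H L (lev ord0) Q (disjoint_levels ord0 LR).
  move=> L' W L'L hQ WS cW; have L'R := subset_trans L'L LR.
  have rW : rho^-1 * #|W|%:R <= #|V|%:R.
    have /andP[r0 _] := rho01; rewrite mulrC ler_pdivrMr // mulrC; apply: le_trans gV.
    by rewrite ler_nat (leq_trans cW) // leq_mul // leq_pred.
  have [dis big reg] := root_system_ok Mok rho01 Tdis1 Tbig Treg rhoK (root_ok ord0 L'R) rW.
  have rc : rooted_copy F G M (root_system x T ord0 L' W) S.
    move/forallP: many => /(_ (root_system x T ord0 L' W))/implyP; apply.
    apply/and4P; split=> //.
    - by apply/forallP => u; apply/implyP; apply: big.
    - by rewrite ffunE eqxx -natrX -natrM ler_nat ltnW.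
    - exact/forall_inP.
  exact: rooted_copy_spanned dis rc.
by exists L', W; split=> //; rewrite leqNgt.
Qed.

(** Each round needs a new level because [few_roots] tolerates only [K] used vertices per root still
    uncovered, while earlier rounds may have used far more. *)
Lemma rooted_cover (L : {set V}) : L \subset Res -> (#|L| <= g)%N ->
  exists W : {set V}, [/\ W \subset \bigcup_j lev j, tiled F H (L :|: W) & (#|W| <= k * g)%N].
Proof.
move=> LR Lg.
have dlev i j v : v \in lev i -> v \in lev j -> i = j.
  by case/bigcupP => u ux vu /bigcupP[w wx vw]; have [] := Tdis ux wx vu vw.
have main i : (i <= r)%N -> exists L' W : {set V}, [/\ L' \subset L, (#|L'| * K ^ 2 <= #|V|)%N,
    (#|L'| * K ^ i <= k ^ i * #|V|)%N &
    [/\ W \subset \bigcup_(j : 'I_r.+1 | (j <= i)%N) lev j, tiled F H ((L :\: L') :|: W) &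
    #|W| = (k.-1 * (#|L| - #|L'|))%N]].
  elim: i => [_|i IH ir].
    have [L' [W [L'L L'K WS tW cW]]] := cover_first LR Lg.
    exists L', W; split=> //.
      by rewrite muln1 mul1n; apply: leq_trans (max_card _); apply: subset_leq_card; exact: subsetT.
    split=> //; apply: subset_trans WS _; exact: (bigcup_sup ord0).
  have [L1 [W1 [L1L L1K L1i [W1S tW1 cW1]]]] := IH (ltnW ir).
  have [L2 [W2 [L2L1 L2K W2S tW2 cW2]]] := cover_step (Ordinal (ir : (i.+1 < r.+1)%N)) (subset_trans L1L LR) L1K.
  have cL1 := subset_leq_card L1L; have cL2 := subset_leq_card L2L1.
  have dW : [disjoint W1 & W2].
    rewrite -setI_eq0; apply/eqP/setP => v; rewrite in_setI in_set0; apply/negP => /andP[v1 v2].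
    have /bigcupP[j ji vj] := subsetP W1S _ v1.
    have jE := dlev _ _ _ vj (subsetP W2S _ v2).
    by move: ji; rewrite jE /= ltnn.
  have dL j : [disjoint L & lev j] by apply: disjoint_levels.
  exists L2, (W1 :|: W2); split.
  - exact: subset_trans L2L1 L1L.
  - by apply: leq_trans L1K; rewrite leq_mul2r cL2 orbT.
  - rewrite !expnS mulnA [(#|L2| * K)%N]mulnC -mulnA.
    apply: (@leq_trans (k * #|L1| * K ^ i)); first by rewrite mulnA leq_mul2r L2K orbT.
    by rewrite -!mulnA leq_mul2l L1i orbT.
  split.
  - rewrite subUset; apply/andP; split.
      apply: subset_trans W1S _; apply/bigcupsP => j ji; apply: (bigcup_sup j).
      exact: leqW.
    by apply: subset_trans W2S _; apply: (bigcup_sup (Ordinal (ir : (i.+1 < r.+1)%N))).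
  - have -> : (L :\: L2) :|: (W1 :|: W2) = ((L :\: L1) :|: W1) :|: ((L1 :\: L2) :|: W2).
      apply/setP => v; have := introT implyP (subsetP L2L1 v); have := introT implyP (subsetP L1L v).
      rewrite !inE; case: (v \in L); case: (v \in L1) => //=; case: (v \in L2) => //=;
      by case: (v \in W1); case: (v \in W2).
    apply: tiledU => //; rewrite -setI_eq0; apply/eqP/setP => v; rewrite in_setI in_set0.
    have noLW w : w \in L -> (w \in W1) || (w \in W2) -> False.
      move=> wL /orP[/(subsetP W1S)/bigcupP[j _ wj]|/(subsetP W2S) wj].
        by rewrite (disjointFr (dL j) wL) in wj.
      by rewrite (disjointFr (dL _) wL) in wj.
    apply/negP; rewrite !inE => /andP[/orP[/andP[v1 vL]|vW1] /orP[/andP[v2 vL1]|vW2]].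
    + by rewrite vL1 in v1.
    + by apply: (noLW v vL); rewrite vW2 orbT.
    + by apply: (noLW v (subsetP L1L _ vL1)); rewrite vW1.
    by have := disjointFr dW vW1; rewrite vW2.
  rewrite cardsU (_ : W1 :&: W2 = set0) ?cards0 ?subn0; last by apply/eqP; rewrite setI_eq0.
  rewrite cW1 cW2 -mulnDr; congr (_ * _)%N.
  by move: #|L| #|L1| #|L2| cL1 cL2 => a b c'; clear; lia.
have [L' [W [L'L L'K L'r [WS tW cW]]]] := main r (leqnn r).
have L'0 : L' = set0.
  apply/eqP; rewrite -cards_eq0; case: (posnP #|L'|) => // L'0.
  have := leq_trans (leq_pmull (K ^ r) L'0) L'r.
  by rewrite leqNgt Kr.
exists W; split.
- apply: subset_trans WS _; apply/bigcupsP => j _; exact: (bigcup_sup j).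
- by move: tW; rewrite L'0 setD0.
by rewrite cW; apply: leq_mul; rewrite ?leq_pred // (leq_trans (leq_subr _ _)).
Qed.

End RootedCover.

(** * Choice of the vertex classes *)

Lemma subset_of_card (V : finType) (A : {set V}) (j : nat) : (j <= #|A|)%N ->
  exists2 B : {set V}, B \subset A & #|B| = j.
Proof.
move=> jA; exists [set v in take j (enum A)].
  by apply/subsetP => v; rewrite inE => /mem_take; rewrite mem_enum.
rewrite cardsE; have /card_uniqP -> : uniq (take j (enum A)) by rewrite take_uniq ?enum_uniq.
by rewrite size_take -cardE; case: ltnP => // h; apply/eqP; rewrite eqn_leq h jA.
Qed.

Lemma disjoint_blocks (V I : finType) (A : {set V}) : exists B : I -> {set V},
  [/\ forall i, B i \subset A, forall i, #|B i| = (#|A| %/ #|I|)%N &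
      forall i j v, v \in B i -> v \in B j -> i = j].
Proof.
set s := (#|A| %/ #|I|)%N.
have le : (#|{: I * 'I_s}| <= #|A|)%N.
  by rewrite card_prod card_ord mulnC leq_trunc_div.
pose f (z : I * 'I_s) : V := enum_val (widen_ord le (enum_rank z)).
have fi : injective f.
  move=> z z' /enum_val_inj /(congr1 val) /= h.
  by apply: enum_rank_inj; apply: val_inj.
exists (fun i => [set f (i, j) | j : 'I_s]); split.
- by move=> i; apply/subsetP => _ /imsetP[j _ ->]; apply: enum_valP.
- by move=> i; rewrite card_imset ?card_ord // => j j' /fi[].
by move=> i j v /imsetP[a _ ->] /imsetP[b _ /fi[]].
Qed.

Section Setup.
Variables (R : realType) (V : finType) (r : rel V) (X Y : {set V}) (d eta : R) (k : nat).
Hypothesis rC : symmetric r.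
Hypotheses (k0 : (0 < k)%N) (d01 : 0 < d <= 1) (eta0 : 0 < eta).
Hypothesis YX : (#|Y| <= #|X|)%N.
Hypothesis Ybig : (64 * k <= #|Y|)%N.
Hypothesis eta_small : eta * (64 * k)%:R <= d.
Hypothesis reg : forall A B : {set V}, A \subset X -> B \subset Y ->
  eta * #|X|%:R <= #|A|%:R -> eta * #|Y|%:R <= #|B|%:R ->
  d * (#|A|%:R * #|B|%:R) <= (ecount r A B)%:R.

(** [B0] is taken of size about [#|Y| / (16 k)], so that [X1] has room for [#|Y1|] tiles twice over.
    Vertices of [X] of low degree into [B0] are discarded first, then those of [Y] of low degree
    into [X2]. The second step removes at most [d * h0 / 2] vertices from [B0], which explains
    [d / 2] in the degrees into [Y1]. *)
Lemma dense_pair_split : exists X1 X2 Y1 Y2 : {set V},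
  [/\ [/\ X1 \subset X, X2 \subset X, Y1 \subset Y & Y2 \subset Y],
      [disjoint X1 & X2] /\ [disjoint Y1 & Y2],
      [/\ (#|X| <= 8 * #|X1|)%N, (#|X| <= 8 * #|X2|)%N, (#|Y| <= 8 * #|Y2|)%N,
          (#|Y| <= 64 * k * #|Y1|)%N & (2 * (k * #|Y1|) <= #|X1|)%N],
      forall v, v \in X1 :|: X2 -> d / 2 * #|Y1|%:R <= #|[set y in Y1 | r v y]|%:R &
      forall v, v \in Y1 :|: Y2 -> d * #|X2|%:R <= #|[set y in X2 | r v y]|%:R].
Proof.
have /andP[d0 d1] := d01.
pose h0 := (#|Y| %/ (16 * k))%N.
have k16 : (0 < 16 * k)%N by rewrite muln_gt0.
have h0l : (16 * k * h0 <= #|Y|)%N by rewrite mulnC leq_trunc_div.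
have h0u : (#|Y| < 16 * k * h0.+1)%N by rewrite mulnC ltn_ceil.
have h04 : (4 <= h0)%N by rewrite leq_divRL // mulnA.
have h0Y : (h0 <= #|Y|)%N by rewrite leq_div.
have h0u2 : (#|Y| <= 32 * k * h0)%N.
  apply: leq_trans (ltnW h0u) _; rewrite -(leq_pmul2l (isT : 0 < 1)%N) !mul1n.
  rewrite (_ : 32 * k * h0 = 16 * k * (2 * h0))%N; last by ring.
  by rewrite leq_mul2l; apply/orP; right; move: (h0) h04 => a; clear; lia.
have kR : 1 <= k%:R :> R by rewrite ler1n.
have yR : (64 * k)%:R <= #|Y|%:R :> R by rewrite ler_nat.
have Y0 : 0 < #|Y|%:R :> R by rewrite ltr0n; apply: leq_trans Ybig; rewrite muln_gt0.
have etaY : eta * #|Y|%:R * 2 <= d * h0%:R.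
  have a1 : #|Y|%:R <= (32 * k)%:R * h0%:R :> R by rewrite -natrM ler_nat.
  have a2 : eta * #|Y|%:R <= eta * ((32 * k)%:R * h0%:R) by rewrite ler_wpM2l // ltW.
  have a3 : eta * (64 * k)%:R * h0%:R <= d * h0%:R by rewrite ler_wpM2r.
  move: a2 a3; rewrite !natrM; lra.
have h0R : d * h0%:R <= h0%:R by rewrite ler_piMl.
have eta8 : eta <= 8^-1.
  have : eta * 64 <= d.
    apply: le_trans eta_small; rewrite ler_wpM2l ?(ltW eta0) // ler_nat leq_pmulr //.
  by lra.
have [B0 B0Y cB0] := subset_of_card h0Y.
have etaB0 : eta * #|Y|%:R <= #|B0|%:R.
  rewrite cB0; apply: (le_trans _ h0R); apply: le_trans etaY.
  have : 0 <= eta * #|Y|%:R by rewrite mulr_ge0 // ltW.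
  by lra.
pose lowX := [set x in X | #|[set y in B0 | r x y]|%:R < d * #|B0|%:R].
have clowX : #|lowX|%:R <= eta * #|X|%:R by apply: few_low_degree reg _ _ _.
have lowXX : lowX \subset X by apply/subsetP => v; rewrite inE => /andP[].
have etaX : eta * #|X|%:R <= 8^-1 * #|X|%:R by rewrite ler_wpM2r.
have clowX' : (8 * #|lowX| <= #|X|)%N by rewrite -(ler_nat R) natrM; move: clowX etaX; lra.
have cXg : #|X :\: lowX| = (#|X| - #|lowX|)%N by rewrite cardsDS.
have [|X1 X1X cX1] := @subset_of_card V (X :\: lowX) (#|X| %/ 4).
  by rewrite cXg; move: #|X| #|lowX| clowX' => a a'; clear; lia.
pose X2 := X :\: lowX :\: X1.
have cX2 : #|X2| = (#|X| - #|lowX| - #|X| %/ 4)%N by rewrite cardsDS // cXg cX1.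
have Xbig : (64 <= #|X|)%N.
  by apply: leq_trans YX; apply: leq_trans Ybig; rewrite leq_pmulr.
have X1b : (#|X| <= 8 * #|X1|)%N.
  by rewrite cX1; move: #|X| Xbig => a; clear; lia.
have X2b : (#|X| <= 2 * #|X2|)%N.
  by rewrite cX2; move: #|X| #|lowX| clowX' Xbig => a a'; clear; lia.
have X2X : X2 \subset X by apply: subset_trans (subsetDl _ _) (subsetDl _ _).
pose lowY := [set y in Y | #|[set x in X2 | r y x]|%:R < d * #|X2|%:R].
have lowYY : lowY \subset Y by apply/subsetP => v; rewrite inE => /andP[].
have clowY : #|lowY|%:R <= eta * #|Y|%:R.
  apply: (@few_low_degree R V r Y X d eta) => //.
    by move=> A B AY BX hA hB; rewrite ecountC // [#|A|%:R * _]mulrC; apply: reg.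
  have : #|X|%:R <= 2 * #|X2|%:R :> R by rewrite -natrM ler_nat.
  by have : 0 <= #|X2|%:R :> R by []; move: etaX; lra.
have clowY' : (2 * #|lowY| <= h0)%N.
  by rewrite -(ler_nat R) natrM; move: clowY etaY h0R; lra.
exists X1, X2, (B0 :\: lowY), (Y :\: B0 :\: lowY).
have cY1 : (#|B0 :\: lowY| >= h0 - #|lowY|)%N.
  by rewrite cardsD cB0 leq_sub2l // subset_leq_card // subsetIr.
have cY1u : (#|B0 :\: lowY| <= h0)%N by rewrite -cB0 subset_leq_card // subsetDl.
have cY2 : (#|Y :\: B0 :\: lowY| >= #|Y| - h0 - #|lowY|)%N.
  by rewrite cardsD cardsDS // cB0 leq_sub2l // subset_leq_card // subsetIr.
have h0Y16 : (16 * h0 <= #|Y|)%N.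
  by apply: leq_trans h0l; rewrite leq_mul2r leq_pmulr ?orbT.
split.
- split => //; first exact: subset_trans X1X (subsetDl _ _).
    exact: subset_trans (subsetDl _ _) B0Y.
  by apply: subset_trans (subsetDl _ _) (subsetDl _ _).
- split; rewrite -setI_eq0; apply/eqP/setP => v; rewrite [RHS]inE /X2 !in_setI !in_setD.
    by case: (v \in X1).
  by case: (v \in B0); rewrite ?andbF.
- split => //.
  + by apply: leq_trans X2b _; rewrite leq_mul2r orbT.
  + move: cY2 clowY' h0Y16; move: (h0) #|Y :\: B0 :\: lowY| #|lowY| #|Y| => e a b c'; clear; lia.
  + apply: leq_trans h0u2 _; rewrite (_ : 64 * k * _ = 32 * k * (2 * #|B0 :\: lowY|))%N; last by ring.
    rewrite leq_mul2l; apply/orP; right.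
    by move: cY1 clowY'; move: (h0) #|B0 :\: lowY| #|lowY| => e a b; clear; lia.
  apply: (@leq_trans (2 * (k * h0))); first by rewrite !leq_mul2l cY1u !orbT.
  rewrite cX1 leq_divRL //; apply: leq_trans YX; apply: leq_trans h0l.
  by rewrite (_ : 2 * (k * h0) * 4 = 8 * k * h0)%N ?leq_mul //; ring.
- move=> v vX; have vg : v \in X :\: lowX.
    by case/setUP: vX => [/(subsetP X1X)//|/setDP[]].
  move: vg; rewrite in_setD => /andP[+ vX']; rewrite inE vX' /= -leNgt cB0 => dv.
  have sub : [set y in B0 | r v y] \subset [set y in B0 :\: lowY | r v y] :|: lowY.
    apply/subsetP => y; rewrite in_setU inE => /andP[yB ry].
    case: (boolP (y \in lowY)) => yl; rewrite ?orbT // orbF.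
    by rewrite inE in_setD yB yl ry.
  have := leq_trans (subset_leq_card sub) (leq_card_setU _ _).
  rewrite -(ler_nat R) natrD => h1.
  have h2 : d / 2 * #|B0 :\: lowY|%:R <= d / 2 * h0%:R.
    by rewrite ler_wpM2l ?ler_nat // divr_ge0 // ltW.
  by move: dv h1 h2 clowY etaY; lra.
move=> v vY; have : v \in Y :\: lowY.
  case/setUP: vY => /setDP[vY vl]; rewrite in_setD vl /=; first exact: (subsetP B0Y).
  by case/setDP: vY.
by rewrite in_setD => /andP[+ vY']; rewrite inE vY' /= -leNgt.
Qed.

End Setup.

Section Existence.
Variables (R : realType) (U V : finType) (F : sgraph U) (S : {set {set V}}).
Let k := #|U|.
Let E := edges F.

(** [A] is cut into [k] disjoint blocks, which serve as vertex classes and make the embedding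
    injective. *)
Lemma spread_copies (gam : R) (g : nat) : (0 < k)%N ->
  gam * #|V|%:R <= (g %/ k)%:R -> spread F gam S ->
  forall A : {set V}, (g <= #|A|)%N -> exists f : {ffun U -> V},
    [/\ injective f, forall u, f u \in A & image_edges f E \subset S].
Proof.
move=> k0 gk /forallP sp A gA; have [B [BA cB dB]] := disjoint_blocks U A.
pose Sf : {ffun U -> {set V}} := [ffun u => B u].
have dS : disjoint_family Sf.
  by apply/disjoint_familyP => u w v; rewrite !ffunE; apply: dB.
have big : [forall u, gam * #|V|%:R <= #|Sf u|%:R].
  apply/forallP => u; rewrite ffunE cB; apply: (le_trans gk).
  by rewrite ler_nat leq_div2r.
have /implyP := sp Sf; rewrite dS big => /(_ isT)/existsP[f /andP[/forallP fS fE]].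
exists f; split=> //; last by move=> u; have := fS u; rewrite ffunE => /(subsetP (BA u)).
move=> u w fuw; have := fS u; have := fS w; rewrite -fuw !ffunE => h1 h2.
exact: dB h2 h1.
Qed.

Lemma tiles_exist_copies (X : {set V}) (g m : nat) : (g + m * k <= #|X|)%N ->
  (forall A : {set V}, (g <= #|A|)%N -> exists f : {ffun U -> V},
    [/\ injective f, forall u, f u \in A & image_edges f E \subset S]) ->
  tiles_exist E X m S.
Proof.
move=> gX hcopy.
have main j : (j <= m)%N -> exists f : nat -> {ffun U -> V},
    (forall i, (i < j)%N -> (forall u, f i u \in X) /\ image_edges (f i) E \subset S) /\
    (forall i i' u w, (i < j)%N -> (i' < j)%N -> f i u = f i' w -> i = i' /\ u = w).
  elim: j => [|j IH] jm.
    have [|f0 _] := hcopy X; first by apply: leq_trans gX; rewrite leq_addr.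
    by exists (fun=> f0).
  have [f [f1 f2]] := IH (ltnW jm).
  pose used := \bigcup_(i < j) (f i @: [set: U]).
  have cused : (#|used| <= j * k)%N.
    apply: (@leq_trans (\sum_(i < j) k)); last by rewrite sum_nat_const card_ord.
    rewrite /used; elim/big_ind2: _ => [|a A b B hA hB|i _].
    - by rewrite cards0.
    - by apply: leq_trans (leq_card_setU _ _) _; apply: leq_add.
    - by apply: leq_trans (leq_imset_card _ _) _; rewrite cardsT.
  have [|f' [f'i f'X f'S]] := hcopy (X :\: used).
    have h1 : (#|X| <= #|X :\: used| + #|used|)%N.
      by rewrite -(cardsID used X) addnC leq_add2l subset_leq_card // subsetIr.
    have h2 : (j * k <= m * k)%N by rewrite leq_mul2r (ltnW jm) orbT.
    by rewrite -(leq_add2r (m * k)); apply: leq_trans gX (leq_trans h1 _);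
      rewrite leq_add2l (leq_trans cused).
  exists (fun i => if i == j then f' else f i); split.
    move=> i; rewrite ltnS leq_eqVlt => /orP[/eqP ->|ij].
      by rewrite eqxx; split=> // u; have /setDP[] := f'X u.
    by rewrite (ltn_eqF ij); apply: f1.
  have cross i u w : (i < j)%N -> f i u = f' w -> False.
    move=> ij fu; have /setDP[_ /negP[]] := f'X w; apply/bigcupP.
    by exists (Ordinal ij) => //; rewrite -fu; apply: imset_f.
  move=> i i' u w; rewrite !ltnS leq_eqVlt => /orP[/eqP ->|ij]; rewrite leq_eqVlt => /orP[/eqP ->|ij'].
  - by rewrite eqxx => /f'i.
  - by rewrite eqxx (ltn_eqF ij') => /esym /(cross _ _ _ ij').
  - by rewrite eqxx (ltn_eqF ij) => /(cross _ _ _ ij).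
  - by rewrite (ltn_eqF ij) (ltn_eqF ij'); apply: f2.
have [f [f1 f2]] := main m (leqnn m).
apply/existsP; exists [ffun z : 'I_m * U => f z.1 z.2]; rewrite inE.
apply/andP; split; first apply/andP; first split.
- apply/injectiveP => -[i u] [j w]; rewrite !ffunE /= => h.
  have [ij ->] := f2 _ _ _ _ (ltn_ord i) (ltn_ord j) h.
  by congr pair; apply: val_inj.
- by apply/forallP => -[i u]; rewrite ffunE; have [] := f1 i (ltn_ord i).
apply/forallP => i; have [_] := f1 i (ltn_ord i).
suff -> : tile [ffun z : 'I_m * U => f z.1 z.2] i = f i by [].
by apply/ffunP => u; rewrite !ffunE.
Qed.

End Existence.

Section TileNumbers.
Variable R : realType.

Lemma tile_parameters (c1 d : R) (h q g k : nat) : 0 < c1 <= 1 -> c1 <= d <= 1 ->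
  12 <= c1 * q%:R -> (q <= h)%N -> (q * (k.+1 * g) <= h)%N ->
  exists m b : nat, [/\ (m <= h)%N, 2 * h%:R <= q%:R * (c1 * h%:R - (h%:R - m%:R)),
    (2 * h <= q * b)%N /\ b%:R * q%:R <= c1 * (q%:R * m%:R - h%:R),
    (h + q * (k * g + m) <= q * h)%N /\ (h + q * g <= q * m)%N &
    (h + q * (k * g + g) <= q * Num.truncn (d / 2 * h%:R))%N].
Proof.
case/andP=> c0 c1_1 /andP[cd d1] cq qh gh.
have h0R : 0 <= h%:R :> R by [].
have q0R : 0 <= q%:R :> R by [].
have q0 : (0 < q)%N.
  by rewrite lt0n; apply: contraTneq cq => ->; rewrite mulr0 -ltNge.
have qhR : q%:R <= h%:R :> R by rewrite ler_nat.
have ghR : q%:R * (k%:R * g%:R + g%:R) <= h%:R :> R.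
  by rewrite -natrM -natrD -natrM ler_nat -mulSnr.
have kg0 : 0 <= q%:R * (k%:R * g%:R) :> R by rewrite !mulr_ge0.
have qg0 : 0 <= q%:R * g%:R :> R by rewrite !mulr_ge0.
have cqh : 12 * h%:R <= c1 * q%:R * h%:R by rewrite ler_wpM2r.
have dqh : c1 * q%:R * h%:R <= d * q%:R * h%:R by rewrite !ler_wpM2r.
have q12 : 12 <= q%:R :> R by apply: (le_trans cq); rewrite ler_piMl.
have q12h : 12 * h%:R <= q%:R * h%:R :> R by rewrite ler_wpM2r.
have ch1 : c1 * h%:R <= h%:R by rewrite ler_piMl.
have qch : q%:R * (c1 * h%:R) <= q%:R * h%:R by rewrite ler_wpM2l.
(* [Y1] has [s] more vertices than there are tiles: a surplus to absorb with, yet about half of the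
   guaranteed degree [c1 * h] of a good tile, as Hall's condition requires. *)
pose s := Num.truncn (c1 / 2 * h%:R).
have x0 : 0 <= c1 / 2 * h%:R by rewrite !mulr_ge0 // ?invr_ge0 // ltW.
have /andP[s1 s2] := truncn_itv x0; rewrite -/s in s1 s2.
have {}s2 : c1 / 2 * h%:R < s%:R + 1 by rewrite natr1.
have sh : (s <= h)%N.
  rewrite -(ler_nat R); apply: (le_trans s1); move: ch1 h0R; clear; lra.
have qs1 : q%:R * s%:R <= q%:R * (c1 / 2 * h%:R) by rewrite ler_wpM2l.
have qs2 : q%:R * (c1 / 2 * h%:R) <= q%:R * (s%:R + 1) by rewrite ler_wpM2l // ltW.
pose m := (h - s)%N; pose b := ((2 * h) %/ q).+1.
have mR : m%:R = h%:R - s%:R :> R by rewrite natrB.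
have bq : (2 * h <= q * b)%N by rewrite /b [(q * _)%N]mulnC ltnW // ltn_ceil.
have bq' : b%:R * q%:R <= 3 * h%:R :> R.
  rewrite -!natrM ler_nat /b mulSn (_ : 3 * h = h + 2 * h)%N; last by rewrite -mulSn.
  by apply: leq_add => //; apply: leq_trunc_div.
exists m, b; split; first exact: leq_subr.
- rewrite mR; move: qs1 cqh h0R; clear; lra.
- split=> //; apply: (le_trans bq'); rewrite mR.
  have e : c1 * (q%:R * (h%:R - s%:R) - h%:R) >= 5 * h%:R.
    have e1 : c1 * (q%:R * s%:R) <= q%:R * s%:R by rewrite ler_piMl // mulr_ge0.
    have e2 : c1 * (q%:R * s%:R) <= c1 * (q%:R * (c1 / 2 * h%:R)) by rewrite ler_wpM2l // ltW.
    have e3 : c1 * (q%:R * (c1 * h%:R)) <= c1 * (q%:R * h%:R) by rewrite ler_wpM2l // ltW.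
    move: e1 e2 e3 cqh ch1 h0R; clear; lra.
  by move: e h0R; clear; lra.
- split.
    rewrite -(ler_nat R) !(natrD, natrM) mR.
    by move: qs2 cqh ghR qhR kg0 qg0 h0R; clear; lra.
  rewrite -(ler_nat R) !(natrD, natrM) mR.
  by move: qs1 qch q12h ghR kg0 h0R; clear; lra.
have d0 : 0 <= d / 2 * h%:R.
  by rewrite !mulr_ge0 // ?invr_ge0 // (le_trans (ltW c0)).
have /andP[_ t2] := truncn_itv d0; move: t2; set w := Num.truncn _ => t2.
have {}t2 : d / 2 * h%:R < w%:R + 1 by rewrite natr1.
have qw : q%:R * (d / 2 * h%:R) <= q%:R * (w%:R + 1) by rewrite ler_wpM2l // ltW.
rewrite -(ler_nat R) !(natrD, natrM).
by move: qw dqh cqh ghR qhR h0R; clear; lra.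
Qed.

Lemma lower_bound_of_cover (e0 e1 e2 e3 e4 t1 t2 t3 t4 : R) :
  1 <= e0 + (e1 + e2 + e3 + e4) -> e1 <= t1 -> e2 <= t2 -> e3 <= t3 -> e4 <= t4 ->
  1 - (t1 + t2 + t3 + t4) <= e0.
Proof. lra. Qed.

End TileNumbers.

(** To be used with [A] the first ends of the matching: every matching edge then runs between [X]
    and [Y], where [G] is regular. *)
Lemma root_blocks (U V : finType) (r : nat) (A : {set U}) (X Y : {set V}) : [disjoint X & Y] ->
  exists T : 'I_r.+1 -> U -> {set V},
   [/\ forall i j u w v, v \in T i u -> v \in T j w -> i = j /\ u = w,
       forall j u, u \in A -> T j u \subset X /\ #|T j u| = (#|X| %/ (r.+1 * #|U|))%N &
       forall j u, u \notin A -> T j u \subset Y /\ #|T j u| = (#|Y| %/ (r.+1 * #|U|))%N].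
Proof.
move=> dXY; pose I : finType := ('I_r.+1 * U)%type.
have cI : #|I| = (r.+1 * #|U|)%N by rewrite card_prod card_ord.
have [BX [BX1 BX2 BX3]] := disjoint_blocks I X.
have [BY [BY1 BY2 BY3]] := disjoint_blocks I Y.
have cross i j v : v \in BX i -> v \in BY j -> False.
  by move=> /(subsetP (BX1 i)) vX /(subsetP (BY1 j)) vY; have := disjointFr dXY vX; rewrite vY.
exists (fun j u => if u \in A then BX (j, u) else BY (j, u)); split.
- move=> i j u w v; case: ifP => uA; case: ifP => wA.
  + by move=> h1 h2; have [-> ->] := BX3 _ _ _ h1 h2.
  + by move=> h1 h2; case: (cross _ _ _ h1 h2).
  + by move=> h1 h2; case: (cross _ _ _ h2 h1).
  + by move=> h1 h2; have [-> ->] := BY3 _ _ _ h1 h2.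
- by move=> j u ->; rewrite -cI BX2; split.
by move=> j u /negPf ->; rewrite -cI BY2; split.
Qed.

(** * The probability of a factor for fixed parameters *)

Section Perturbed.
Variables (R : realType) (U V : finType) (F : sgraph U) (G : sgraph V).
Variables (x : U) (M : {set U * U}) (p c d eta rho gam y : R) (K r q g : nat) (X Y : {set V}).
Let k := #|U|.
Let n : R := #|V|%:R.
Let N := (r.+1 * k)%N.
Let E := edges F.
Let E' := E :\: [set [set z.1; z.2] | z in M].

Hypothesis p01 : 0 < p <= 1.
Hypothesis c_ge1 : 1 <= c.
Hypothesis Hc : forall D : {set U}, induced E D != set0 ->
  c * n <= n ^+ #|D| * p ^+ #|induced E D|.
Hypothesis HK : forall D : {set U}, x \in D -> (2 <= #|D|)%N ->
  K%:R ^+ 3 * n <= n ^+ #|D| * p ^+ #|induced E' D|.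
Hypothesis Mok : forall z, z \in M ->
  [/\ z.1 != z.2, [set z.1; z.2] \in E, x != z.1 & x != z.2].
Hypothesis Mdis :
  {in M &, forall z z', z != z' -> [disjoint [set z.1; z.2] & [set z'.1; z'.2]]}.
Hypothesis d01 : 0 < d <= 1.
Hypothesis dXY : [disjoint X & Y].
Hypothesis YX : (#|Y| <= #|X|)%N.
Hypothesis eta0 : 0 < eta.
Hypothesis reg : forall A B : {set V}, A \subset X -> B \subset Y ->
  eta * #|X|%:R <= #|A|%:R -> eta * #|Y|%:R <= #|B|%:R ->
  d * (#|A|%:R * #|B|%:R) <= (ecount (adj G) A B)%:R.
Hypothesis Y_k : (64 * k <= #|Y|)%N.
Hypothesis Y_N : (8 * N <= #|Y|)%N.
Hypothesis Y_q : (64 * k * q <= #|Y|)%N.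
Hypothesis Y_g : (64 * k * (q * (k.+1 * g)) <= #|Y|)%N.
Hypothesis eta_k : eta * (64 * k)%:R <= d.
Hypothesis eta_N : eta * (32 * N)%:R <= 1.
Hypothesis eta_q : (64 * k)%:R * eta * q%:R <= d ^+ k.
Hypothesis eta_qk : k%:R * ((64 * k)%:R * eta) * 2 ^+ (k.+3 * q) <= 1.
Hypothesis q_large : 12 <= d ^+ k * q%:R.
Hypothesis rho01 : 0 < rho <= 1.
Hypothesis rho_Y : rho * n * (32 * N)%:R <= #|Y|%:R.
Hypothesis g0 : (0 < g)%N.
Hypothesis g_rho : (k * g)%:R <= rho * n.
Hypothesis g_X : 8 * (2 * (k * g) + g)%:R <= d * #|X|%:R.
Hypothesis gam01 : 0 < gam <= 1.
Hypothesis gam_g : gam * n <= (g %/ k)%:R.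
Hypothesis cK : c <= K%:R.
Hypothesis rhoK : 1 <= rho * K%:R.
Hypothesis Kr : (k ^ r * #|V| < K ^ r)%N.
Hypothesis yK : #|V|.+1%:R ^+ K.+1 *
  expR (- (d ^+ #|M| * (rho ^+ k * K%:R ^+ 2) / (4 * 2 ^+ k))) <= y.
Hypothesis y1 : y <= 1.
Hypothesis divk : (k %| #|V|)%N.

Lemma perturbed_factor_probability :
  1 - (2 ^+ (#|V| * k) * expR (- (gam ^+ k * (c * n) / (4 * 2 ^+ k))) +
       2 ^+ (#|V| * k) * expR (- (d ^+ #|M| * (rho ^+ k * (c * n)) / (4 * 2 ^+ k))) +
       r.+1%:R * #|V|.+1%:R * y + (64 * k)%:R / #|Y|%:R) <=
  gnp_prob p (fun H => has_factor F (gunion G H)).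
Proof.
have k0 : (0 < k)%N by apply/card_gt0P; exists x.
have N0 : (0 < N)%N by rewrite muln_gt0.
have p01' : 0 <= p <= 1 by case/andP: p01 => /ltW -> ->.
have /andP[d0 d1] := d01.
have [X1 [X2 [Y1 [Y2 [[X1X X2X Y1Y Y2Y] [dX12 dY12] [sX1 sX2 sY2 sY1 s12] degX degY]]]]] :=
  dense_pair_split (@adjC V G) k0 d01 eta0 YX Y_k eta_k reg.
have dis (A B : {set V}) : A \subset X -> B \subset Y -> [disjoint A & B].
  move=> AX BY; apply: disjointWl AX _; rewrite disjoint_sym.
  by apply: disjointWl BY _; rewrite disjoint_sym.
set h := #|Y1| in sY1 s12.
have k64 : (0 < 64 * k)%N by rewrite muln_gt0.
have qh : (q <= h)%N by rewrite -(leq_pmul2l k64); apply: leq_trans sY1.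
have gh : (q * (k.+1 * g) <= h)%N by rewrite -(leq_pmul2l k64); apply: leq_trans sY1.
have q0 : (0 < q)%N.
  by rewrite lt0n; apply: contraTneq q_large => ->; rewrite mulr0 -ltNge.
have h0 : (0 < h)%N by apply: leq_trans qh.
have n0 : 0 < n.
  by rewrite ltr0n; apply: leq_trans h0 _; rewrite -cardsT subset_leq_card.
have c1b : 0 < d ^+ k <= 1.
  by rewrite exprn_gt0 //= exprn_ile1 // ltW.
have c1d : d ^+ k <= d <= 1.
  by rewrite d1 andbT -[leRHS]expr1; apply: ler_wiXn2l; rewrite // ltW.
have [m [b [mh slack [bl bs] [ms ml] a1l]]] := tile_parameters c1b c1d q_large qh gh.
pose A1 := [set z.1 | z in M].
have dXY2 : [disjoint X2 & Y2] by apply: dis.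
have [T [Tdis TX TY]] := root_blocks r A1 dXY2.
have ceilN (a a' : nat) : (8 * N <= a)%N -> (a <= 8 * a')%N -> (a <= 16 * N * (a' %/ N))%N.
  move=> Na aa'; have Na' : (N <= a')%N by rewrite -(leq_pmul2l (isT : 0 < 8)%N); apply: leq_trans aa'.
  have h1 : (a' <= 2 * (N * (a' %/ N)))%N.
    have := divn_eq a' N; have := ltn_pmod a' N0.
    have : (1 <= a' %/ N)%N by rewrite divn_gt0.
    rewrite [(a' %/ N * N)%N]mulnC; move: (a' %/ N)%N (a' %% N)%N => u w u1 wN ->.
    have : (N <= N * u)%N by rewrite leq_pmulr.
    by move: (N * u)%N wN => e; clear; lia.
  apply: leq_trans aa' _; rewrite (_ : 16 * N * (a' %/ N) = 8 * (2 * (N * (a' %/ N))))%N; last by ring.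
  by rewrite leq_mul2l h1 orbT.
have Xbig : (8 * N <= #|X|)%N by apply: leq_trans YX.
have TXs j u : u \in A1 -> (#|X| <= 16 * N * #|T j u|)%N.
  by move=> uA; have [_ ->] := TX j u uA; apply: ceilN.
have TYs j u : u \notin A1 -> (#|Y| <= 16 * N * #|T j u|)%N.
  by move=> uA; have [_ ->] := TY j u uA; apply: ceilN.
have Tbig j u : u != x -> 2 * rho * n <= #|T j u|%:R.
  move=> _; have hT : (#|Y| <= 16 * N * #|T j u|)%N.
    by have [/(TXs j)|/(TYs j)//] := boolP (u \in A1); apply: leq_trans.
  have N16 : 0 < (16 * N)%:R :> R by rewrite ltr0n muln_gt0.
  rewrite -(ler_pM2l N16) -natrM; apply: (@le_trans _ _ #|Y|%:R); last by rewrite ler_nat.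
  apply: le_trans rho_Y; rewrite !natrM le_eqVlt; apply/orP; left; apply/eqP; ring.
have half (Z : {set V}) (B C : {set V}) : (#|Z| <= 16 * N * #|B|)%N -> (#|B| <= 2 * #|C|)%N ->
    eta * #|Z|%:R <= #|C|%:R.
  move=> h1 h2; have h3 : #|Z|%:R <= (32 * N)%:R * #|C|%:R :> R.
    rewrite -natrM ler_nat; apply: leq_trans h1 _.
    rewrite (_ : 32 * N * #|C| = 16 * N * (2 * #|C|))%N; last by ring.
    by rewrite leq_mul2l h2 orbT.
  apply: (le_trans (ler_wpM2l (ltW eta0) h3)); rewrite mulrA -[leRHS]mul1r.
  by rewrite ler_wpM2r.
have Treg j z (A B : {set V}) : z \in M -> A \subset T j z.1 -> B \subset T j z.2 ->
  (#|T j z.1| <= 2 * #|A|)%N -> (#|T j z.2| <= 2 * #|B|)%N ->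
  d * (#|A|%:R * #|B|%:R) <= (ecount (adj G) A B)%:R.
  move=> zM A_T B_T hA hB; have z1A : z.1 \in A1 by apply: imset_f.
  (* As [M] is a matching, a second end is not the first end of any pair, so its class lies in
     [Y]. *)
  have z2A : z.2 \notin A1.
    apply/imsetP => -[z' z'M z2]; have [z12 _ _ _] := Mok zM.
    have [zz'|zz'] := eqVneq z z'; first by rewrite z2 zz' eqxx in z12.
    have := Mdis zM z'M zz'; rewrite -setI_eq0 => /eqP/setP/(_ z.2).
    by rewrite !inE eqxx orbT z2 eqxx.
  have [TX1 _] := TX j _ z1A; have [TY1 _] := TY j _ z2A.
  apply: reg.
  - by apply: subset_trans A_T (subset_trans TX1 X2X).
  - by apply: subset_trans B_T (subset_trans TY1 Y2Y).
  - by apply: half hA; apply: TXs.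
  - by apply: half hB; apply: TYs.
have Tdis' j u w v : u != x -> w != x -> v \in T j u -> v \in T j w -> u = w.
  by move=> _ _ h1 h2; have [_ ->] := Tdis _ _ _ _ _ h1 h2.
(* [X1] and [Y1] make up at least a fraction [1 / (64 k)] of [X] and [Y], so regularity passes to
   them with this parameter. *)
pose eta1 := (64 * k)%:R * eta.
have eta1P : 0 < eta1 by rewrite mulr_gt0 // ltr0n.
have reg1 (A B : {set V}) : A \subset X1 -> B \subset Y1 ->
    eta1 * #|X1|%:R <= #|A|%:R -> eta1 * #|Y1|%:R <= #|B|%:R ->
    d * (#|A|%:R * #|B|%:R) <= (ecount (adj G) A B)%:R.
  move=> AX BY hA hB; apply: reg.
  - exact: subset_trans AX X1X.
  - exact: subset_trans BY Y1Y.
  - apply: le_trans hA; rewrite /eta1 [_ * eta]mulrC -mulrA ler_wpM2l ?(ltW eta0) // -natrM ler_nat.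
    by apply: leq_trans sX1 _; rewrite leq_mul2r (leq_trans _ (leq_pmulr 64 k0)) ?orbT.
  - by apply: le_trans hB; rewrite /eta1 [_ * eta]mulrC -mulrA ler_wpM2l ?(ltW eta0) // -natrM ler_nat.
have mX : (2 * (m * k) <= #|X1|)%N.
  by apply: leq_trans s12; rewrite leq_mul2l [(m * k)%N]mulnC leq_mul2l mh !orbT.
have tiles_prob := tiles_ill_spread_probability E p01' d01 eta1P reg1 eta_q eta_qk mh mX.
pose q' := expR (- (d ^+ #|M| * (rho ^+ k * K%:R ^+ 2) / (4 * 2 ^+ k))).
have spread_prob := spread_probability G p01 n0 c_ge1 Hc gam01.
have many_prob := many_roots_probability G p01 n0 c_ge1 Hc HK Mok Mdis d01 rho01 cK.
have few_prob := few_roots_probability p01 n0 c_ge1 Hc HK Mok Mdis d01 rho01 Tdis' Tbig Treg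
   rhoK (erefl q') (le_trans yK y1).
pose Q (S : {set {set V}}) := [&& spread F gam S, many_roots F G x M d rho K S, few_roots F G x M K T S &
   good_tiles E (adj G) X1 Y1 d m q S].
have factor S : Q S -> tiled F (edges G :|: S) [set: V].
  case/and4P=> Ssp Sm Sf /existsP[t /andP[tI /andP[tS tgood]]].
  have copies := spread_copies k0 gam_g Ssp.
  apply: (tiled_setT x d0 h0 q0 g0 dX12 (dis _ _ X1X Y1Y) (dis _ _ X1X Y2Y) (dis _ _ X2X Y1Y)
    dXY2 dY12 copies _ _ _ tI tS tgood slack bl bs _ a1l ms ml divk (a2 := Num.truncn (d * #|X2|%:R))).
  - move=> v /degX; rewrite -(ler_nat R); apply: le_trans; rewrite truncn_le.
    by rewrite !mulr_ge0 // ?invr_ge0 // ltW.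
  - move=> v /degY; rewrite -(ler_nat R); apply: le_trans; rewrite truncn_le.
    by rewrite mulr_ge0 // ltW.
  - move=> L LR Lg.
    have TRes j u : u != x -> [disjoint ~: (X1 :|: X2 :|: Y1 :|: Y2) & T j u].
      move=> _; have TS : T j u \subset X2 :|: Y2.
        have [/(TX j)[h1 _]|/(TY j)[h1 _]] := boolP (u \in A1).
          by apply: subset_trans h1 (subsetUl _ _).
        by apply: subset_trans h1 (subsetUr _ _).
      rewrite -setI_eq0; apply/eqP/setP => v; rewrite !inE; apply/negP => /andP[vn /(subsetP TS)].
      by rewrite inE; case/orP=> vv; move: vn; rewrite vv !orbT.
    have [W [WS tW cW]] := rooted_cover Mok rho01 (fun i j u w v _ _ => Tdis i j u w v) Tbig Treg TRes
       rhoK g_rho Kr Sm Sf LR (ltnW Lg).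
    exists W; split=> //; apply: subset_trans WS _; apply/bigcupsP => j _; apply/bigcupsP => u _.
    have [/(TX j)[h1 _]|/(TY j)[h1 _]] := boolP (u \in A1).
      by apply: subset_trans h1 (subsetUl _ _).
    by apply: subset_trans h1 (subsetUr _ _).
  - rewrite truncn_ge_nat ?mulr_ge0 ?(ltW d0) //.
    have : #|X|%:R <= 8 * #|X2|%:R :> R by rewrite -natrM ler_nat.
    move=> h1; have := le_trans g_X (ler_wpM2l (ltW d0) h1); rewrite mulrCA.
    by rewrite ler_pM2l.
have tiles_ex S : spread F gam S -> tiles_exist E X1 m S.
  move=> Ssp; apply: (@tiles_exist_copies U V F S X1 g m) (spread_copies k0 gam_g Ssp).
  apply: leq_trans s12; rewrite mul2n -addnn; apply: leq_add.
    apply: leq_trans (leq_trans gh _); last by rewrite leq_pmull.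
    by rewrite mulnA leq_pmull // muln_gt0 q0.
  by rewrite mulnC leq_mul2l mh orbT.
have mass_ge0 H : 0 <= gnp_mass p H.
  rewrite /gnp_mass prodr_ge0 // => e _; case: ifP => _; case/andP: p01' => // *.
  by rewrite subr_ge0.
apply: (@le_trans _ _ (gnp_prob p (fun H => Q (edges H)))); last first.
  rewrite /gnp_prob [leRHS](bigID (fun H => Q (edges H))) /=.
  apply: (@le_trans _ _ (\sum_(H | has_factor F (gunion G H) && Q (edges H)) gnp_mass p H)); last first.
    by rewrite lerDl sumr_ge0.
  rewrite le_eqVlt; apply/orP; left; apply/eqP; apply: eq_bigl => H.
  rewrite andbC; case: (boolP (Q _)) => //= QH.
  by apply/esym/tiled_has_factor/factor.
rewrite gnp_probE.
pose b1 (S : {set {set V}}) : R := (~~ spread F gam S)%:R.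
pose b2 (S : {set {set V}}) : R := (~~ many_roots F G x M d rho K S)%:R.
pose b3 (S : {set {set V}}) : R := (~~ few_roots F G x M K T S)%:R.
pose b4 (S : {set {set V}}) : R := (tiles_exist E X1 m S && ~~ good_tiles E (adj G) X1 Y1 d m q S)%:R.
(* Since [spread] provides tiles, a failure of [Q] is one of the four events [b1] to [b4]; in
   particular [good_tiles] can fail only through [b4] once [spread] holds. *)
have key : 1 <= bexp p (enum (pairs V)) (fun S => (Q S)%:R) +
    (bexp p (enum (pairs V)) b1 + bexp p (enum (pairs V)) b2 + bexp p (enum (pairs V)) b3 +
     bexp p (enum (pairs V)) b4).
  rewrite -!bexpD -[leLHS](bexp_cst p (enum (pairs V))); apply: le_bexp => // S _.
  rewrite /b1 /b2 /b3 /b4 /Q.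
  case: (boolP (spread F gam S)) => [/tiles_ex ->|_] /=.
    case: (many_roots _ _ _ _ _ _ _ S); case: (few_roots _ _ _ _ _ _ S);
    by case: (good_tiles _ _ _ _ _ _ _ S) => /=; lra.
  by rewrite -subr_ge0 (_ : _ - 1 = (~~ many_roots F G x M d rho K S)%:R +
     (~~ few_roots F G x M K T S)%:R +
     (tiles_exist E X1 m S && ~~ good_tiles E (adj G) X1 Y1 d m q S)%:R) ?addr_ge0 //; ring.
(* The exponential bound [2 ^- h] is weakened to [1 / h], with [h >= #|Y| / (64 k)]. *)
have p4 : bexp p (enum (pairs V)) b4 <= (64 * k)%:R / #|Y|%:R.
  have Y0 : 0 < #|Y|%:R :> R by rewrite ltr0n; apply: leq_trans Y_k.
  rewrite ler_pdivlMr //.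
  have b40 : 0 <= bexp p (enum (pairs V)) b4 by apply: bexp_ge0.
  apply: (@le_trans _ _ (bexp p (enum (pairs V)) b4 * ((64 * k)%:R * 2 ^+ h))).
    rewrite ler_wpM2l // -natrX -natrM ler_nat; apply: leq_trans sY1 _.
    by rewrite leq_mul2l ltnW ?orbT // ltn_expl.
  by rewrite mulrCA -[leRHS]mulr1 ler_wpM2l.
have p3 : bexp p (enum (pairs V)) b3 <= r.+1%:R * #|V|.+1%:R * y.
  by apply: (le_trans few_prob); rewrite card_ord ler_wpM2l // mulr_ge0.
exact: lower_bound_of_cover key spread_prob many_prob p3 p4.
Qed.

End Perturbed.

(** * Asymptotics *)

Section Asymptotics.
Variable R : realType.
Implicit Types (n k q N r K a e : nat).

(** The bound [1 / (1 + sum of 1 / f i)] avoids a minimum over a possibly empty index set. *)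
Lemma finite_lower_bound (I : finType) (P : pred I) (f : I -> R) :
  (forall i, P i -> 0 < f i) -> exists2 b, 0 < b & forall i, P i -> b <= f i.
Proof.
move=> f0; have s0 : 0 <= \sum_(i | P i) (f i)^-1.
  by apply: sumr_ge0 => i /f0 fi; rewrite invr_ge0 ltW.
exists (1 + \sum_(i | P i) (f i)^-1)^-1; first by rewrite invr_gt0 ltr_pwDl.
move=> i Pi; rewrite -[leRHS]invrK lef_pV2 ?posrE ?invr_gt0 ?f0 ?ltr_pwDl //.
rewrite (bigD1 i) //= addrCA lerDl addr_ge0 // sumr_ge0 // => j /andP[/f0 fj _].
by rewrite invr_ge0 ltW.
Qed.

Lemma powR_edge_bound (n c p m s : R) (a e : nat) : 1 <= n -> 1 <= c ->
  c * n `^ (- m^-1) <= p -> s <= a%:R - e%:R / m ->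
  c ^+ e * n `^ s <= n ^+ a * p ^+ e.
Proof.
move=> n1 c1 cp sa; have n0 : 0 < n by apply: lt_le_trans n1.
have c0 : 0 < c by apply: lt_le_trans c1.
have w0 : 0 < n `^ (- m^-1) by apply: powR_gt0.
apply: (@le_trans _ _ (c ^+ e * n `^ (a%:R - e%:R / m))).
  by rewrite ler_wpM2l ?exprn_ge0 ?(ltW c0) ?ler_powR.
rewrite powRD; last by rewrite (gt_eqF n0) implybT.
rewrite powR_mulrn ?(ltW n0) //.
have -> : n `^ (- (e%:R / m)) = (n `^ (- m^-1)) ^+ e.
  by rewrite -powR_mulrn ?(ltW w0) // -powRrM mulNr mulrC.
rewrite mulrCA ler_wpM2l ?exprn_ge0 ?(ltW n0) // -exprMn.
by apply: lerXn2r; rewrite ?nnegrE ?mulr_ge0 ?(ltW c0) ?(ltW w0) // (le_trans _ cp) // mulr_ge0 ?(ltW c0) ?(ltW w0).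
Qed.

(** With [z = n ^ (beta / 2)], the logarithm is linear in [z] while the power is [z ^+ 2]; [Z]
    collects the constants beyond which the square wins. *)
Lemma log_vs_power (beta A : R) : 0 < beta -> 0 < A -> exists n0 : nat, forall n, (n0 <= n)%N ->
  A * (1 + ln n.+1%:R) <= (Num.truncn (n%:R `^ beta))%:R.
Proof.
move=> b0 A0; pose B := 2 * A / beta; pose Z := 2 + 2 * A + B.
have B0 : 0 < B by rewrite !mulr_gt0 // invr_gt0.
exists (Num.truncn (Z `^ (2 / beta))).+1 => n hn.
have nZ : Z `^ (2 / beta) <= n%:R.
  by apply: ltW; apply: lt_le_trans (truncnS_gt _) _; rewrite ler_nat.
have Z0 : 0 < Z by rewrite /Z; move: A0 B0; lra.
have n0 : 0 < n%:R :> R by apply: lt_le_trans nZ; apply: powR_gt0.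
have n1 : 1 <= n%:R :> R by move: n0; rewrite ltr0n ler1n.
pose z := n%:R `^ (beta / 2).
have zZ : Z <= z.
  have -> : Z = (Z `^ (2 / beta)) `^ (beta / 2).
    rewrite -powRrM (_ : 2 / beta * (beta / 2) = 1) ?powRr1 ?(ltW Z0) //.
    by field; rewrite lt0r_neq0.
  by apply: ge0_ler_powR; rewrite ?nnegrE ?powR_ge0 ?divr_ge0 ?(ltW b0) ?(ltW n0).
have zE : n%:R `^ beta = z ^+ 2.
  rewrite /z -powR_mulrn ?powR_ge0 // -powRrM; congr (_ `^ _); by field.
have lnn : ln n.+1%:R <= 1 + 2 / beta * z.
  apply: (@le_trans _ _ (ln (2 * n%:R))).
    rewrite ler_ln ?posrE ?ltr0n // ?mulr_gt0 // -natrM ler_nat.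
    by move: n1; rewrite ler1n; clear; lia.
  rewrite lnM ?posrE //; apply: lerD.
    have := le_ln1Dx (x := 1 : R); apply; lra.
  have z0 : 0 < z by apply: lt_le_trans zZ.
  have := ltW (ln_sublinear z0); rewrite /z ln_powR -/z => h.
  have -> : ln (n%:R : R) = 2 / beta * (beta / 2 * ln n%:R) by field; rewrite lt0r_neq0.
  by rewrite ler_wpM2l // divr_ge0 // ltW.
have Kz : z ^+ 2 - 1 <= (Num.truncn (n%:R `^ beta))%:R.
  have := ltW (truncnS_gt (n%:R `^ beta)); rewrite -natr1 zE; lra.
apply: le_trans Kz; apply: (@le_trans _ _ (A * (2 + 2 / beta * z))).
  by rewrite ler_wpM2l ?(ltW A0) //; move: lnn; lra.
have -> : A * (2 + 2 / beta * z) = 2 * A + B * z by rewrite /B; field; rewrite lt0r_neq0.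
have zz : z * Z <= z ^+ 2 by rewrite expr2 ler_wpM2l // (le_trans (ltW Z0)).
have z1 : 1 <= z by apply: le_trans zZ; rewrite /Z; move: A0 B0; lra.
have Az : 2 * A <= 2 * A * z by rewrite ler_peMr // mulr_ge0 // ltW.
by move: zz z1 Az; rewrite /Z; lra.
Qed.

(** Rounding down costs at most a factor 2, so [(2 * K) ^ r >= n ^ 2]; one factor [n] pays for
    [(2 * k) ^ r]. *)
Lemma power_exceeds (beta : R) k r n : 2 <= beta * r%:R -> (0 < n)%N ->
  (0 < Num.truncn ((n%:R : R) `^ beta))%N -> ((2 * k) ^ r < n)%N ->
  (k ^ r * n < Num.truncn ((n%:R : R) `^ beta) ^ r)%N.
Proof.
move=> br n0 K0 kn; set K := Num.truncn _ in K0 *.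
have n1 : 1 <= n%:R :> R by rewrite ler1n.
have h1 : (n%:R : R) `^ beta <= (2 * K)%:R.
  apply: (le_trans (ltW (truncnS_gt _))); rewrite ler_nat -/K.
  by move: K0; clear; case: K => // K _; lia.
have h2 : (n ^ 2 <= (2 * K) ^ r)%N.
  rewrite -(ler_nat R) !natrX; apply: (@le_trans _ _ ((n%:R `^ beta) ^+ r)); last first.
    by apply: lerXn2r; rewrite ?nnegrE ?powR_ge0.
  rewrite -powR_mulrn ?powR_ge0 // -powRrM -powR_mulrn //.
  exact: ler_powR.
have P2 : (0 < 2 ^ r)%N by rewrite expn_gt0.
rewrite -(ltn_pmul2l P2) -expnMn; apply: leq_trans h2.
by rewrite mulnA -expnMn expnS expn1 ltn_mul2r n0.
Qed.

Lemma few_roots_bound (kap z : R) n K : (0 < K)%N -> 4 * ln n.+1%:R <= kap * K%:R ->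
  kap * K%:R ^+ 2 <= z -> n.+1%:R ^+ K.+1 * expR (- z) <= (n.+1%:R ^+ 2)^-1.
Proof.
move=> K0 hK hz; have n0 : 0 < n.+1%:R :> R by rewrite ltr0n.
have L0 : 0 <= ln n.+1%:R :> R by rewrite ln_ge0 // ler1n.
have p0 : 0 < n.+1%:R ^+ 2 :> R by rewrite exprn_gt0.
rewrite -[leRHS]mul1r ler_pdivlMr // mulrAC -exprD expRN ler_pdivrMr ?expR_gt0 // mul1r.
rewrite -[n.+1%:R in leLHS]lnK ?posrE // -expRM_natl ler_expR; apply: le_trans hz.
(* The exponent of [n.+1] is [K + 3], at most [4 * K]. *)
apply: (@le_trans _ _ ((4 * K)%:R * ln n.+1%:R)).
  by rewrite ler_wpM2r // ler_nat; move: K0; clear; lia.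
rewrite natrM mulrAC expr2 mulrA ler_wpM2r //.
Qed.

Lemma union_bound_exp (z : R) n k : k.+1%:R * n%:R <= z ->
  2 ^+ (n * k) * expR (- z) <= n.+1%:R^-1.
Proof.
move=> hz; have e2 : 2 <= expR 1 :> R by have := expR_ge1Dx (1 : R); lra.
apply: (@le_trans _ _ (expR ((n * k)%:R * 1) * expR (- z))).
  rewrite ler_wpM2r ?expR_ge0 // expRM_natl; apply: lerXn2r; rewrite ?nnegrE ?expR_ge0 //.
rewrite mulr1 -expRD; apply: (@le_trans _ _ (expR (- n%:R))).
  rewrite ler_expR natrM; move: hz; rewrite -natr1 mulrDl mul1r [k%:R * _]mulrC; lra.
rewrite expRN lef_pV2 ?posrE ?expR_gt0 ?ltr0n //.
by rewrite -nat1r; apply: expR_ge1Dx.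
Qed.

Lemma divM_le (c : R) (C a : nat) : 0 <= c -> (0 < C)%N -> (a <= C)%N -> c / C%:R * a%:R <= c.
Proof.
move=> c0 C0 aC; rewrite mulrAC ler_pdivrMr ?ltr0n // ler_wpM2l // ler_nat //.
Qed.

Lemma small_regularity (c : R) k N q : 0 < c <= 1 -> (0 < k)%N -> (0 < N)%N -> (0 < q)%N ->
  exists2 eta, 0 < eta & [/\ eta * (64 * k)%:R <= c, eta * (32 * N)%:R <= 1,
    (64 * k)%:R * eta * q%:R <= c & k%:R * ((64 * k)%:R * eta) * 2 ^+ (k.+3 * q) <= 1].
Proof.
move=> /andP[c0 c1] k0 N0 q0.
pose b1 := (64 * k)%N; pose b2 := (32 * N)%N; pose b3 := (64 * k * q)%N.
pose b4 := (k * (64 * k) * 2 ^ (k.+3 * q))%N.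
have [p1 p2 p3 p4] : [/\ (0 < b1)%N, (0 < b2)%N, (0 < b3)%N & (0 < b4)%N].
  by split; rewrite !muln_gt0 ?k0 ?N0 ?q0 ?expn_gt0.
pose C := (b1 * b2 * b3 * b4)%N.
have posM a b : (0 < a)%N -> (0 < b)%N -> (0 < a * b)%N by move=> a0 b0; rewrite muln_gt0 a0.
have p12 := posM _ _ p1 p2; have p123 := posM _ _ p12 p3; have C0 := posM _ _ p123 p4.
have l4 : (b4 <= C)%N := leq_pmull _ p123.
have l3 : (b3 <= C)%N := leq_trans (leq_pmull _ p12) (leq_pmulr _ p4).
have l12 : (b1 * b2 <= C)%N := leq_trans (leq_pmulr _ p3) (leq_pmulr _ p4).
have l1 : (b1 <= C)%N by apply: leq_trans l12; rewrite leq_pmulr.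
have l2 : (b2 <= C)%N by apply: leq_trans l12; rewrite leq_pmull.
have ce b : (b <= C)%N -> c / C%:R * b%:R <= c by apply: divM_le => //; apply: ltW.
exists (c / C%:R); first by rewrite divr_gt0 // ltr0n.
split; first exact: ce.
- by apply: le_trans c1; apply: ce.
- by rewrite [(64 * k)%:R * _]mulrC -mulrA -natrM; apply: ce.
apply: le_trans c1; rewrite -natrX mulrA -natrM mulrAC -natrM mulrC; exact: ce.
Qed.

End Asymptotics.

Lemma edges_le_ecount (V : finType) (G : sgraph V) :
  (#|edges G| <= ecount (adj G) [set: V] [set: V])%N.
Proof.
rewrite ecount_card; set A := [set z | _].
apply: leq_trans (leq_imset_card (fun z : V * V => [set z.1; z.2]) A).
apply: subset_leq_card; apply/subsetP => e eG.
have := subsetP (edges_sub G) _ eG; rewrite inE => /cards2P[a [b [_ eab]]].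
by apply/imsetP; exists (a, b); rewrite // !inE /= /adj -eab.
Qed.

Lemma adj_irr (V : finType) (G : sgraph V) : irreflexive (adj G).
Proof.
move=> a; apply/negP => aG; have := subsetP (edges_sub G) _ aG.
by rewrite inE setUid cards1.
Qed.

Lemma small_tile_size (R : realType) (xi d : R) (k N q : nat) :
  0 < xi <= 1 -> 0 < d <= 1 -> (0 < k)%N -> (0 < N)%N -> (0 < q)%N ->
  exists2 gam : R, 0 < gam <= 1 & forall (n : R) (g : nat), 0 <= n -> g%:R <= gam * n ->
    [/\ (64 * k * (q * (k.+1 * g)))%:R <= xi * n, (32 * N * (k * g))%:R <= xi * n &
        (8 * (2 * (k * g) + g))%:R <= d * (xi * n)].
Proof.
case/andP=> x0 x1 /andP[d0 d1] k0 N0 q0.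
pose b1 := (64 * k * (q * k.+1))%N; pose b2 := (32 * N * k)%N; pose b3 := (8 * (2 * k + 1))%N.
have [p1 p2 p3] : [/\ (0 < b1)%N, (0 < b2)%N & (0 < b3)%N].
  by split; rewrite !muln_gt0 ?k0 ?N0 ?q0 // addn1.
have posM a b : (0 < a)%N -> (0 < b)%N -> (0 < a * b)%N by move=> a0 b0; rewrite muln_gt0 a0.
pose C := (b1 * b2 * b3)%N; have C0 : (0 < C)%N by apply: (posM _ _ (posM _ _ p1 p2) p3).
have l1 : (b1 <= C)%N := leq_trans (leq_pmulr _ p2) (leq_pmulr _ p3).
have l2 : (b2 <= C)%N := leq_trans (leq_pmull _ p1) (leq_pmulr _ p3).
have l3 : (b3 <= C)%N := leq_pmull _ (posM _ _ p1 p2).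
have dx0 : 0 <= d * xi by rewrite mulr_ge0 // ltW.
have CR : 0 < C%:R :> R by rewrite ltr0n.
exists (d * xi / C%:R).
  rewrite divr_gt0 ?mulr_gt0 //= ler_pdivrMr // mul1r; apply: (@le_trans _ _ 1).
    by rewrite -[leRHS]mul1r ler_pM // ltW.
  by rewrite ler1n.
move=> n g n0 gn.
have ce b : (b <= C)%N -> (b * g)%:R <= d * (xi * n).
  move=> bC; rewrite natrM; apply: (le_trans (ler_wpM2l (ler0n _ b) gn)).
  rewrite (_ : b%:R * _ = d * xi / C%:R * b%:R * n); last by ring.
  by rewrite [leRHS]mulrA ler_wpM2r // divM_le.
have dle : d * (xi * n) <= xi * n by rewrite ler_piMl // mulr_ge0 // ltW.
split.
- by rewrite (_ : 64 * k * (q * (k.+1 * g)) = b1 * g)%N ?(le_trans (ce _ l1)) // /b1 !mulnA.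
- by rewrite mulnA (le_trans (ce _ l2)).
rewrite (_ : 8 * (2 * (k * g) + g) = b3 * g)%N ?ce //.
by rewrite /b3 -mulnA mulnDl mul1n mulnA.
Qed.

Lemma div_lower_bound (R : realType) (a : R) (g k : nat) : (0 < k)%N ->
  a < g.+1%:R -> 2 * k%:R <= a -> a / (2 * k%:R) <= (g %/ k)%:R.
Proof.
move=> k0 ag ak; have kR : 0 < k%:R :> R by rewrite ltr0n.
rewrite ler_pdivrMr ?mulr_gt0 //.
have : (g.+1 <= (g %/ k).+1 * k)%N by rewrite ltn_ceil.
rewrite -(ler_nat R) natrM -[(g %/ k).+1%:R]natr1 mulrDl mul1r => h.
by have := lt_le_trans ag h; lra.
Qed.

Lemma perturbed_factor (R : realType) (U : finType) (F : sgraph U) (eps : R) :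
  (0 < #|edges F|)%N -> ~ forest F -> 0 < eps ->
  exists2 c : R, 0 < c & forall delta : R, 0 < delta ->
    exists n0 : nat, forall n : nat, (n0 <= n)%N -> (#|U| %| n)%N ->
    forall (p : R) (V : finType) (G : sgraph V), 0 <= p <= 1 ->
      c * n%:R `^ (- (m1 R F)^-1) <= p -> #|V| = n ->
      eps * n%:R ^+ 2 <= #|edges G|%:R ->
      1 - delta <= gnp_prob p (fun H => has_factor F (gunion G H)).
Proof.
move=> F_edge F_cyclic eps0; have m_gt1 := m1_gt1 R F_cyclic.
set m := m1 R F in m_gt1 *; have m0 : 0 < m by apply: lt_trans m_gt1.
have [x _] : exists x : U, true.
  case/card_gt0P: F_edge => e eF; have := subsetP (edges_sub F) _ eF.
  by rewrite inE => /cards2P[a _]; exists a.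
pose k := #|U|; have k0 : (0 < k)%N by apply/card_gt0P; exists x.
have [M [Mok Mdis Mstrict]] := matching_in_tight_sets m_gt1 x.
pose E' := edges F :\: [set [set z.1; z.2] | z in M].
(* This is the exponent of [n] gained at the root after deleting the matching; strictness and
   finiteness of [U] give a uniform [b0]. *)
have gap (D : {set U}) : (x \in D) && (2 <= #|D|)%N ->
    0 < #|D|%:R - 1 - #|induced E' D|%:R / m.
  by case/andP=> xD D2; rewrite subr_gt0 ltr_pdivrMr // mulrC; apply: Mstrict.
have [b0 b0P hb0] := finite_lower_bound gap.
(* [K] will be about [n ^ beta], so that [K ^ 3] fits into the gain [n ^ b0]. *)
pose beta := b0 / 3; have beta0 : 0 < beta by rewrite divr_gt0.
pose r := (Num.truncn (2 / beta)).+1.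
have br : 2 <= beta * r%:R.
  by rewrite [leRHS]mulrC -ler_pdivrMr //; apply: ltW; apply: truncnS_gt.
pose N := (r.+1 * k)%N; have N0 : (0 < N)%N by rewrite muln_gt0.
pose e1 := Num.min eps 1.
have e10 : 0 < e1 by rewrite lt_min eps0 ltr01.
have e11 : e1 <= 1 by rewrite ge_min lexx orbT.
have e1e : e1 <= eps by rewrite ge_min lexx.
(* The bipartition keeps a quarter of the adjacent ordered pairs, and the regular pair guarantees
   half of its density. *)
pose e0 := e1 / 4; pose d := e0 / 2.
have e0P : 0 < e0 by rewrite divr_gt0.
have e0_1 : e0 <= 1 by rewrite /e0; move: e11 e10; clear; lra.
have d01 : 0 < d <= 1 by rewrite divr_gt0 //= /d; move: e0_1 e0P; clear; lra.
have /andP[d0 d1] := d01.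
pose c1 := d ^+ k.
have c1b : 0 < c1 <= 1 by rewrite exprn_gt0 //= exprn_ile1 // ltW.
have c1d : c1 <= d by rewrite -[leRHS]expr1; apply: ler_wiXn2l; rewrite // ltW.
have c10 : 0 < c1 by case/andP: c1b.
pose q := (Num.truncn (12 / c1)).+1.
have qP : 12 <= c1 * q%:R.
  by rewrite [leRHS]mulrC -ler_pdivrMr //; apply: ltW; apply: truncnS_gt.
have [eta eta0 [et1 et2 et3 et4]] := small_regularity c1b k0 N0 (ltn0Sn _ : (0 < q)%N).
pose s := Num.truncn (4 / eta ^+ 2).
have sP : 4 <= s.+1%:R * eta ^+ 2.
  by rewrite -ler_pdivrMr ?exprn_gt0 //; apply: ltW; apply: truncnS_gt.
pose xi := e0 ^+ s.+1.
have xi0 : 0 < xi by rewrite exprn_gt0.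
have xi01 : 0 < xi <= 1 by rewrite xi0 exprn_ile1 // ltW.
have [gam' g'01 hg'] := small_tile_size xi01 d01 k0 N0 (ltn0Sn _ : (0 < q)%N).
have /andP[g'0 g'1] := g'01.
have kR1 : 1 <= k%:R :> R by rewrite ler1n.
have kR0 : 0 < k%:R :> R by rewrite ltr0n.
pose gam := gam' / (2 * k%:R).
have gam0 : 0 < gam by rewrite divr_gt0 // mulr_gt0.
have gam01 : 0 < gam <= 1.
  by rewrite gam0 ler_pdivrMr ?mulr_gt0 // mul1r; move: kR1 g'1; clear; lra.
have N32 : 0 < (32 * N)%:R :> R by rewrite ltr0n muln_gt0.
pose rho := xi / (32 * N)%:R.
have rho0 : 0 < rho by rewrite divr_gt0.
have rho01 : 0 < rho <= 1.
  rewrite rho0 ler_pdivrMr // mul1r; case/andP: xi01 => _ h; apply: (le_trans h).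
  by rewrite ler1n muln_gt0.
have f0 : 0 < 4 * 2 ^+ k :> R by rewrite mulr_gt0 // exprn_gt0.
pose kap1 := gam ^+ k / (4 * 2 ^+ k); pose kap2 := d ^+ #|M| * rho ^+ k / (4 * 2 ^+ k).
have kap10 : 0 < kap1 by rewrite divr_gt0 // exprn_gt0.
have kap20 : 0 < kap2 by rewrite divr_gt0 // mulr_gt0 // exprn_gt0.
(* Both exponents [kap1 * c * n] and [kap2 * c * n] then reach [(k + 1) * n], beating the
   [2 ^ (n k)] families with [expR (- n)] to spare. Nothing here depends on [delta]. *)
pose c := 1 + k.+1%:R / kap1 + k.+1%:R / kap2.
have t10 : 0 <= k.+1%:R / kap1 by rewrite divr_ge0 // ltW.
have t20 : 0 <= k.+1%:R / kap2 by rewrite divr_ge0 // ltW.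
have c_ge1 : 1 <= c by rewrite /c; move: t10 t20; clear; lra.
have ck1 : k.+1%:R <= kap1 * c.
  by rewrite [leRHS]mulrC -ler_pdivrMr // /c; move: t10 t20; clear; lra.
have ck2 : k.+1%:R <= kap2 * c.
  by rewrite [leRHS]mulrC -ler_pdivrMr // /c; move: t10 t20; clear; lra.
exists c; first exact: lt_le_trans c_ge1.
move=> delta delta0.
(* Three demands on [K] in one: [4 * ln n.+1 <= kap2 * K], [1 <= rho * K] and [c <= K]. *)
pose A := 4 / kap2 + rho^-1 + c.
have A1 : 0 < 4 / kap2 by rewrite divr_gt0.
have A2 : 0 < rho^-1 by rewrite invr_gt0.
have A0 : 0 < A by rewrite /A; move: A1 A2 c_ge1; clear; lra.
have [nK hK] := log_vs_power beta0 A0.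
pose T1 := (64 * k + 8 * N + 64 * k * q)%:R / xi.
pose T2 := 2 * k%:R / gam'.
pose T3 := ((2 * k) ^ r).+1%:R : R.
pose T4 := (r%:R + 3 + (64 * k)%:R / xi) / delta.
have T10 : 0 <= T1 by rewrite divr_ge0 // ltW.
have T20 : 0 <= T2 by rewrite divr_ge0 ?mulr_ge0 // ltW.
have T30 : 0 <= T3 by [].
have T40 : 0 <= T4 by rewrite divr_ge0 ?(ltW delta0) // !addr_ge0 // divr_ge0 // ltW.
exists (maxn nK (Num.truncn (T1 + T2 + T3 + T4)).+1) => n hn nk p V G p01 cp Vn eG.
have [hnK hnT] : (nK <= n)%N /\ T1 + T2 + T3 + T4 <= n%:R.
  move: hn; rewrite geq_max => /andP[-> h]; split=> //.
  by apply: ltW; apply: lt_le_trans (truncnS_gt _) _; rewrite ler_nat.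
have [nT1 nT2 nT3 nT4] : [/\ T1 <= n%:R, T2 <= n%:R, T3 <= n%:R & T4 <= n%:R].
  by move: hnT T10 T20 T30 T40; clear; split; lra.
have nT3' : ((2 * k) ^ r < n)%N by move: nT3; rewrite ler_nat.
have n0 : (0 < n)%N by apply: leq_ltn_trans nT3'.
have nR0 : 0 < n%:R :> R by rewrite ltr0n.
have nR1 : 1 <= n%:R :> R by rewrite ler1n.
have xin : (64 * k + 8 * N + 64 * k * q)%:R <= xi * n%:R.
  by rewrite [leRHS]mulrC -ler_pdivrMr.
have gamn : 2 * k%:R <= gam' * n%:R by rewrite [leRHS]mulrC -ler_pdivrMr.
pose K := Num.truncn ((n%:R : R) `^ beta).
have hKn : A * (1 + ln n.+1%:R) <= K%:R by apply: hK.
have L0 : 0 <= ln n.+1%:R :> R by rewrite ln_ge0 // ler1n.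
have KA : A <= K%:R by apply: le_trans hKn; rewrite ler_peMr ?(ltW A0) // lerDl.
have K_rho : rho^-1 <= K%:R by apply: le_trans KA; rewrite /A; move: A1 c_ge1; clear; lra.
have K_c : c <= K%:R by apply: le_trans KA; rewrite /A; move: A1 A2; clear; lra.
have K0 : (0 < K)%N by rewrite -(ltr0n R); apply: lt_le_trans K_rho.
have K_log : 4 * ln n.+1%:R <= kap2 * K%:R.
  have h : 4 / kap2 * ln n.+1%:R <= K%:R.
    apply: le_trans hKn; rewrite mulrDr mulr1.
    apply: (@le_trans _ _ (A * ln n.+1%:R)); last by rewrite lerDr ltW.
    by rewrite ler_wpM2r // /A; move: A2 c_ge1; clear; lra.
  have -> : 4 * ln n.+1%:R = kap2 * (4 / kap2 * ln n.+1%:R) by field; rewrite lt0r_neq0.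
  by rewrite ler_wpM2l // ltW.
have p0 : 0 < p.
  by apply: lt_le_trans cp; rewrite mulr_gt0 ?powR_gt0 // (lt_le_trans _ c_ge1).
have p01' : 0 < p <= 1 by rewrite p0; case/andP: p01.
pose g := Num.truncn (gam' * n%:R).
have gn0 : 0 <= gam' * n%:R by rewrite mulr_ge0 // ltW.
have /andP[g1 g2] := truncn_itv gn0; rewrite -/g in g1 g2.
have [hg1 hg2 hg3] := hg' _ _ (ltW nR0) g1.
have gpos : (0 < g)%N by rewrite truncn_gt0; apply: le_trans gamn; move: kR1; clear; lra.
have [A0' eA] := bipartition_ecount R (@adj_irr V G).
have eAB : e0 * #|V|%:R ^+ 2 <= (ecount (adj G) A0' (~: A0'))%:R.
  rewrite /e0 mulrAC ler_pdivrMr // mulrC [leRHS]mulrC -natrM.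
  apply: (@le_trans _ _ (ecount (adj G) [set: V] [set: V])%:R); last by rewrite ler_nat.
  apply: (@le_trans _ _ #|edges G|%:R); last by rewrite ler_nat edges_le_ecount.
  by apply: le_trans eG; rewrite Vn mulrC ler_wpM2r // exprn_ge0.
have V0 : (0 < #|V|)%N by rewrite Vn.
have disA : [disjoint A0' & ~: A0'] by rewrite -setI_eq0 setICr.
have [X0 [Y0 [dXY0 X0n Y0n reg0]]] := dense_regular_pair e0P eta0 sP disA V0 eAB.
rewrite -/xi Vn in X0n Y0n.
(* Regularity is symmetric; [Y] is made the smaller side because the tiles to be matched with its
   vertices must fit into [X]. *)
have [X [Y [dXY YX Yn reg]]] : exists X Y : {set V}, [/\ [disjoint X & Y], (#|Y| <= #|X|)%N,
    xi * n%:R <= #|Y|%:R & forall B C : {set V}, B \subset X -> C \subset Y ->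
      eta * #|X|%:R <= #|B|%:R -> eta * #|Y|%:R <= #|C|%:R ->
      d * (#|B|%:R * #|C|%:R) <= (ecount (adj G) B C)%:R].
  have [YX|/ltnW XY] := leqP #|Y0| #|X0|; first by exists X0, Y0.
  exists Y0, X0; split=> //; first by rewrite disjoint_sym.
  move=> B C BY CX hB hC; rewrite (ecountC _ _ (@adjC V G)) [#|B|%:R * _]mulrC.
  exact: reg0.
have XY_R : #|Y|%:R <= #|X|%:R :> R by rewrite ler_nat.
have Ynat a : a%:R <= xi * n%:R -> (a <= #|Y|)%N.
  by move=> h; rewrite -(ler_nat R); apply: le_trans h Yn.
have Ysum a : (a <= 64 * k + 8 * N + 64 * k * q)%N -> (a <= #|Y|)%N.
  by move=> h; apply: Ynat; apply: le_trans xin; rewrite ler_nat.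
have Hc (D : {set U}) : induced (edges F) D != set0 ->
    c * #|V|%:R <= #|V|%:R ^+ #|D| * p ^+ #|induced (edges F) D|.
  move=> Dn; have D0 : D != set0.
    apply: contraNneq Dn => ->; apply/eqP/setP => e; rewrite !inE; apply/negP => /andP[eF].
    rewrite subset0 => /eqP e0'; have := subsetP (edges_sub F) _ eF.
    by rewrite inE e0' cards0.
  have s1 : 1 <= #|D|%:R - #|induced (edges F) D|%:R / m.
    have := induced_edges_le R F D0; rewrite -/m mulrC -ler_pdivrMr //; clear; lra.
  have := powR_edge_bound nR1 c_ge1 cp s1; rewrite powRr1 ?(ltW nR0) // Vn; apply: le_trans.
  rewrite ler_wpM2r ?(ltW nR0) // -[leLHS]expr1 ler_weXn2l //.
  by rewrite card_gt0.
have HK (D : {set U}) : x \in D -> (2 <= #|D|)%N ->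
    K%:R ^+ 3 * #|V|%:R <= #|V|%:R ^+ #|D| * p ^+ #|induced E' D|.
  move=> xD D2.
  have s1 : 1 + 3 * beta <= #|D|%:R - #|induced E' D|%:R / m.
    by have := hb0 D; rewrite xD D2 => /(_ isT); rewrite /beta; clear; lra.
  have := powR_edge_bound nR1 c_ge1 cp s1; rewrite Vn; apply: le_trans.
  rewrite powRD; last by rewrite (gt_eqF nR0) implybT.
  rewrite powRr1 ?(ltW nR0) // mulrC [leRHS]mulrCA ler_wpM2l ?(ltW nR0) //.
  apply: (@le_trans _ _ (n%:R `^ (3 * beta))); last first.
    by rewrite ler_peMl ?powR_ge0 // exprn_ege1.
  rewrite mulrC powRrM powR_mulrn ?powR_ge0 //.
  apply: lerXn2r; rewrite ?nnegrE ?powR_ge0 //.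
  by rewrite /K truncn_le powR_ge0.
pose y : R := (n.+1%:R ^+ 2)^-1.
have yK : #|V|.+1%:R ^+ K.+1 *
    expR (- (d ^+ #|M| * (rho ^+ k * K%:R ^+ 2) / (4 * 2 ^+ k))) <= y.
  rewrite Vn; apply: few_roots_bound K0 K_log _; rewrite /kap2 le_eqVlt; apply/orP; left.
  by apply/eqP; rewrite mulrAC !mulrA.
have y1 : y <= 1 by rewrite invf_le1 ?exprn_gt0 ?ltr0n // exprn_ege1 // ler1n.
have rho_n : rho * n%:R * (32 * N)%:R <= xi * n%:R.
  by rewrite /rho mulrAC divfK ?lt0r_neq0.
have kap1E z : kap1 * z = gam ^+ k * z / (4 * 2 ^+ k) by rewrite /kap1 mulrAC.
have kap2E z : kap2 * z = d ^+ #|M| * (rho ^+ k * z) / (4 * 2 ^+ k).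
  by rewrite /kap2 mulrAC !mulrA.
have bound1 : 2 ^+ (#|V| * k) * expR (- (gam ^+ k * (c * #|V|%:R) / (4 * 2 ^+ k))) <= n.+1%:R^-1.
  by rewrite Vn; apply: union_bound_exp; rewrite -kap1E mulrA ler_wpM2r // ltW.
have bound2 : 2 ^+ (#|V| * k) *
    expR (- (d ^+ #|M| * (rho ^+ k * (c * #|V|%:R)) / (4 * 2 ^+ k))) <= n.+1%:R^-1.
  by rewrite Vn; apply: union_bound_exp; rewrite -kap2E mulrA ler_wpM2r // ltW.
have sum_bounds (a b r' z : R) : a <= b -> a + a + (r' + 1) * b + z * b <= (r' + 3 + z) * b.
  by clear => ab; lra.
have inv_n : n.+1%:R^-1 <= n%:R^-1 :> R by rewrite lef_pV2 ?posrE ?ltr0n // ler_nat.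
have bound3 : r.+1%:R * #|V|.+1%:R * y <= r.+1%:R / n%:R.
  rewrite Vn /y expr2 invfM -mulrA ler_wpM2l //.
  by rewrite mulrA divff ?mul1r // lt0r_neq0 // ltr0n.
have YR0 : 0 < #|Y|%:R :> R by apply: lt_le_trans Yn; rewrite mulr_gt0.
have bound4 : (64 * k)%:R / #|Y|%:R <= (64 * k)%:R / xi / n%:R.
  by rewrite -mulrA -invfM ler_wpM2l // lef_pV2 ?posrE ?mulr_gt0.
have total : (r%:R + 3 + (64 * k)%:R / xi) / n%:R <= delta.
  by rewrite ler_pdivrMr // [leRHS]mulrC -ler_pdivrMr.
apply: le_trans (perturbed_factor_probability (x := x) (M := M) (p := p) (c := c) (d := d)
  (eta := eta) (rho := rho) (gam := gam) (y := y) (K := K) (r := r) (q := q) (g := g)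
  (X := X) (Y := Y) p01' c_ge1 Hc HK Mok Mdis d01 dXY YX eta0 reg _ _ _ _ _ _ _ _ qP rho01 _ gpos
  _ _ gam01 _ K_c _ _ yK y1 _).
- rewrite lerD2l lerN2; apply: le_trans total.
  apply: (le_trans (lerD (lerD (lerD bound1 bound2) bound3) bound4)).
  have -> : r.+1%:R = r%:R + 1 :> R by rewrite natr1.
  exact: sum_bounds.
- by apply: Ysum; rewrite -addnA leq_addr.
- by apply: Ysum; rewrite addnAC leq_addl.
- by apply: Ysum; rewrite leq_addl.
- exact: Ynat.
- exact: le_trans et1 c1d.
- exact: et2.
- exact: et3.
- exact: et4.
- by rewrite Vn; apply: le_trans rho_n Yn.
- by rewrite Vn /rho mulrAC ler_pdivlMr // -natrM mulnC.
- rewrite -natrM; apply: (le_trans hg3); rewrite ler_wpM2l ?(ltW d0) //.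
  exact: le_trans Yn XY_R.
- by rewrite Vn /gam mulrAC; apply: div_lower_bound.
- by rewrite [leRHS]mulrC -ler_pdivrMr // div1r.
- by rewrite Vn; apply: power_exceeds br n0 K0 nT3'.
- by rewrite Vn.
Qed.

From mathcomp Require Import all_classical all_reals all_analysis.
Local Open Scope classical_set_scope.
Local Open Scope ring_scope.

Theorem theorem1p5 (R : realType) (U : finType) (F : sgraph U)
    (F_edge : (0 < #|edges F|)%N) (F_cyclic : ~ forest F)
    (eps : R) (eps_gt0 : 0 < eps) :
  exists2 c : R, 0 < c &
    forall delta : R, 0 < delta ->
    \forall n \near \oo, (#|U| %| n)%N ->
    forall (p : R) (V : finType) (G : sgraph V),
      0 <= p <= 1 ->
      c * n%:R `^ (- (m1 R F)^-1) <= p ->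
      #|V| = n ->
      eps * n%:R ^+ 2 <= #|edges G|%:R ->
      1 - delta <= gnp_prob p (fun H => has_factor F (gunion G H)).
Proof.
have [c c0 Hc] := perturbed_factor F_edge F_cyclic eps_gt0.
exists c => // delta d0; have [n0 Hn] := Hc delta d0.
by exists n0 => // n /= hn; apply: Hn.
Qed.
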